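(* There exists a unique family of evolution operators $U(t,\tau)\in\mathfrak L(L^2(\Omega,m))$, $0\le\tau\le t\le T$, such that: 1) $U(\tau,\tau)=\mathrm{Id}$ for $0\le\tau\le T$; 2) $U(t,\tau)U(\tau,\sigma)=U(t,\sigma)$ for $0\le\sigma\le\tau\le t\le T$; 3) $\|U(t,\tau)\|_{\mathfrak L(L^2(\Omega,m))}\le1$ for every $0\le\tau\le t\le T$, and $U(t,\tau)$, $0\le\tau\le t<T$, is a strongly continuous contractive family on $L^2(\Omega,m)$; 4) the map $t\mapsto U(t,\tau)$ is differentiable in $(\tau,T]$ with values in $\mathfrak L(L^2(\Omega,m))$ and $\frac{\partial U(t,\tau)}{\partial t}=A(t)U(t,\tau)$; 5) $A(t)U(t,\tau)$ is an $\mathfrak L(L^2(\Omega,m))$-valued continuous function for $0\le\tau<t\le T$; moreover, there exists a constant $C>0$ such that $\|A(t)U(t,\tau)\|_{\mathfrak L(L^2(\Omega,m))}\le\frac C{t-\tau}$ for $0\le\tau<t<T$.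
   Context: Setting. $\Omega\subset\mathbb R^N$ is a bounded $(\varepsilon,\delta)$ domain, i.e. $\Omega$ is open and connected and, with $d(x)=\inf_{y\notin\Omega}|x-y|$, whenever $x,y\in\Omega$ and $|x-y|<\delta$ there is a rectifiable arc $\gamma\subset\Omega$ joining $x$ to $y$ with length $\ell(\gamma)\le\frac1\varepsilon|x-y|$ and $d(z)\ge\frac{\varepsilon|x-z||y-z|}{|x-y|}$ for all $z\in\gamma$. The boundary $\partial\Omega$ is a $d$-set, $0<d\le N$: there are a Borel measure $\mu$ with $\operatorname{supp}\mu=\partial\Omega$ and constants $c_1,c_2>0$ with $c_1r^d\le\mu(B(x,r)\cap\partial\Omega)\le c_2r^d$ for every $x\in\partial\Omega$ and $0<r\le1$. Moreover $\Omega=\bigcup_n\Omega_n$ with $\Omega_n$ bounded Lipschitz domains and $\Omega_n\subseteq\Omega_{n+1}$. The number $s\in(0,1)$ satisfies $N-d<2s<N$, $\alpha:=s-\frac{N-d}2\in(0,1)$, and $T>0$ is fixed. $\mathfrak L(X)$ denotes the bounded linear operators on $X$. $H^s(\Omega)$ has norm $\|u\|_{H^s(\Omega)}^2=\|u\|_{L^2(\Omega)}^2+\iint_{\Omega\times\Omega}\frac{(u(x)-u(y))^2}{|x-y|^{N+2s}}\,d\mathcal L_N(x)\,d\mathcal L_N(y)$ ($\mathcal L_N$ Lebesgue measure). The trace is $u|_{\partial\Omega}(x)=\lim_{r\to0}\frac1{|B(x,r)\cap\Omega|}\int_{B(x,r)\cap\Omega}u\,d\mathcal L_N$ ($\mu$-a.e.);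 it maps $H^s(\Omega)$ boundedly onto the Besov space $B^{2,2}_\alpha(\partial\Omega)$, whose norm is $\|u\|^2=\|u\|_{L^2(\partial\Omega,\mu)}^2+\iint_{|x-y|<1}\frac{|u(x)-u(y)|^2}{|x-y|^{d+2\alpha}}\,d\mu(x)\,d\mu(y)$. $m=\mathcal L_N+\mu$ (Lebesgue measure on $\Omega$ plus $\mu$ on $\partial\Omega$), $\|u\|_{L^2(\Omega,m)}^2=\|u\|_{L^2(\Omega)}^2+\|u|_{\partial\Omega}\|_{L^2(\partial\Omega)}^2$; $H^s(\Omega)\subset L^2(\Omega,m)$ through traces. Data. $K:[0,T]\times\Omega\times\Omega\to\mathbb R$ and $\zeta:[0,T]\times\partial\Omega\times\partial\Omega\to\mathbb R$ are measurable, symmetric in the last two variables, with $k_1\le K\le k_2$ and $\zeta_1\le\zeta\le\zeta_2$ a.e. for constants $0<k_1<k_2$, $0<\zeta_1<\zeta_2$; $b\in L^\infty([0,T]\times\partial\Omega)$ with $\inf b>b_0>0$; and for a fixed exponent $\eta\in(\frac12,1)$ and constants $c,C$: $|b(t,P)-b(\tau,P)|\le c|t-\tau|^\eta$, $|K(t,x,y)-K(\tau,x,y)|\le C|t-\tau|^\eta$, $|\zeta(t,x,y)-\zeta(\tau,x,y)|\le C|t-\tau|^\eta$ for $t,\tau\in[0,T]$ and (almost) all points. $C_{N,s}=\frac{s2^{2s}\Gamma(\frac{N+2s}2)}{\pi^{N/2}\Gamma(1-s)}$. For $u,v\in H^s(\Omega)$, $$E(t,u,v)=\frac{C_{N,s}}2\iint_{\Omega\times\Omega}K(t,x,y)\frac{(u(x)-u(y))(v(x)-v(y))}{|x-y|^{N+2s}}\,d\mathcal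 L_N(x)\,d\mathcal L_N(y)+\int_{\partial\Omega}b(t,P)\,u|_{\partial\Omega}v|_{\partial\Omega}\,d\mu+\langle\Theta^t_\alpha(u|_{\partial\Omega}),v|_{\partial\Omega}\rangle,$$ where $\langle\Theta^t_\alpha(u),v\rangle=\iint_{\partial\Omega\times\partial\Omega}\zeta(t,x,y)\frac{(u(x)-u(y))(v(x)-v(y))}{|x-y|^{d+2\alpha}}\,d\mu(x)\,d\mu(y)$. This is a closed symmetric form on $L^2(\Omega,m)$, and $A(t)$ is the unique selfadjoint non-positive operator on $L^2(\Omega,m)$ with dense domain $D(A(t))\subset H^s(\Omega)$ such that $E(t,u,v)=(-A(t)u,v)_{L^2(\Omega,m)}$ for $u\in D(A(t))$, $v\in H^s(\Omega)$. *)

(* Defs.v *)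
From HB Require Import structures.
From mathcomp Require Import all_boot all_order all_algebra.
From mathcomp Require Import all_classical all_reals all_analysis.
From mathcomp Require Import measurable_realfun ess_sup_inf.

Set Implicit Arguments.
Unset Strict Implicit.
Unset Printing Implicit Defensive.

Import Order.TTheory GRing.Theory Num.Theory.
Import numFieldNormedType.Exports.

Local Open Scope classical_set_scope.
Local Open Scope ring_scope.

Section borel_rV.
Context (R : realType) (N : nat).

Definition borel_rV : set (set 'rV[R]_N) := <<s [set U | open U] >>.

Let borel_rV0 : borel_rV set0. Proof. exact: sigma_algebra0. Qed.

Let borel_rVC (A : set 'rV[R]_N) : borel_rV A -> borel_rV (~` A).
Proof. exact: sigma_algebraC. Qed.

Let borel_rV_bigcup (F : (set 'rV[R]_N)^nat) :
  (forall i, borel_rV (F i)) -> borel_rV (\bigcup_i F i).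
Proof. exact: sigma_algebra_bigcup. Qed.

HB.instance Definition _ := @isMeasurable.Build default_measure_display
  'rV[R]_N borel_rV borel_rV0 borel_rVC borel_rV_bigcup.

Lemma open_measurable_rV (U : set 'rV[R]_N) : open U -> measurable U.
Proof. by move=> oU; exact: sub_sigma_algebra. Qed.

Lemma closed_measurable_rV (F : set 'rV[R]_N) : closed F -> measurable F.
Proof.
move=> cF; rewrite -(setCK F); apply: measurableC.
by apply: open_measurable_rV; rewrite openC.
Qed.

(* The library balls of ['rV[R]_N] are boxes. *)
Lemma open_rV_bigcup_ball (U : set 'rV[R]_N) : open U ->
  U = \bigcup_(z in [set z : {ffun 'I_N -> rat} * nat |
      ball (\row_j (ratr (z.1 j) : R)) z.2.+1%:R^-1 `<=` U])
    ball (\row_j (ratr (z.1 j) : R)) z.2.+1%:R^-1.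
Proof.
move=> oU; apply/seteqP; split => [x Ux|x [z /= zU]]; last exact: zU.
have /nbhs_ballP[e /= e0 xeU] : nbhs x U by exact: open_nbhs_nbhs.
have [k ke] : exists k, k.+1%:R^-1 < e / 2 :> R.
  have e20 : 0 < e / 2 by rewrite divr_gt0.
  exists (Num.truncn (e / 2)^-1).
  rewrite invf_plt ?posrE//; exact: truncnS_gt.
have k0 : 0 < k.+1%:R^-1 :> R by rewrite invr_gt0.
have qP j : exists q : rat, ball (ratr q : R) k.+1%:R^-1 (x ord0 j).
  have : x ord0 j - k.+1%:R^-1 < x ord0 j + k.+1%:R^-1.
    by rewrite ltrBlDr -addrA ltrDl addr_gt0.
  move=> /rat_in_itvoo[q]; rewrite in_itv/= => /andP[q1 q2]; exists q.
  by rewrite /ball/= ltr_distlC; apply/andP; split;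
    [rewrite ltrBlDr | rewrite -ltrBlDr].
pose q := [ffun j => sval (cid (qP j))].
have xq : ball (\row_j (ratr (q j) : R)) k.+1%:R^-1 x.
  split => // i j; rewrite ord1 mxE /q ffunE.
  exact: (svalP (cid (qP j))).
exists (q, k) => //= y qy; apply: xeU.
have := ball_triangle (ball_sym xq) qy.
apply: le_ball; apply/ltW.
by rewrite [ltRHS](splitr e) ltrD.
Qed.

Definition row_of_tuple (t : N.-tuple R) : 'rV[R]_N := \row_j tnth t j.
Definition tuple_of_row (v : 'rV[R]_N) : N.-tuple R :=
  [tuple v ord0 j | j < N].

Lemma row_of_tupleK : cancel row_of_tuple tuple_of_row.
Proof. by move=> t; apply: eq_from_tnth => j; rewrite tnth_mktuple mxE. Qed.

Lemma measurable_row_of_tuple : measurable_fun [set: N.-tuple R] row_of_tuple.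
Proof.
apply: (@measurability _ _ _ _ _ _ [set U : set 'rV[R]_N | open U]) => //.
move=> _ [U oU <-]; rewrite setTI (open_rV_bigcup_ball oU) preimage_bigcup.
set I := ({ffun 'I_N -> rat} * nat)%type; set P := [set z : I | _].
set F := (X in bigcup _ X).
have -> : \bigcup_(z in P) F z = \bigcup_n
    (if unpickle n is Some z then if z \in P then F z else set0 else set0).
  apply/seteqP; split => [x [z Pz Fz]|x [n _]].
    by exists (pickle z) => //; rewrite pickleK mem_set.
  by case: unpickle => [z|//]; case: ifPn => // /set_mem Pz Fz; exists z.
apply: bigcupT_measurable => n; case: unpickle => [z|//]; case: ifPn => // _.
rewrite (_ : F z = \bigcap_(j in [set: 'I_N])
    (fun t : N.-tuple R => tnth t j) @^-1` ball (ratr (z.1 j) : R) z.2.+1%:R^-1).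
  apply: fin_bigcap_measurable => // j _; rewrite -[X in measurable X]setTI.
  by apply: measurable_tnth => //; apply: open_measurable; exact: ball_open.
apply/seteqP; split => [t [_ tz] j _|t tz].
  by have := tz ord0 j; rewrite !mxE.
by split => [|i j]; [rewrite invr_gt0|rewrite !mxE; exact: tz].
Qed.

Lemma measurable_tuple_of_row : measurable_fun [set: 'rV[R]_N] tuple_of_row.
Proof.
apply/measurable_fun_tnthP => j.
rewrite (_ : _ \o _ = fun v : 'rV[R]_N => v ord0 j); last first.
  by apply/funext => v /=; rewrite tnth_mktuple.
apply: (measurability _ (RGenOpens.measurableE R)) => //.
move=> _ [_ [a [b ->]] <-]; rewrite setTI; apply: open_measurable_rV.
apply: open_comp => [v _|]; first exact: coord_continuous.
exact: interval_open.
Qed.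
End borel_rV.

Lemma pushforward_sigma_finite d1 d2 (T1 : measurableType d1)
    (T2 : measurableType d2) (R : realType) (m : set T1 -> \bar R)
    (f : T1 -> T2) (g : T2 -> T1) :
  measurable_fun setT g -> cancel f g -> sigma_finite setT m ->
  sigma_finite setT (pushforward m f).
Proof.
move=> mg fK [F FT Foo]; exists (fun k => g @^-1` F k).
  by rewrite -preimage_bigcup -FT preimage_setT.
move=> k; have [mF mFoo] := Foo k; split.
  by rewrite -[X in measurable X]setTI; exact: mg.
by rewrite /pushforward -comp_preimage (_ : g \o f = id)//; exact/funext.
Qed.

(* Stated as a lemma because the instance of [{sigma_finite_measure _}] on
   [m1 \x m2] is not found by inference. *)
Lemma product_sigma_finite d1 d2 (T1 : measurableType d1)
    (T2 : measurableType d2) (R : realType)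
    (m1 : {sigma_finite_measure set T1 -> \bar R})
    (m2 : {sigma_finite_measure set T2 -> \bar R}) :
  sigma_finite setT (m1 \x m2)%E.
Proof.
have /sigma_finiteP[F [TF ndF Foo]] := sigma_finiteT m1.
have /sigma_finiteP[G [TG ndG Goo]] := sigma_finiteT m2.
exists (fun n => F n `*` G n).
  rewrite -setXTT TF TG predeqE => -[x y]; split.
    move=> [/= [n _ Fnx] [k _ Gky]]; exists (maxn n k) => //; split.
    - by move: x Fnx; exact/subsetPset/ndF/leq_maxl.
    - by move: y Gky; exact/subsetPset/ndG/leq_maxr.
  by move=> [n _ []/= ? ?]; split; exists n.
move=> k; have [? ?] := Foo k; have [? ?] := Goo k.
split; first exact: measurableX.
by rewrite product_measure1E// lte_mul_pinfty// ge0_fin_numE.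
Qed.

Section lebesgue_rV.
Context {R : realType}.

Definition tuple_cons n (z : R * n.-tuple R) : n.+1.-tuple R :=
  [tuple of z.1 :: z.2].

Definition tuple_uncons n (t : n.+1.-tuple R) : R * n.-tuple R :=
  (thead t, [tuple of behead t]).

Lemma tuple_consK n : cancel (@tuple_cons n) (@tuple_uncons n).
Proof. by case=> x t; congr pair; apply/val_inj. Qed.

Lemma measurable_tuple_cons n : measurable_fun setT (@tuple_cons n).
Proof. exact: measurable_cons. Qed.

Lemma measurable_tuple_uncons n : measurable_fun setT (@tuple_uncons n).
Proof.
apply/measurable_fun_pairP; split; first exact: measurable_tnth.
exact: measurable_behead.
Qed.

Section lebesgue_cons.
Context (n : nat) (m : {sigma_finite_measure set (n.-tuple R) -> \bar R}).

Definition lebesgue_cons : set (n.+1.-tuple R) -> \bar R :=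
  pushforward (@lebesgue_measure R \x m)%E (@tuple_cons n).

Let mcons := @measurable_tuple_cons n.

Let lebesgue_cons0 : lebesgue_cons set0 = 0%E. Proof. exact: measure0. Qed.

Let lebesgue_cons_ge0 A : (0 <= lebesgue_cons A)%E. Proof. exact: measure_ge0. Qed.

Let lebesgue_cons_sigma_additive : semi_sigma_additive lebesgue_cons.
Proof. exact: measure_semi_sigma_additive. Qed.

HB.instance Definition _ := isMeasure.Build _ _ _ lebesgue_cons
  lebesgue_cons0 lebesgue_cons_ge0 lebesgue_cons_sigma_additive.

Let lebesgue_cons_sigma_finite : sigma_finite setT lebesgue_cons.
Proof.
apply: (pushforward_sigma_finite _ (@tuple_consK n)) => /=.
  exact: measurable_tuple_uncons.
have := product_sigma_finite (@lebesgue_measure R) m.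
exact.
Qed.

HB.instance Definition _ := @Measure_isSigmaFinite.Build _ _ _ lebesgue_cons
  lebesgue_cons_sigma_finite.

End lebesgue_cons.

Fixpoint lebesgue_tuple n : {sigma_finite_measure set (n.-tuple R) -> \bar R} :=
  if n is n'.+1 then lebesgue_cons (lebesgue_tuple n')
  else \d_ [tuple].

Section lebesgue_rV.
Context (n : nat).

Definition lebesgue_rV : set 'rV[R]_n -> \bar R :=
  pushforward (lebesgue_tuple n) (@row_of_tuple R n).

Let mrow := @measurable_row_of_tuple R n.

Let lebesgue_rV0 : lebesgue_rV set0 = 0%E. Proof. exact: measure0. Qed.

Let lebesgue_rV_ge0 A : (0 <= lebesgue_rV A)%E. Proof. exact: measure_ge0. Qed.

Let lebesgue_rV_sigma_additive : semi_sigma_additive lebesgue_rV.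
Proof. exact: measure_semi_sigma_additive. Qed.

HB.instance Definition _ := isMeasure.Build _ _ _ lebesgue_rV
  lebesgue_rV0 lebesgue_rV_ge0 lebesgue_rV_sigma_additive.

Let lebesgue_rV_sigma_finite : sigma_finite setT lebesgue_rV.
Proof.
exact: pushforward_sigma_finite (@measurable_tuple_of_row R n)
  (@row_of_tupleK R n) (sigma_finiteT _).
Qed.

HB.instance Definition _ := @Measure_isSigmaFinite.Build _ _ _ lebesgue_rV
  lebesgue_rV_sigma_finite.

End lebesgue_rV.

Lemma lebesgue_tuple_box n (A : 'I_n -> set R) :
  (forall j, measurable (A j)) ->
  measurable [set t : n.-tuple R | forall j, A j (tnth t j)] /\
  lebesgue_tuple n [set t | forall j, A j (tnth t j)] =
    (\prod_(j < n) @lebesgue_measure R (A j))%E.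
Proof.
elim: n A => [|n IH] A mA.
  have -> : [set t : 0.-tuple R | forall j, A j (tnth t j)] = setT.
    by apply/seteqP; split => // t _ [].
  by split; [|rewrite /= big_ord0 diracT].
have [mB lB] := IH (fun j => A (lift ord0 j)) (fun j => mA _).
set B := [set t | _] in mB lB.
set C := [set t | _].
have CB : @tuple_cons n @^-1` C = A ord0 `*` B.
  apply/seteqP; split => [[x t] /= Ct|[x t] /= [Ax Bt] j].
    by split => [|j]; [exact: (Ct ord0)|have := Ct (lift ord0 j); rewrite tnthS].
  case: (unliftP ord0 j) => [i ->|->//]; rewrite tnthS; exact: Bt.
have mC : measurable C.
  have -> : C = @tuple_uncons n @^-1` (A ord0 `*` B).
    by rewrite -CB -comp_preimage; apply/seteqP; split => t /=;
      rewrite /tuple_uncons /tuple_cons /= -?tuple_eta.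
  rewrite -[X in measurable X]setTI; apply: measurable_tuple_uncons => //.
  exact: measurableX.
split=> //; rewrite /= /lebesgue_cons /pushforward CB big_ord_recl -lB.
have /= := product_measure1E (@lebesgue_measure R) (lebesgue_tuple n)
  (mA ord0) mB.
exact.
Qed.

(* On boxes this determines the measure. *)
Lemma lebesgue_rV_box n (A : 'I_n -> set R) : (forall j, measurable (A j)) ->
  lebesgue_rV [set v : 'rV[R]_n | forall j, A j (v ord0 j)] =
    (\prod_(j < n) @lebesgue_measure R (A j))%E.
Proof.
move=> /lebesgue_tuple_box[_ <-]; rewrite /lebesgue_rV /pushforward.
congr (lebesgue_tuple n _); apply/seteqP.
by split => t /= tA j; have := tA j; rewrite mxE.
Qed.
End lebesgue_rV.
Arguments lebesgue_rV {R} n.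

Section Lspace_normedModType.
Context d (T : measurableType d) (R : realType).
Context (mu : {measure set T -> \bar R}) (p : \bar R) (p1 : (1 <= p)%E).
Local Notation L := (LspaceType mu p1).

Lemma ae_eq_Lnorm (f g : T -> R) : measurable_fun setT f ->
  measurable_fun setT g -> f = g %[ae mu] ->
  'N[mu]_p[EFin \o f]%E = 'N[mu]_p[EFin \o g]%E.
Proof.
move=> mf mg fg; rewrite unlock /Lnorm; case: p p1 => [r r1|_|//].
  congr (_ `^ _)%E; apply: ae_eq_integral => //.
  - apply: (measurableT_comp (measurable_poweR _)).
    by apply: measurableT_comp => //; exact/measurable_EFinP.
  - apply: (measurableT_comp (measurable_poweR _)).
    by apply: measurableT_comp => //; exact/measurable_EFinP.
  - by apply: filterS fg => x /= /(_ I) ->.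
case: ifPn => // _; apply: eq_ess_sup.
by apply: filterS fg => x /= /(_ I) ->.
Qed.

(* [Lspace_of_Lfun] sends a p-integrable function to its class and
   [Lfun_of_Lspace] picks a representative; the vector space and norm
   structures of L^p are those of the functions, transported to classes. *)
Lemma LspaceP (u : L) : (u : T -> R) \in Lfun mu p.
Proof.
apply/andP; split; rewrite inE; last exact: Lebesgue_finite.
exact: (measurable_funPT (repr (u : {mfun_ mu, T >-> measurableTypeR R}))).
Qed.

Definition Lfun_of_Lspace (u : L) : LfunType mu p1 := Lfun_Sub p1 (LspaceP u).

Definition mfun_of_Lfun (f : LfunType mu p1) : {mfun T >-> measurableTypeR R} :=
  MeasurableFun.Pack (MeasurableFun.Class
    (isMeasurableFun.Build _ _ T (measurableTypeR R) f (measurable_funPT f))).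

Definition Lclass (f : LfunType mu p1) : {mfun_ mu, T >-> measurableTypeR R} :=
  \pi_({mfun_ mu, T >-> measurableTypeR R})%qT (mfun_of_Lfun f).

Lemma ae_eq_Lclass (f : LfunType mu p1) : (Lclass f : T -> R) = f %[ae mu].
Proof.
have /eqmodP/asboolP := reprK (Lclass f).
exact.
Qed.

Lemma finite_norm_Lclass (f : LfunType mu p1) : finite_norm mu p (Lclass f).
Proof.
rewrite /finite_norm (ae_eq_Lnorm _ _ (ae_eq_Lclass f)).
- exact: Lfunction_finite.
- exact: (measurable_funPT (repr (Lclass f))).
- exact: measurable_funPT.
Qed.

Definition Lspace_of_Lfun (f : LfunType mu p1) : L :=
  LebesgueSpace.Pack (LebesgueSpace.Class
    (isFinLebesgue.Build _ _ _ _ _ p1 _ (finite_norm_Lclass f))).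

Lemma Lspace_of_LfunK f : Lfun_of_Lspace (Lspace_of_Lfun f) = f %[ae mu].
Proof. exact: ae_eq_Lclass. Qed.

Lemma LspaceE (u v : L) :
  Lfun_of_Lspace u = Lfun_of_Lspace v %[ae mu] <-> u = v.
Proof.
split=> [|->]; last by apply: filterE.
case: u v => u [[uP]] [v [[vP]]] uv; have E : u = v.
  by rewrite -[u]reprK -[v]reprK; apply/eqmodP/asboolP.
by move: vP uv; rewrite -E => vP _; rewrite (Prop_irrelevance uP vP).
Qed.

HB.instance Definition _ := gen_eqMixin L.
HB.instance Definition _ := gen_choiceMixin L.

Local Notation fn := Lfun_of_Lspace.
Local Notation cls := Lspace_of_Lfun.

Lemma Lspace_of_Lfun_eq (f g : LfunType mu p1) : f = g %[ae mu] <-> cls f = cls g.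
Proof.
split=> [fg|fg].
  apply/LspaceE; apply: (ae_eq_trans (Lspace_of_LfunK f)).
  exact/(ae_eq_trans fg)/ae_eq_sym/Lspace_of_LfunK.
apply: (ae_eq_trans (ae_eq_sym (Lspace_of_LfunK f))); rewrite fg.
exact: Lspace_of_LfunK.
Qed.

Lemma Lfun_of_LspaceK u : cls (fn u) = u.
Proof. by apply/LspaceE; exact: Lspace_of_LfunK. Qed.

Definition Lspace_add (u v : L) : L := cls ((fn u) + (fn v)).
Definition Lspace_opp (u : L) : L := cls (- (fn u)).
Definition Lspace_scale (a : R) (u : L) : L := cls (a *: (fn u)).

Lemma Lspace_addE f g : Lspace_add (cls f) (cls g) = cls (f + g).
Proof.
apply/Lspace_of_Lfun_eq.
by apply: filterS2 (Lspace_of_LfunK f) (Lspace_of_LfunK g) => x /= + + _ =>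
  /(_ I) /= fx /(_ I) /= gx; rewrite /GRing.add/= fx gx.
Qed.

Lemma Lspace_oppE f : Lspace_opp (cls f) = cls (- f).
Proof.
apply/Lspace_of_Lfun_eq.
by apply: filterS (Lspace_of_LfunK f) => x /= + _ => /(_ I) /= fx;
  rewrite /GRing.opp/= fx.
Qed.

Lemma Lspace_scaleE a f : Lspace_scale a (cls f) = cls (a *: f).
Proof.
apply/Lspace_of_Lfun_eq.
by apply: filterS (Lspace_of_LfunK f) => x /= + _ => /(_ I) /= fx;
  rewrite /GRing.scale/= fx.
Qed.

Let addA : associative Lspace_add.
Proof.
move=> u v w; rewrite -(Lfun_of_LspaceK u) -(Lfun_of_LspaceK v).
by rewrite -(Lfun_of_LspaceK w) !Lspace_addE addrA.
Qed.

Let addC : commutative Lspace_add.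
Proof. by move=> u v; rewrite /Lspace_add addrC. Qed.

Let add0 : left_id (cls 0) Lspace_add.
Proof. by move=> u; rewrite -(Lfun_of_LspaceK u) Lspace_addE add0r. Qed.

Let addN : left_inverse (cls 0) Lspace_opp Lspace_add.
Proof.
by move=> u; rewrite -(Lfun_of_LspaceK u) Lspace_oppE Lspace_addE addNr.
Qed.

HB.instance Definition _ := GRing.isZmodule.Build L addA addC add0 addN.

Let scaleA (a b : R) (u : L) :
  Lspace_scale a (Lspace_scale b u) = Lspace_scale (a * b) u.
Proof. by rewrite -(Lfun_of_LspaceK u) !Lspace_scaleE scalerA. Qed.

Let scale1 : left_id 1 Lspace_scale.
Proof. by move=> u; rewrite -(Lfun_of_LspaceK u) Lspace_scaleE scale1r. Qed.

Let scaleDr : right_distributive Lspace_scale +%R.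
Proof.
move=> a u v; rewrite -(Lfun_of_LspaceK u) -(Lfun_of_LspaceK v).
by rewrite /GRing.add/= Lspace_addE !Lspace_scaleE Lspace_addE scalerDr.
Qed.

Let scaleDl u : {morph Lspace_scale^~ u : a b / a + b}.
Proof.
move=> a b; rewrite -(Lfun_of_LspaceK u) /GRing.add/=.
by rewrite !Lspace_scaleE Lspace_addE scalerDl.
Qed.

HB.instance Definition _ := GRing.Zmodule_isLmodule.Build R L
  scaleA scale1 scaleDr scaleDl.

Definition Lspace_norm (u : L) : R := fine 'N[mu]_p[EFin \o u]%E.

Lemma Lspace_normE f : Lspace_norm (cls f) = fine 'N[mu]_p[EFin \o f]%E.
Proof.
by rewrite /Lspace_norm (ae_eq_Lnorm _ _ (Lspace_of_LfunK f)).
Qed.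

Let normD (u v : L) : Lspace_norm (u + v) <= Lspace_norm u + Lspace_norm v.
Proof.
rewrite -(Lfun_of_LspaceK u) -(Lfun_of_LspaceK v) [X in Lspace_norm X]Lspace_addE.
by rewrite !Lspace_normE; exact: ler_LnormD.
Qed.

Let normZ (a : R) (u : L) : Lspace_norm (a *: u) = `|a| * Lspace_norm u.
Proof.
rewrite -(Lfun_of_LspaceK u) [X in Lspace_norm X]Lspace_scaleE !Lspace_normE.
apply/EFin_inj; rewrite EFinM !finite_norm_fine.
exact: LnormZ.
Qed.

Let norm0 (u : L) : Lspace_norm u = 0 -> u = 0.
Proof.
rewrite -{2}(Lfun_of_LspaceK u) => u0; apply/Lspace_of_Lfun_eq.
exact: (fine_Lnormr_eq0 (f := (fn u))).
Qed.

HB.instance Definition _ := Lmodule_isNormed.Build R L normD normZ norm0.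

End Lspace_normedModType.

Definition L2dot d (T : measurableType d) (R : realType)
    (m : {measure set T -> \bar R}) (u v : LspaceType2 m) : R :=
  \int[m]_x (u x * v x).

Section operators.
Context (R : realType) (H : normedModType R).

Definition opnorm (S : H -> H) : \bar R :=
  ereal_sup [set `|S u|%:E | u in [set u | `|u| <= 1]].

Definition bounded_operator (S : H -> H) : Prop :=
  linear S /\ (opnorm S < +oo)%E.

(* The values of [op_fun] outside of [op_dom] are irrelevant. *)
Record unbounded_operator := UnboundedOperator {
  op_dom : set H;
  op_fun :> H -> H;
  op_dom0 : op_dom 0;
  op_dom_linear : forall (a : R) u v,
    op_dom u -> op_dom v -> op_dom (a *: u + v);
  op_fun_linear : forall (a : R) u v,
    op_dom u -> op_dom v -> op_fun (a *: u + v) = a *: op_fun u + op_fun v }.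

Context (dot : H -> H -> R).

(* The right-hand side of the equivalence says that (v, w) is in the graph of
   [A], the left-hand side that it is in the graph of its adjoint. *)
Definition selfadjoint (A : unbounded_operator) : Prop :=
  dense (op_dom A) /\
  forall v w, (forall u, op_dom A u -> dot (A u) v = dot u w) <->
              (op_dom A v /\ w = A v).

Definition nonpositive (A : unbounded_operator) : Prop :=
  forall u, op_dom A u -> dot (A u) u <= 0.

(* [V] is the domain of the form [E]. *)
Definition form_operator (V : set H) (E : H -> H -> \bar R)
    (A : unbounded_operator) : Prop :=
  [/\ selfadjoint A, nonpositive A, op_dom A `<=` V &
      forall u v, op_dom A u -> V v -> E u v = (dot (- A u) v)%:E].

(* Limits of operators are taken in the operator norm; at [t = T] the
   derivative is one-sided. *)
Record evolution_family (T : R) (A : R -> unbounded_operator)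
    (U : R -> R -> H -> H) : Prop := EvolutionFamily {
  evol_bounded : forall t tau, 0 <= tau <= t -> t <= T ->
    bounded_operator (U t tau);
  evol_id : forall tau, 0 <= tau <= T -> forall u, U tau tau u = u;
  evol_comp : forall t tau sigma,
    0 <= sigma <= tau -> tau <= t <= T ->
    forall u, U t tau (U tau sigma u) = U t sigma u;
  evol_contraction : forall t tau, 0 <= tau <= t -> t <= T ->
    (opnorm (U t tau) <= 1)%E;
  evol_strongly_continuous : forall u,
    {within [set z : R * R | 0 <= z.2 <= z.1 /\ z.1 < T],
      continuous (fun z => U z.1 z.2 u)};
  evol_dom : forall t tau, 0 <= tau < t -> t <= T ->
    forall u, op_dom (A t) (U t tau u);
  evol_derivable : forall t tau, 0 <= tau < t -> t <= T ->
    opnorm (fun u => h^-1 *: (U (t + h) tau u - U t tau u) - A t (U t tau u))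
      @[h --> within [set h | tau < t + h <= T] 0^'] --> 0%E;
  evol_gen_bounded : forall t tau, 0 <= tau < t -> t <= T ->
    bounded_operator (A t \o U t tau);
  evol_gen_continuous : forall t tau, 0 <= tau < t -> t <= T ->
    opnorm (fun u => A z.1 (U z.1 z.2 u) - A t (U t tau u))
      @[z --> within [set z : R * R | 0 <= z.2 < z.1 /\ z.1 <= T]
                (nbhs (t, tau))] --> 0%E;
  evol_gen_bound : exists2 C : R, 0 < C &
    forall t tau, 0 <= tau < t -> t < T ->
      (opnorm (A t \o U t tau) <= (C / (t - tau))%:E)%E }.

End operators.

Section euclidean.
Context (R : realType) (N : nat).
Implicit Types (x y z : 'rV[R]_N) (A : set 'rV[R]_N).

(* The library norm on ['rV[R]_N] is the sup norm. *)
Definition eucl_dot x y : R := \sum_i x ord0 i * y ord0 i.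
Definition eucl_dist x y : R := Num.sqrt (eucl_dot (x - y) (x - y)).
Definition eucl_ball x (r : R) : set 'rV[R]_N := [set y | eucl_dist x y < r].

Definition boundary A : set 'rV[R]_N := closure A `\` A°.

Lemma closed_boundary A : closed (boundary A).
Proof.
apply: closedI; first exact: closed_closure.
by rewrite closedC; exact: open_interior.
Qed.

Definition dist_compl A x : R := inf [set eucl_dist x y | y in ~` A].

Definition arc_length (g : R -> 'rV[R]_N) : \bar R :=
  ereal_sup [set (\sum_(i < size s)
      eucl_dist (g (nth 0 (0 :: s) i)) (g (nth 0 s i)))%:E
    | s in [set s | itv_partition 0 1 s]].

Definition domain A : Prop := [/\ open A, connected A & A !=set0].

(* The factor 1 / |x - y| vanishes for x = y by the convention 0^-1 = 0, and
   the condition is then satisfied by a constant arc. *)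
Definition eps_delta_domain (eps delta : R) A : Prop :=
  domain A /\
  forall x y, A x -> A y -> eucl_dist x y < delta ->
    exists g : R -> 'rV[R]_N,
      [/\ {within `[0, 1], continuous g}, g 0 = x, g 1 = y &
      [/\ g @` `[0, 1] `<=` A,
          (arc_length g <= (eps^-1 * eucl_dist x y)%:E)%E &
          forall z, (g @` `[0, 1]) z ->
            eps * eucl_dist x z * eucl_dist y z / eucl_dist x y <= dist_compl A z]].

Lemma eps_delta_domain_open eps delta A :
  eps_delta_domain eps delta A -> open A.
Proof. by move=> [[]]. Qed.

(* Near each boundary point [A] is the region above the graph, in the
   direction of a unit vector [e], of a Lipschitz function on the hyperplane
   orthogonal to [e]. *)
Definition lipschitz_domain A : Prop :=
  domain A /\
  forall x, boundary A x -> exists e phi k (V : set 'rV[R]_N),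
    [/\ eucl_dot e e = 1, (forall y z, `|phi y - phi z| <= k * eucl_dist y z :> R),
        open_nbhs x V &
        A `&` V = V `&` [set y | phi (y - eucl_dot y e *: e) < eucl_dot y e]].

Definition measure_support (mu : {measure set 'rV[R]_N -> \bar R}) :
    set 'rV[R]_N :=
  [set x | forall r, 0 < r -> (0 < mu (eucl_ball x r))%E].

Definition d_set_measure (d : R) A (mu : {measure set 'rV[R]_N -> \bar R}) :
    Prop :=
  measure_support mu = A /\
  exists c1 c2 : R, [/\ 0 < c1, 0 < c2 &
    forall x r, A x -> 0 < r <= 1 ->
      ((c1 * r `^ d)%:E <= mu (eucl_ball x r `&` A) <= (c2 * r `^ d)%:E)%E].

Definition domain_boundary_measure A (oA : open A)
    (mu : {measure set 'rV[R]_N -> \bar R}) : {measure set 'rV[R]_N -> \bar R} :=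
  measure_add (mrestr (lebesgue_rV N) (open_measurable_rV oA))
    (mrestr mu (closed_measurable_rV (closed_boundary (A := A)))).

Definition L2_domain_boundary A (oA : open A)
    (mu : {measure set 'rV[R]_N -> \bar R}) : normedModType R :=
  LspaceType2 (domain_boundary_measure oA mu).

Local Notation leb := (lebesgue_rV N).

Definition Hs (s : R) A (f : 'rV[R]_N -> R) : Prop :=
  [/\ measurable_fun A f, (\int[leb]_(x in A) (f x ^+ 2)%:E < +oo)%E &
      (\int[leb \x leb]_(z in A `*` A)
        ((f z.1 - f z.2) ^+ 2 / eucl_dist z.1 z.2 `^ (N%:R + 2 * s))%:E
          < +oo)%E].

Definition ball_average A (f : 'rV[R]_N -> R) x (r : R) : R :=
  (fine (leb (eucl_ball x r `&` A)))^-1 * \int[leb]_(y in eucl_ball x r `&` A) f y.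

Definition trace A (f : 'rV[R]_N -> R) x : R :=
  lim (ball_average A f x r @[r --> 0^'+]).

(* The image of H^s in L^2(Omega, m), m = Lebesgue + mu: the classes whose
   boundary values are the trace of their restriction to Omega. *)
Definition Hs_L2 (s : R) A (oA : open A) (mu : {measure set 'rV[R]_N -> \bar R})
    : set (L2_domain_boundary oA mu) :=
  [set u : LspaceType2 (domain_boundary_measure oA mu) | Hs s A u /\
    {ae mu, forall x, boundary A x ->
      ball_average A u x r @[r --> 0^'+] --> (u x : R)}].

End euclidean.
Arguments Hs_L2 {R N} s {A} oA mu _.
Arguments L2_domain_boundary {R N A} oA mu.

Section energy.
Context (R : realType) (N : nat).
Local Notation leb := (lebesgue_rV N).

Definition Gamma (z : R) : R :=
  \int[@lebesgue_measure R]_(x in `]0, +oo[) (x `^ (z - 1) * expR (- x)).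

Definition frac_const (s : R) : R :=
  s * 2 `^ (2 * s) * Gamma ((N%:R + 2 * s) / 2)
  / (pi `^ (N%:R / 2) * Gamma (1 - s)).

(* The integrals are extended-real-valued; they are finite for [u], [v] in
   H^s(Omega) by boundedness of the trace into the Besov space of order alpha.
   The quotients vanish on the diagonals, which are negligible. *)
Definition energy (d s : R) (Omega : set 'rV[R]_N)
    (mu : {sigma_finite_measure set 'rV[R]_N -> \bar R})
    (K zeta : R -> 'rV[R]_N -> 'rV[R]_N -> R) (b : R -> 'rV[R]_N -> R)
    (t : R) (u v : 'rV[R]_N -> R) : \bar R :=
  let bd := boundary Omega in
  let alpha := s - (N%:R - d) / 2 in
  let u' := trace Omega u in
  let v' := trace Omega v in
  ((frac_const s / 2)%:E *
     \int[leb \x leb]_(z in Omega `*` Omega)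
       (K t z.1 z.2 * ((u z.1 - u z.2) * (v z.1 - v z.2))
         / eucl_dist z.1 z.2 `^ (N%:R + 2 * s))%:E
   + \int[mu]_(P in bd) (b t P * u' P * v' P)%:E
   + \int[mu \x mu]_(z in bd `*` bd)
       (zeta t z.1 z.2 * ((u' z.1 - u' z.2) * (v' z.1 - v' z.2))
         / eucl_dist z.1 z.2 `^ (d + 2 * alpha))%:E)%E.

Definition admissible_kernel (T eta k1 k2 c : R) (D : set 'rV[R]_N)
    (nu : {sigma_finite_measure set 'rV[R]_N -> \bar R})
    (k : R -> 'rV[R]_N -> 'rV[R]_N -> R) : Prop :=
  [/\ measurable_fun (`[0, T] `*` D `*` D) (fun z => k z.1.1 z.1.2 z.2),
      (forall t x y, t \in `[0, T] -> D x -> D y -> k t x y = k t y x),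
      {ae ((@lebesgue_measure R \x nu) \x nu)%E, forall z,
        (`[0, T] `*` D `*` D) z -> k1 <= k z.1.1 z.1.2 z.2 <= k2} &
      forall t tau, t \in `[0, T] -> tau \in `[0, T] ->
        {ae (nu \x nu)%E, forall z, (D `*` D) z ->
          `|k t z.1 z.2 - k tau z.1 z.2| <= c * `|t - tau| `^ eta}].

(* [b] stands for a class in L^oo, so that its infimum is the essential one. *)
Definition admissible_coeff (T eta b0 c : R) (D : set 'rV[R]_N)
    (nu : {sigma_finite_measure set 'rV[R]_N -> \bar R})
    (b : R -> 'rV[R]_N -> R) : Prop :=
  [/\ measurable_fun (`[0, T] `*` D) (fun z => b z.1 z.2),
      (exists M, {ae (@lebesgue_measure R \x nu)%E, forall z,
        (`[0, T] `*` D) z -> `|b z.1 z.2| <= M}),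
      (exists2 b1, b0 < b1 & {ae (@lebesgue_measure R \x nu)%E, forall z,
        (`[0, T] `*` D) z -> b1 <= b z.1 z.2}) &
      forall t tau, t \in `[0, T] -> tau \in `[0, T] ->
        {ae nu, forall P, D P ->
          `|b t P - b tau P| <= c * `|t - tau| `^ eta}].

End energy.

(* Main.v *)
(** The form enters only through one estimate. Pointwise AM-GM in the three
integrals, with the lower bounds of K, zeta, b and their Hoelder continuity,
gives

  |(A(t) u, v) - (u, A(s) v)| <= C |t - s|^eta (- (A(t) u, u) - (A(s) v, v))

for u in D(A(t)) and v in D(A(s)), and this bound passes with the same C to the
Yosida approximations B_l(t). The evolution U_l of the bounded generators B_l is
obtained from a linear ODE. Comparing it with the frozen semigroups
exp(s B_l(t)), the bound and eta > 1/2 give, uniformly in l,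
|B_l(t) U_l(t,tau)| <= C' / (t - tau), a modulus of continuity of B_l U_l in t,
and, by duality with the time-reversed evolution,
|U_l - U_(l/4)| <= C'' sqrt(l) (1 + 1 / (t - tau)). So U_l converges in operator
norm for l = 4^-n, and the selfadjointness of A(t) identifies the limit of
B_l U_l with A U. Two evolution families agree because x' = A x makes |x|^2
nonincreasing. *)
Require Import Defs.
From mathcomp Require Import all_boot all_order all_algebra.
From mathcomp Require Import all_classical all_reals all_analysis.
From mathcomp Require Import measurable_realfun ring lra.

Import Order.TTheory GRing.Theory Num.Theory.
Import numFieldNormedType.Exports.

Local Open Scope classical_set_scope.
Local Open Scope ring_scope.

Set Implicit Arguments.
Unset Strict Implicit.
Unset Printing Implicit Defensive.

(** The domain of [A t] varies with [t], so that a difference [A t - A s] has no meaning and only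
    pairings of a vector of one domain with a vector of the other can be compared. Scaling its two
    arguments against each other trades the energy dissipated by [x] against the smoothing of [z].
    The form of [B t (z s)] is of order [s^-3], so that the pairing moves at a speed of order
    [(t - r)^(eta - 3/2)]; this is integrable exactly when [eta > 1/2]. Smoothing itself comes from
    Lyapunov functions instead of a functional calculus. As no constant depends on the Yosida
    parameter, weak limits suffice to carry the bounds on [B_l U_l] over to [A U]. *)

Definition seq_lim (R : realType) (V : normedModType R) (u : nat -> V) (l : V) :=
  forall e : R, 0 < e -> exists n, forall i, (n <= i)%N -> `|u i - l| <= e.

Definition seq_cauchy (R : realType) (V : normedModType R) (u : nat -> V) :=
  forall e : R, 0 < e -> exists n, forall i j, (n <= i)%N -> (n <= j)%N ->
    `|u i - u j| <= e.

(** A property of an inner product on a given normed space, so that it can be established afterwards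
    for the normed space of square-integrable classes. *)
Record hilbert_dot (R : realType) (H : normedModType R) (dot : H -> H -> R) :
    Prop := HilbertDot {
  hdotC : forall u v, dot u v = dot v u;
  hdotP : forall a u v w, dot (a *: u + v) w = a * dot u w + dot v w;
  hdotE : forall u, dot u u = `|u| ^+ 2;
  hilbert_complete : forall u : nat -> H, seq_cauchy u ->
    exists l, seq_lim u l }.

(** * Hilbert space geometry: orthogonal projection and Riesz representation *)

Section hilbert.
Context {R : realType} {H : normedModType R} {dot : H -> H -> R}.
Hypothesis hH : hilbert_dot dot.

Lemma dotC u v : dot u v = dot v u. Proof. exact: hdotC hH u v. Qed.
Lemma dotE u : dot u u = `|u| ^+ 2. Proof. exact: hdotE hH u. Qed.
Lemma dotDl u v w : dot (u + v) w = dot u w + dot v w.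
Proof. by have := hdotP hH 1 u v w; rewrite scale1r mul1r. Qed.
Lemma dot0l w : dot 0 w = 0.
Proof. by have := dotDl 0 0 w; rewrite addr0 => e; lra. Qed.
Lemma dotZl a u w : dot (a *: u) w = a * dot u w.
Proof. by have := hdotP hH a u 0 w; rewrite addr0 dot0l addr0. Qed.
Lemma dotNl u w : dot (- u) w = - dot u w.
Proof. by rewrite -scaleN1r dotZl mulN1r. Qed.
Lemma dotDr u v w : dot u (v + w) = dot u v + dot u w.
Proof. by rewrite dotC dotDl !(dotC u). Qed.
Lemma dot0r w : dot w 0 = 0. Proof. by rewrite dotC dot0l. Qed.
Lemma dotZr a u w : dot u (a *: w) = a * dot u w.
Proof. by rewrite dotC dotZl (dotC w). Qed.
Lemma dotNr u w : dot u (- w) = - dot u w.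
Proof. by rewrite dotC dotNl dotC. Qed.

Definition dotlin := (dotDl, dotDr, dotZl, dotZr, dotNl, dotNr, dot0l, dot0r).

Lemma dot_ge0 u : 0 <= dot u u. Proof. by rewrite dotE sqr_ge0. Qed.

Lemma sqr_normB u v : `|u - v| ^+ 2 = `|u| ^+ 2 - 2 * dot u v + `|v| ^+ 2.
Proof. by rewrite -!dotE !dotlin (dotC v u); ring. Qed.

Lemma sqr_normD u v : `|u + v| ^+ 2 = `|u| ^+ 2 + 2 * dot u v + `|v| ^+ 2.
Proof. by rewrite -!dotE !dotlin (dotC v u); ring. Qed.

Lemma sqr_normZ a (u : H) : `|a *: u| ^+ 2 = a ^+ 2 * `|u| ^+ 2.
Proof. by rewrite -!dotE !dotlin; ring. Qed.

Lemma le_of_sqr (a b : R) : 0 <= b -> a ^+ 2 <= b ^+ 2 -> a <= b.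
Proof. by move=> b0 ab; rewrite leNgt; apply/negP => ba; nra. Qed.

Lemma dot_amgm u v : dot u v <= (`|u| ^+ 2 + `|v| ^+ 2) / 2.
Proof. have := sqr_ge0 `|u - v|; rewrite sqr_normB; lra. Qed.

Lemma dot_le u v : dot u v <= `|u| * `|v|.
Proof.
have [->|u0] := eqVneq u 0; first by rewrite dot0l mulr_ge0.
have [->|v0] := eqVneq v 0; first by rewrite dot0r mulr_ge0.
have u1 : 0 < `|u| by rewrite normr_gt0.
have v1 : 0 < `|v| by rewrite normr_gt0.
have := dot_amgm (`|u|^-1 *: u) (`|v|^-1 *: v).
rewrite !sqr_normZ !exprVn !mulVf ?expf_neq0 ?gt_eqF// !dotlin => h.
have -> : dot u v = `|u| * `|v| * (`|u|^-1 * (`|v|^-1 * dot u v)).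
  by field; rewrite !gt_eqF.
by rewrite ler_piMr ?mulr_ge0 ?(le_trans h)//; lra.
Qed.

Lemma dot_abs u v : `|dot u v| <= `|u| * `|v|.
Proof.
rewrite ler_norml dot_le andbT lerNl -dotNl.
by rewrite (le_trans (dot_le _ _))// normrN.
Qed.

(** Testing with the normalised [w] itself. This reduces vector-valued estimates to scalar ones,
    with a bound that must be uniform over unit vectors. *)
Lemma norm_le_dot (w : H) K : (forall v, `|v| <= 1 -> dot w v <= K) -> `|w| <= K.
Proof.
move=> h; have [->|w0] := eqVneq w 0.
  by rewrite normr0; have := h 0; rewrite normr0 dot0r; apply.
have w1 : 0 < `|w| by rewrite normr_gt0.
have := h (`|w|^-1 *: w); rewrite normrZ normfV normr_id mulVf ?gt_eqF//.
move/(_ (lexx _)); rewrite dotZr dotE expr2 mulKf// gt_eqF//.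
Qed.

(** For small [t] of the right sign the linear term would win: this is the first-order condition at
    a minimum. *)
Lemma lin_quad_eq0 (b c : R) : (forall t, 0 <= t * b + t ^+ 2 * c) -> b = 0.
Proof.
move=> h; have c1 : 0 < `|c| + 1 by have := normr_ge0 c; lra.
have := h (- (b / (`|c| + 1))).
set t := b / _; have tb : b = t * (`|c| + 1) by rewrite /t divfK// gt_eqF.
have := ler_norm c => cc; rewrite {1}tb => h1.
suff t0 : t = 0 by rewrite tb t0 mul0r.
by apply/eqP; rewrite -sqrf_eq0 eq_le sqr_ge0 andbT; nra.
Qed.

Lemma seq_limD (u v : nat -> H) l m :
  seq_lim u l -> seq_lim v m -> seq_lim (fun n => u n + v n) (l + m).
Proof.
move=> ul vm e e0; have [n1 h1] := ul (e / 2) ltac:(lra).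
have [n2 h2] := vm (e / 2) ltac:(lra).
exists (maxn n1 n2) => i; rewrite geq_max => /andP[/h1 a /h2 b].
rewrite opprD addrACA (le_trans (ler_normD _ _))//; lra.
Qed.

Lemma seq_limZ (u : nat -> H) l (a : R) :
  seq_lim u l -> seq_lim (fun n => a *: u n) (a *: l).
Proof.
move=> ul e e0; have a1 : 0 < `|a| + 1 by have := normr_ge0 a; lra.
have [n h] := ul (e / (`|a| + 1)) ltac:(by rewrite divr_gt0).
exists n => i /h {}h; rewrite -scalerBr normrZ.
rewrite (le_trans (ler_wpM2l (normr_ge0 _) h))//.
by rewrite mulrCA ler_piMr ?ltW// ltr_pdivrMr//; lra.
Qed.

Lemma seq_lim_uniq (u : nat -> H) l m : seq_lim u l -> seq_lim u m -> l = m.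
Proof.
move=> ul um; apply/eqP; rewrite -subr_eq0 -normr_le0; apply/ler_addgt0Pr => e e0.
rewrite add0r; have [n1 h1] := ul (e / 2) ltac:(lra).
have [n2 h2] := um (e / 2) ltac:(lra).
have := h1 (maxn n1 n2) (leq_maxl _ _); have := h2 (maxn n1 n2) (leq_maxr _ _).
rewrite -(subrKA (u (maxn n1 n2))) => a b.
by rewrite (le_trans (ler_normD _ _))// [`|l - _|]distrC; lra.
Qed.

Lemma seq_lim_dot_le (u : nat -> H) l w K :
  (forall n, dot (u n) w <= K) -> seq_lim u l -> dot l w <= K.
Proof.
move=> h ul; apply/ler_addgt0Pr => e e0.
have w1 : 0 < `|w| + 1 by have := normr_ge0 w; lra.
have [n hn] := ul (e / (`|w| + 1)) ltac:(by rewrite divr_gt0).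
have {}hn := hn n (leqnn _).
have -> : dot l w = dot (u n) w + dot (- (u n - l)) w by rewrite !dotlin; ring.
apply: lerD; first exact: h.
rewrite (le_trans (dot_le _ _))// normrN.
rewrite (le_trans (ler_wpM2r (normr_ge0 _) hn))//.
by rewrite mulrAC -mulrA ler_piMr ?ltW// ltr_pdivrMr//; lra.
Qed.

Lemma seq_lim_dot_eq (u v : nat -> H) l m w z :
  (forall n, dot (u n) w = dot (v n) z) -> seq_lim u l -> seq_lim v m ->
  dot l w = dot m z.
Proof.
move=> h ul vm; apply/eqP; rewrite -subr_eq0 -normr_le0; apply/ler_addgt0Pr => e e0.
rewrite add0r.
have w1 : 0 < `|w| + 1 by have := normr_ge0 w; lra.
have z1 : 0 < `|z| + 1 by have := normr_ge0 z; lra.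
have [n1 h1] := ul (e / 2 / (`|w| + 1)) ltac:(by rewrite !divr_gt0).
have [n2 h2] := vm (e / 2 / (`|z| + 1)) ltac:(by rewrite !divr_gt0).
have := h1 (maxn n1 n2) (leq_maxl _ _); have := h2 (maxn n1 n2) (leq_maxr _ _).
set n := maxn n1 n2; rewrite ler_pdivlMr// => a; rewrite ler_pdivlMr// => b.
have -> : dot l w - dot m z = dot (v n - m) z - dot (u n - l) w.
  by rewrite !dotlin h; ring.
rewrite (le_trans (ler_normB _ _))//.
have := dot_abs (v n - m) z; have := dot_abs (u n - l) w.
have := normr_ge0 (u n - l); have := normr_ge0 (v n - m); lra.
Qed.

Lemma seq_lim_norm_le (u : nat -> H) l K :
  (forall n, `|u n| <= K) -> seq_lim u l -> `|l| <= K.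
Proof.
move=> h ul; apply: norm_le_dot => v v1; apply: seq_lim_dot_le ul => n.
rewrite (le_trans (dot_le _ _))// (le_trans _ (h n))//.
by rewrite ler_piMr.
Qed.

Lemma seq_lim_cauchy (u : nat -> H) l : seq_lim u l -> seq_cauchy u.
Proof.
move=> ul e e0; have [n h] := ul (e / 2) ltac:(lra); exists n => i j /h a /h b.
rewrite -(subrKA l) (le_trans (ler_normD _ _))// [`|l - _|]distrC; lra.
Qed.

Lemma invS_small (e : R) : 0 < e -> exists n, forall i, (n <= i)%N ->
  i.+1%:R^-1 <= e :> R.
Proof.
move=> e0; exists (Num.truncn e^-1) => i ni.
rewrite invf_ple ?posrE//; apply/ltW/(lt_le_trans (truncnS_gt _)).
by rewrite ler_nat.
Qed.

Section projection.
Variable M : set H.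
Hypotheses (M0 : M 0) (Mlin : forall (a : R) u v, M u -> M v -> M (a *: u + v)).
Hypothesis Mclosed : forall (u : nat -> H) l, (forall n, M (u n)) ->
  seq_lim u l -> M l.

(** A minimising sequence for the distance is Cauchy by the parallelogram law, since midpoints of
    its terms lie in [M]; orthogonality is the first-order condition at the limit. *)
Lemma projection x : exists2 m, M m & forall y, M y -> dot (x - m) y = 0.
Proof.
pose S := [set `|x - y| ^+ 2 | y in M].
have S0 : has_inf S.
  split; first by exists (`|x - 0| ^+ 2), 0.
  by exists 0 => _ [y _ <-]; exact: sqr_ge0.
set d := inf S.
have dS y : M y -> d <= `|x - y| ^+ 2.
  by move=> My; apply: ge_inf; [exact: S0.2|exists y].
have ex n : exists y, M y /\ `|x - y| ^+ 2 <= d + n.+1%:R^-1.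
  have n0 : 0 < n.+1%:R^-1 :> R by rewrite invr_gt0.
  have [_ [y My <-] lt] := inf_adherent n0 S0.
  by exists y; split => //; exact: ltW.
pose u n := sval (cid (ex n)).
have uM n : M (u n) by exact: (svalP (cid (ex n))).1.
have ud n : `|x - u n| ^+ 2 <= d + n.+1%:R^-1 by exact: (svalP (cid (ex n))).2.
have [m ulm] : exists m, seq_lim u m.
  apply: (hilbert_complete hH) => e e0.
  (* The parallelogram law bounds the squared distance of two terms by twice the sum of their
     excesses over [d], hence the 4. *)
  have [n hn] := @invS_small (e ^+ 2 / 4) ltac:(nra).
  exists n => i j /hn ni /hn nj; apply: le_of_sqr; first exact: ltW.
  have Mm : M (2^-1 *: (u i + u j)).
    have Mij : M (u i + u j) by have := Mlin 1 (uM i) (uM j); rewrite scale1r.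
    by have := Mlin 2^-1 Mij M0; rewrite addr0.
  have := dS _ Mm; have := ud i; have := ud j.
  move: (i.+1%:R^-1) ni (j.+1%:R^-1) nj => a ia b jb.
  rewrite -!dotE !dotlin !(dotC _ x) !(dotC (u j) (u i)); lra.
have Mm : M m by exact: Mclosed ulm.
exists m => // y My.
have xd : `|x - m| ^+ 2 <= d.
  suff : `|x - m| <= Num.sqrt d.
    move=> h; rewrite -[leRHS]sqr_sqrtr ?ler_sqr ?nnegrE ?sqrtr_ge0//.
    by apply: lb_le_inf; [exact: S0.1|move=> _ [z _ <-]; exact: sqr_ge0].
  apply/ler_addgt0Pr => e e0.
  have d0 : 0 <= d.
    by apply: lb_le_inf; [exact: S0.1|move=> _ [z _ <-]; exact: sqr_ge0].
  have [n1 h1] := ulm (e / 2) ltac:(lra).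
  have [n2 h2] := @invS_small (e ^+ 2 / 4) ltac:(nra).
  have := h1 (maxn n1 n2) (leq_maxl _ _); have := h2 (maxn n1 n2) (leq_maxr _ _).
  set n := maxn n1 n2 => a b.
  rewrite -(subrKA (u n)) (le_trans (ler_normD _ _))//.
  suff : `|x - u n| <= Num.sqrt d + e / 2 by lra.
  apply: le_of_sqr; first by have := sqrtr_ge0 d; lra.
  rewrite (le_trans (ud n))//.
  have := sqr_sqrtr d0; have := sqrtr_ge0 d.
  by move: a; move: (n.+1%:R^-1) (Num.sqrt d) => r a q q0 qd; nra.
apply: (@lin_quad_eq0 _ (2^-1 * `|y| ^+ 2)) => t.
have := dS (- t *: y + m) (Mlin _ My Mm).
have -> : x - (- t *: y + m) = (x - m) + t *: y.
  by rewrite opprD scaleNr opprK addrCA addrC.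
by rewrite sqr_normD sqr_normZ dotZr; nra.
Qed.

End projection.

(** The kernel of [f] is closed by boundedness, and subtracting from a vector outside it its
    projection gives [p], orthogonal to the kernel; a multiple of [p] represents [f]. *)
Lemma riesz (f : H -> R) (K : R) :
  (forall a u v, f (a *: u + v) = a * f u + f v) ->
  (forall u, `|f u| <= K * `|u|) -> exists z, forall v, f v = dot z v.
Proof.
move=> flin fK.
have f0 : f 0 = 0 by have := flin (-1) 0 0; rewrite scaler0 addr0; lra.
have [[w fw]|nw] := pselect (exists w, f w != 0); last first.
  exists 0 => v; rewrite dot0l; apply/eqP/negbNE/negP => fv.
  by apply: nw; exists v.
have K0 : 0 <= K.
  rewrite leNgt; apply/negP => Klt; have := fK w; have := normr_ge0 w.
  move=> w0 fKw; have := mulr_le0_ge0 (ltW Klt) w0.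
  by move: fw; rewrite -normr_gt0; lra.
pose M := [set y | f y = 0].
have [m /= fm ort] : exists2 m, M m & forall y, M y -> dot (w - m) y = 0.
  apply: projection; rewrite /M//=.
    by move=> a u v fu fv; rewrite flin fu fv; lra.
  move=> u l fu ul; apply/eqP; rewrite -normr_le0; apply/ler_addgt0Pr => e e0.
  have [n h] := ul (e / (K + 1)) ltac:(by rewrite divr_gt0// ltr_wpDl).
  rewrite add0r; have -> : f l = - f (u n - l).
    by have := flin (-1) l (u n); rewrite scaleN1r [- l + _]addrC fu; lra.
  rewrite normrN (le_trans (fK _))// (le_trans (ler_wpM2l K0 (h n (leqnn _))))//.
  rewrite mulrCA ler_piMr ?ltW// ltr_pdivrMr ?ltr_wpDl//; lra.
set p := w - m; have fp : f p = f w.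
  by have := flin (-1) m w; rewrite scaleN1r [- m + _]addrC fm; lra.
have p0 : `|p| ^+ 2 != 0.
  rewrite expf_neq0// normr_eq0; apply/negP => /eqP p0.
  by move: fw; rewrite -fp p0 f0 eqxx.
exists (f w / `|p| ^+ 2 *: p) => v.
have : f (- (f v / f w) *: p + v) = 0 by rewrite flin fp; field.
move/ort; rewrite dotDr dotZr -/p dotE dotZl => e.
have -> : dot p v = f v / f w * `|p| ^+ 2 by lra.
by field; rewrite fw; move: p0; rewrite sqrf_eq0.
Qed.

End hilbert.

Lemma subrBB (V : zmodType) (a b c d : V) : a - b - (c - d) = a - c - (b - d).
Proof. by rewrite !opprB addrACA [in RHS]addrACA [- b - c]addrC. Qed.

(** * Resolvents and Yosida approximations of a selfadjoint nonpositive operator *)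

Section yosida.
Context {R : realType} {H : normedModType R} {dot : H -> H -> R}.
Hypothesis hH : hilbert_dot dot.

Local Notation dotC := (dotC hH).
Local Notation dotE := (dotE hH).
Local Notation dotlin := (dotlin hH).

(** This is [(1 - l A)^-1], so that [A] is approached as [l] tends to 0; [l] is the inverse of the
    usual resolvent parameter. The default value of [xget] never occurs for [l > 0], by
    [resolvent_ex]. *)
Definition resolvent (A : unbounded_operator H) (l : R) (x : H) : H :=
  xget 0 [set u | op_dom A u /\ u - l *: A u = x].

Definition yosida (A : unbounded_operator H) (l : R) (x : H) : H :=
  A (resolvent A l x).

Section one_operator.
Variable A : unbounded_operator H.
Hypotheses (sA : selfadjoint dot A) (nA : nonpositive dot A).

Local Notation D := (op_dom A).

Lemma op_domZ (a : R) u : D u -> D (a *: u).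
Proof. by move=> Du; have := op_dom_linear a Du (op_dom0 A); rewrite addr0. Qed.

Lemma op_domD u v : D u -> D v -> D (u + v).
Proof. by move=> Du Dv; have := op_dom_linear 1 Du Dv; rewrite scale1r. Qed.

Lemma op_fun0 : A 0 = 0.
Proof.
have D0 := op_dom0 A; have := op_fun_linear (-1) D0 D0.
by rewrite scaler0 addr0 => ->; rewrite scaleN1r addNr.
Qed.

Lemma op_funZ (a : R) u : D u -> A (a *: u) = a *: A u.
Proof.
by move=> Du; have := op_fun_linear a Du (op_dom0 A); rewrite op_fun0 !addr0.
Qed.

Lemma op_funD u v : D u -> D v -> A (u + v) = A u + A v.
Proof. by move=> Du Dv; have := op_fun_linear 1 Du Dv; rewrite !scale1r. Qed.

Lemma op_funB u v : D u -> D v -> A (u - v) = A u - A v.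
Proof.
move=> Du Dv; rewrite -(scaleN1r v) op_funD ?op_funZ ?scaleN1r//.
by rewrite -scaleN1r; exact: op_domZ.
Qed.

Lemma op_domB u v : D u -> D v -> D (u - v).
Proof.
by move=> Du Dv; rewrite -(scaleN1r v); apply: op_domD => //; exact: op_domZ.
Qed.

Lemma selfadjoint_sym u v : D u -> D v -> dot (A u) v = dot u (A v).
Proof. by move=> Du Dv; apply: (sA.2 v (A v)).2. Qed.

Lemma selfadjoint_dense x e : 0 < e -> exists2 w, D w & `|x - w| < e.
Proof.
move=> e0; have := sA.1 (ball x e).
case => [||w [xw Dw]]; first by exists x; exact: ballxx.
  exact: ball_open.
by exists w => //; move: xw; rewrite -ball_normE.
Qed.

(** The relation [dot (A z) v = dot z w] passes to the limit, and by selfadjointness the pairs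
    [(v, w)] satisfying it for all [z] form the graph of [A]. *)
Lemma selfadjoint_closed (u : nat -> H) v w : (forall n, D (u n)) ->
  seq_lim u v -> seq_lim (fun n => A (u n)) w -> D v /\ w = A v.
Proof.
move=> Du uv Auw; apply/(sA.2 v w).1 => z Dz.
rewrite dotC [RHS]dotC.
by apply: (seq_lim_dot_eq hH (u := u) (v := fun n => A (u n))) => // n;
  rewrite selfadjoint_sym.
Qed.

Lemma resolvent_eq0 l x : 0 < l -> D x -> x - l *: A x = 0 -> x = 0.
Proof.
move=> l0 Dx e; apply/normr0_eq0/eqP; rewrite -sqrf_eq0 -dotE.
have : dot (x - l *: A x) x = 0 by rewrite e (dot0l hH).
have := nA Dx; rewrite !dotlin => a b.
rewrite eq_le (dot_ge0 hH) andbT; nra.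
Qed.

Lemma coercive l u : 0 < l -> D u ->
  `|u| ^+ 2 + l ^+ 2 * `|A u| ^+ 2 <= `|u - l *: A u| ^+ 2.
Proof.
move=> l0 Du; have := nA Du; rewrite dotC => h.
by rewrite (sqr_normB hH) (sqr_normZ hH) dotlin; nra.
Qed.

(** The range of [1 - l A] is closed, by [coercive] and the closedness of [A]. A vector [y]
    orthogonal to it satisfies the adjoint relation with [l^-1 *: y], so that [y] is in the domain
    with [A y = l^-1 *: y], and injectivity gives [y = 0]. *)
Lemma resolvent_ex l x : 0 < l -> exists u, D u /\ u - l *: A u = x.
Proof.
move=> l0; pose M := [set u - l *: A u | u in D].
have M0 : M 0 by exists 0; [exact: op_dom0|rewrite op_fun0 scaler0 subr0].
have Mlin (a : R) u v : M u -> M v -> M (a *: u + v).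
  move=> [p Dp <-] [q Dq <-]; exists (a *: p + q); first exact: op_dom_linear.
  rewrite op_fun_linear// scalerDr scalerBr opprD addrACA; congr (_ - _ + _).
  by rewrite !scalerA mulrC.
have Mcl (u : nat -> H) y : (forall n, M (u n)) -> seq_lim u y -> M y.
  move=> Mu uy; pose p n := s2val (cid2 (Mu n)).
  have Dp n : D (p n) by exact: (s2valP (cid2 (Mu n))).
  have pu n : p n - l *: A (p n) = u n by exact: (s2valP' (cid2 (Mu n))).
  have pij i j : `|p i - p j| ^+ 2 + l ^+ 2 * `|A (p i) - A (p j)| ^+ 2 <=
      `|u i - u j| ^+ 2.
    have Dij : D (p i - p j) by exact: op_domB.
    have := coercive l0 Dij; rewrite op_funB// -!pu => h; rewrite (le_trans h)//.
    by rewrite scalerBr subrBB.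
  have cu := seq_lim_cauchy uy.
  have [v pv] : exists v, seq_lim p v.
    apply: (hilbert_complete hH) => e e0; have [n h] := cu e e0.
    exists n => i j ni nj; rewrite (le_trans _ (h i j ni nj))//.
    apply: le_of_sqr => //; have := pij i j.
    by have : 0 <= l ^+ 2 * `|A (p i) - A (p j)| ^+ 2;
      [rewrite mulr_ge0 ?sqr_ge0|lra].
  have [w Apw] : exists w, seq_lim (fun n => A (p n)) w.
    apply: (hilbert_complete hH) => e e0; have [n h] := cu (l * e) ltac:(nra).
    exists n => i j ni nj; have {}h := h i j ni nj.
    suff : l * `|A (p i) - A (p j)| <= l * e by rewrite ler_pM2l.
    rewrite (le_trans _ h)//; apply: le_of_sqr => //.
    by rewrite exprMn; have := pij i j; have := sqr_ge0 `|p i - p j|; lra.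
  have [Dv wE] := selfadjoint_closed Dp pv Apw.
  exists v => //; rewrite -wE -scaleNr.
  apply: (@seq_lim_uniq _ _ (fun n => p n + (- l) *: A (p n))).
    by apply: seq_limD => //; exact: seq_limZ.
  by move=> e /uy[n h]; exists n => i /h; rewrite scaleNr pu.
have [m [u Du um] ort] := projection hH M0 Mlin Mcl x.
exists u; split => //; rewrite um; apply/esym/eqP; rewrite -subr_eq0; apply/eqP.
move: (x - m) ort => y ort.
have yP z : D z -> dot (A z) y = dot z (l^-1 *: y).
  move=> Dz; have := ort _ (ex_intro2 _ _ z Dz erefl).
  rewrite dotC !dotlin => e.
  have -> : dot z y = l * dot (A z) y by lra.
  by rewrite mulrA mulVf ?mul1r// gt_eqF.
have [Dy yE] := (sA.2 _ _).1 yP.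
by apply: (resolvent_eq0 l0 Dy); rewrite -yE scalerA divff ?gt_eqF// scale1r subrr.
Qed.

Section one_parameter.
Variable l : R.
Hypothesis l0 : 0 < l.

Local Notation J := (resolvent A l).
Local Notation B := (yosida A l).

Lemma resolvent_dom x : D (J x).
Proof.
rewrite /resolvent; case: xgetP => [y _ [//]|] h.
by have [u] := resolvent_ex x l0; case=> Du uE; case: (h u).
Qed.

Lemma resolventE x : J x - l *: B x = x.
Proof.
rewrite /yosida /resolvent; case: xgetP => [y _ []//|] h.
by have [u] := resolvent_ex x l0; case=> Du uE; case: (h u).
Qed.

Lemma resolvent_uniq u x : D u -> u - l *: A u = x -> J x = u.
Proof.
move=> Du ux; apply/eqP; rewrite -subr_eq0; apply/eqP.
have DJ := resolvent_dom x.
have DJu : D (J x - u) by exact: op_domB.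
apply: (resolvent_eq0 l0 DJu); rewrite op_funB//.
by rewrite scalerBr subrBB -[A (J x)]/(B x) resolventE ux subrr.
Qed.

Lemma yosidaE x : B x = l^-1 *: (J x - x).
Proof.
have -> : J x - x = l *: B x.
  by apply/eqP; rewrite subr_eq addrC -subr_eq resolventE.
by rewrite scalerA mulVf ?scale1r// gt_eqF.
Qed.

Lemma resolvent_dotr x z : dot z x = dot z (J x) - l * dot z (B x).
Proof. by rewrite -[in LHS](resolventE x) !dotlin. Qed.

Lemma resolventP (a : R) u v : J (a *: u + v) = a *: J u + J v.
Proof.
have Du := resolvent_dom u; have Dv := resolvent_dom v.
apply: resolvent_uniq; first exact: op_dom_linear.
rewrite op_fun_linear// -[in RHS](resolventE u) -[in RHS](resolventE v).
rewrite /yosida scalerDr scalerBr opprD addrACA; congr (_ - _ + _).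
by rewrite !scalerA mulrC.
Qed.

Lemma yosidaP (a : R) u v : B (a *: u + v) = a *: B u + B v.
Proof. by rewrite /yosida resolventP op_fun_linear//; exact: resolvent_dom. Qed.

(** Since [x = J x - l *: B x], the pairing with [B x] is the nonpositive [dot (A (J x)) (J x)]
    minus [l * |B x|^2]. Dissipated energy thus controls [B x], at the price of a factor [l]. *)
Lemma yosida_norm_le x : l * `|B x| ^+ 2 <= - dot (B x) x.
Proof.
rewrite (resolvent_dotr x (B x)) dotE.
have := nA (resolvent_dom x); rewrite -/(B x); lra.
Qed.

Lemma yosida_form_le x : - dot (B x) (J x) <= - dot (B x) x.
Proof.
rewrite (resolvent_dotr x (B x)) dotE; have := mulr_ge0 (ltW l0) (sqr_ge0 `|B x|); lra.
Qed.

Lemma yosida_le0 x : dot (B x) x <= 0.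
Proof. have := yosida_norm_le x; have := mulr_ge0 (ltW l0) (sqr_ge0 `|B x|); lra. Qed.

Lemma yosida_sym x y : dot (B x) y = dot x (B y).
Proof.
rewrite (resolvent_dotr y) [RHS]dotC (resolvent_dotr x) [dot (B y) _]dotC.
rewrite [dot (B y) (B x)]dotC {1}/yosida selfadjoint_sym//; exact: resolvent_dom.
Qed.

Lemma yosida_bounded x : `|B x| <= l^-1 * `|x|.
Proof.
have h := yosida_norm_le x; have := dot_abs hH (B x) x; rewrite ler_norml => /andP[k _].
rewrite ler_pdivlMl//; have [->|B0] := eqVneq `|B x| 0; first by rewrite mulr0.
have B1 : 0 < `|B x| by rewrite lt_def B0 normr_ge0.
rewrite -(ler_pM2r B1); lra.
Qed.

Lemma resolvent_norm_le x : `|J x| <= `|x|.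
Proof.
apply: le_of_sqr => //; have := coercive l0 (resolvent_dom x).
rewrite -[A _]/(B x) resolventE; have := sqr_ge0 (l * `|B x|); rewrite exprMn; lra.
Qed.

Lemma resolvent_dist x : `|J x - x| = l * `|B x|.
Proof.
have -> : J x - x = l *: B x by rewrite yosidaE scalerA divff ?gt_eqF ?scale1r.
by rewrite normrZ gtr0_norm.
Qed.

Lemma yosida_norm_dom w : D w -> `|B w| <= `|A w|.
Proof.
move=> Dw; apply: (norm_le_dot hH) => v v1; rewrite yosida_sym.
rewrite /yosida -(selfadjoint_sym Dw); last exact: resolvent_dom.
rewrite (le_trans (dot_le hH _ _))// ler_piMr//.
exact: le_trans (resolvent_norm_le v) v1.
Qed.

End one_parameter.

(** A weak form of the resolvent identity: when [y] and [x] are expanded through their resolvents,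
    the terms that pair [A] with both resolvents agree by symmetry. *)
Lemma yosida_diff l m x y : 0 < l -> 0 < m ->
  dot (yosida A l x) y - dot x (yosida A m y) =
  (l - m) * dot (yosida A l x) (yosida A m y).
Proof.
move=> l0 m0; rewrite (resolvent_dotr m0 y) [dot x _]dotC (resolvent_dotr l0 x).
have -> : dot (yosida A l x) (resolvent A m y) =
    dot (yosida A m y) (resolvent A l x).
  rewrite [RHS]dotC {1}/yosida selfadjoint_sym//; exact: resolvent_dom.
by rewrite [dot (yosida A m y) (yosida A l x)]dotC; ring.
Qed.

Lemma yosida_comm l m x y : 0 < l -> 0 < m ->
  dot (yosida A l x) (yosida A m y) = dot (yosida A m x) (yosida A l y).
Proof.
move=> l0 m0; have [<-//|lm] := eqVneq l m.
have := yosida_diff x y l0 m0; have := yosida_diff x y m0 l0.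
rewrite -!(yosida_sym l0) -!(yosida_sym m0) => e1 e2.
have : (l - m) * (dot (yosida A m (yosida A l x)) y -
  dot (yosida A l (yosida A m x)) y) = 0 by rewrite mulrBr; lra.
by move/eqP; rewrite mulf_eq0 !subr_eq0 (negbTE lm) => /eqP.
Qed.

(** By [yosida_diff] and commutation, [(B_l v, B_m v) - |B_m v|^2] is [l - m] times the value of a
    nonpositive form, hence nonnegative. Bounded norms therefore make [B_l v] Cauchy as [l] tends to
    0. *)
Lemma yosida_monotone l m v : 0 < l -> 0 < m -> l <= m ->
  `|yosida A l v - yosida A m v| ^+ 2 <=
  `|yosida A l v| ^+ 2 - `|yosida A m v| ^+ 2.
Proof.
move=> l0 m0 lm; rewrite (sqr_normB hH).
have := yosida_diff v (yosida A m v) l0 m0.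
rewrite -[dot v _](yosida_sym m0) dotE.
have -> : dot (yosida A l v) (yosida A m (yosida A m v)) =
    dot (yosida A l (yosida A m v)) (yosida A m v).
  by rewrite yosida_comm// -(yosida_sym l0).
have := yosida_le0 l0 (yosida A m v); nra.
Qed.

(** Since [B_l] is [A] after the contraction [J_l], the hypothesis gives [|B_l v| <= M] for all [l].
    So [J_l v] tends to [v], while [A (J_l v)] converges by [yosida_monotone], and the graph of [A]
    is closed. This way the functional need not be extended from the domain, and the bound on [A v]
    comes along. *)
Lemma selfadjoint_bounded_dom v M : 0 <= M ->
  (forall w, D w -> dot v (A w) <= M * `|w|) -> D v /\ `|A v| <= M.
Proof.
move=> M0 h; pose l n : R := n.+1%:R^-1.
have l0 n : 0 < l n by rewrite invr_gt0.
have BM n : `|yosida A (l n) v| <= M.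
  apply: (norm_le_dot hH) => y y1; rewrite (yosida_sym (l0 n)).
  rewrite (le_trans (h _ (resolvent_dom (l0 n) y)))// ler_piMr//.
  exact: le_trans (resolvent_norm_le (l0 n) y) y1.
have Jv : seq_lim (fun n => resolvent A (l n) v) v.
  move=> e e0; have [n hn] := @invS_small R (e / (M + 1)) ltac:(by rewrite divr_gt0// ltr_wpDl).
  exists n => i /hn; rewrite -/(l i) (resolvent_dist (l0 i)) => li.
  rewrite (le_trans (ler_wpM2l (ltW (l0 i)) (BM i)))//.
  rewrite (le_trans (ler_wpM2r M0 li))// mulrAC -mulrA ler_piMr ?ltW//.
  by rewrite ltr_pdivrMr ?ltr_wpDl//; lra.
have [w Bw] : exists w, seq_lim (fun n => yosida A (l n) v) w.
  apply: (hilbert_complete hH) => e e0.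
  pose S := [set `|yosida A (l n) v| ^+ 2 | n in [set: nat]].
  have hS : has_sup S.
    split; first by exists (`|yosida A (l 0) v| ^+ 2), 0%N.
    exists (M ^+ 2) => _ [n _ <-].
    by rewrite ler_sqr ?nnegrE.
  have e2 : 0 < e ^+ 2 by rewrite exprn_gt0.
  have [_ [n _ <-] nS] := sup_adherent e2 hS.
  have nd i j : (i <= j)%N -> `|yosida A (l j) v - yosida A (l i) v| ^+ 2 <=
      `|yosida A (l j) v| ^+ 2 - `|yosida A (l i) v| ^+ 2.
    by move=> ij; apply: yosida_monotone => //; rewrite lef_pV2 ?posrE// ler_nat.
  have le_n i : (n <= i)%N -> `|yosida A (l n) v| ^+ 2 <= `|yosida A (l i) v| ^+ 2.
    by move=> /nd; have := sqr_ge0 `|yosida A (l i) v - yosida A (l n) v|; lra.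
  have leS i : `|yosida A (l i) v| ^+ 2 <= sup S.
    by apply: sup_upper_bound => //; exists i.
  exists n => i j ni nj; apply: le_of_sqr; first exact: ltW.
  have := le_n _ ni; have := le_n _ nj; have := leS i; have := leS j.
  have [/nd|/ltnW/nd] := leqP i j; last lra.
  rewrite distrC; lra.
have [Dv wE] := selfadjoint_closed (fun n => resolvent_dom (l0 n) v) Jv Bw.
by split => //; rewrite -wE; exact: (seq_lim_norm_le hH BM Bw).
Qed.

End one_operator.

(** Expanding [y] on one side and [x] on the other produces [l] times the pairing of the two
    approximations twice, which cancels. What is left involves the resolvents, which lie in the
    domains and whose forms are bounded by [yosida_form_le]; hence a constant independent of [l]. *)
Lemma yosida_close A1 A2 (r l : R) x y : 0 < l ->
  selfadjoint dot A1 -> nonpositive dot A1 ->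
  selfadjoint dot A2 -> nonpositive dot A2 -> 0 <= r ->
  (forall u v, op_dom A1 u -> op_dom A2 v ->
    `|dot (A1 u) v - dot u (A2 v)| <= r / 2 * (- dot (A1 u) u - dot (A2 v) v)) ->
  `|dot (yosida A1 l x) y - dot x (yosida A2 l y)| <=
    r / 2 * (- dot (yosida A1 l x) x - dot (yosida A2 l y) y).
Proof.
move=> l0 sA1 nA1 sA2 nA2 r0 h.
rewrite (resolvent_dotr sA2 nA2 l0 y) [dot x _]dotC.
rewrite (resolvent_dotr sA1 nA1 l0 x (yosida A2 l y)).
rewrite [dot (yosida A2 l y) (yosida A1 l x)]dotC opprB addrA subrK.
rewrite [dot (yosida A2 l y) _]dotC (le_trans (h _ _ _ _))//.
- exact: resolvent_dom.
- exact: resolvent_dom.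
rewrite ler_wpM2l ?divr_ge0// lerD//; exact: yosida_form_le.
Qed.

End yosida.

(** Two-sided, with [h = 0] and equality allowed, so that it can be used without side conditions;
    real functions are covered through [R^o]. *)
Definition has_deriv (R : realType) (V : normedModType R) (x : R -> V) (r : R)
    (d : V) :=
  forall e : R, 0 < e -> exists2 del : R, 0 < del & forall h, `|h| <= del ->
    `|x (r + h) - x r - h *: d| <= e * `|h|.

Lemma subrDD (V : zmodType) (a b c d : V) : a + b - (c + d) = a - c + (b - d).
Proof. by rewrite opprD addrACA. Qed.

(** * Derivatives of curves and mean value inequalities *)

Section deriv.
Context {R : realType}.
Implicit Types V W : normedModType R.

Lemma has_deriv_ext V (x y : R -> V) r d :
  (forall t, x t = y t) -> has_deriv x r d -> has_deriv y r d.
Proof. by move=> /funext ->. Qed.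

Lemma has_deriv_cst V (c : V) r : has_deriv (fun=> c) r 0.
Proof.
by move=> e e0; exists 1 => // h _; rewrite scaler0 subr0 subrr normr0 mulr_ge0// ltW.
Qed.

Lemma has_derivD V (x y : R -> V) r dx dy : has_deriv x r dx -> has_deriv y r dy ->
  has_deriv (fun t => x t + y t) r (dx + dy).
Proof.
move=> hx hy e e0; have [d1 d10 h1] := hx (e / 2) ltac:(lra).
have [d2 d20 h2] := hy (e / 2) ltac:(lra).
exists (Num.min d1 d2); first by rewrite lt_min d10.
move=> h; rewrite le_min => /andP[/h1 a /h2 b].
rewrite subrDD scalerDr subrDD.
by rewrite (le_trans (ler_normD _ _))// (splitr e) mulrDl lerD.
Qed.

Lemma has_deriv_lin V W (f : V -> W) K (x : R -> V) r d :
  (forall (a : R) u v, f (a *: u + v) = a *: f u + f v) ->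
  (forall u, `|f u| <= K * `|u|) ->
  has_deriv x r d -> has_deriv (fun t => f (x t)) r (f d).
Proof.
move=> flin fK hx e e0.
have K1 : 0 < `|K| + 1 by have := normr_ge0 K; lra.
have [d1 d10 h1] := hx (e / (`|K| + 1)) ltac:(by rewrite divr_gt0).
exists d1 => // h /h1 {}h1.
have f0 : f 0 = 0.
  by have := flin (-1) 0 0; rewrite scaler0 addr0 scaleN1r addNr.
have fB u v : f (u - v) = f u - f v.
  by have := flin (-1) v u; rewrite !scaleN1r addrC [- f v + _]addrC.
have fZ (a : R) u : f (a *: u) = a *: f u.
  by have := flin a u 0; rewrite f0 !addr0.
rewrite -fZ -!fB.
rewrite (le_trans (fK _))//.
rewrite (@le_trans _ _ ((`|K| + 1) * (e / (`|K| + 1) * `|h|)))//.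
  have KK : K <= `|K| + 1 by have := ler_norm K; lra.
  by rewrite (le_trans (ler_wpM2r (normr_ge0 _) KK))// ler_wpM2l// ltW.
by rewrite mulrA mulrCA mulfV ?gt_eqF// mulr1.
Qed.

Lemma has_derivZ V (a : R) (x : R -> V) r d :
  has_deriv x r d -> has_deriv (fun t => a *: x t) r (a *: d).
Proof.
apply: (@has_deriv_lin _ _ (fun u => a *: u) `|a|) => [b u v|u].
  by rewrite scalerDr !scalerA mulrC.
by rewrite normrZ.
Qed.

Lemma has_derivN V (x : R -> V) r d :
  has_deriv x r d -> has_deriv (fun t => - x t) r (- d).
Proof.
move=> h; have := has_derivZ (-1) h; rewrite scaleN1r.
by apply: has_deriv_ext => t; rewrite scaleN1r.
Qed.

Lemma has_derivB V (x y : R -> V) r dx dy : has_deriv x r dx -> has_deriv y r dy ->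
  has_deriv (fun t => x t - y t) r (dx - dy).
Proof. by move=> hx hy; apply: has_derivD => //; exact: has_derivN. Qed.

Lemma has_deriv_id r : has_deriv (fun t : R => t : R^o) r 1.
Proof.
move=> e e0; exists 1 => // h _.
by rewrite /GRing.scale/= mulr1 [r + h]addrC addrK subrr normr0 mulr_ge0// ltW.
Qed.

Lemma has_deriv_shift V (x : R -> V) t r d : has_deriv x (r + t) d ->
  has_deriv (fun s => x (s + t)) r d.
Proof.
move=> hx e /hx[d1 d10 h1]; exists d1 => // h /h1; by rewrite (addrAC r t).
Qed.

Lemma has_deriv_rev V (x : R -> V) t r d : has_deriv x (t - r) d ->
  has_deriv (fun s => x (t - s)) r (- d).
Proof.
move=> hx e /hx[d1 d10 h1]; exists d1 => // h hd.
have := h1 (- h); rewrite normrN => /(_ hd).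
by rewrite scalerN scaleNr (opprD r) addrA.
Qed.

Lemma has_deriv_cvg V (x : R -> V) r d : has_deriv x r d ->
  forall e, 0 < e -> exists2 del, 0 < del & forall s, `|s - r| <= del ->
    `|x s - x r| <= e.
Proof.
move=> hx e e0; have [d1 d10 h1] := hx 1 ltac:(by []).
have d1' : 0 < 1 + `|d| by have := normr_ge0 d; lra.
exists (Num.min d1 (e / (1 + `|d|))).
  by rewrite lt_min d10 divr_gt0.
move=> s; rewrite le_min => /andP[/h1]; rewrite [r + _]addrC subrK => a b.
rewrite -(subrK ((s - r) *: d) (x s - x r)) (le_trans (ler_normD _ _))//.
rewrite normrZ; move: b; rewrite ler_pdivlMr//; lra.
Qed.

Lemma has_derivP (f : R -> R^o) r d : has_deriv f r d <-> is_derive r 1 f d.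
Proof.
split=> [hf|[df <-] e e0].
  have cf : h^-1 *: (f (h *: 1 + r) - f r) @[h --> 0^'] --> d.
    apply/cvgrPdist_le => e e0; have [del del0 hdel] := hf e e0.
    near=> h; have h0 : h != 0 by near: h; exact: nbhs_dnbhs_neq.
    have hd : `|h| <= del.
      near: h; apply: dnbhs0_le; exact: del0.
    have := hdel h hd; rewrite -ler_pdivrMr ?normr_gt0//; apply: le_trans.
    rewrite -normfV -normrM distrC le_eqVlt; apply/orP; left; apply/eqP.
    congr (`|_|); rewrite /GRing.scale/= mulr1 [h + r]addrC; field.
    exact: h0.
  split; first by apply/cvg_ex; exists d.
  exact/cvg_lim.
have := df; move/cvgrPdist_le/(_ e e0).
move=> [del /= del0 hdel]; exists (del / 2); first by rewrite divr_gt0.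
move=> h hd; have [->|h0] := eqVneq h 0.
  by rewrite addr0 scale0r subr0 subrr !normr0 mulr0.
have := hdel h; rewrite /= sub0r normrN => /(_ _ h0) H1.
have {}H1 := H1 ltac:(lra).
rewrite -(@ler_pM2r _ `|h|) ?normr_gt0// in H1; apply: le_trans H1.
rewrite -normrM distrC le_eqVlt; apply/orP; left; apply/eqP.
congr (`|_|); rewrite /GRing.scale/= mulr1 [h + r]addrC /derive.
by rewrite mulrBl mulrAC mulVf// mul1r [h * _]mulrC.
Unshelve. all: by end_near. Qed.

(** The mean value theorem for [g - f]. Estimates are integrated in this form, with an explicit
    antiderivative [g] of the bound, so that solutions themselves are never integrated. *)
Lemma mean_le (f g df dg : R -> R) a b : a <= b ->
  (forall r, a <= r <= b -> has_deriv (f : R -> R^o) r (df r)) ->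
  (forall r, a <= r <= b -> has_deriv (g : R -> R^o) r (dg r)) ->
  (forall r, a < r < b -> df r <= dg r) -> f b - f a <= g b - g a.
Proof.
move=> ab hf hg dfg; pose k r := g r - f r.
have hk r : a <= r <= b -> is_derive (r : R^o) 1 (k : R^o -> R^o) (dg r - df r).
  by move=> arb; apply/has_derivP/has_derivB; [exact: hg|exact: hf].
move: ab; rewrite le_eqVlt => /predU1P[->|ab]; first by rewrite !subrr.
have [r|c|c cab] := @MVT _ k (fun r => dg r - df r) _ _ ab.
- by rewrite in_itv/= => /andP[ar rb]; apply: hk; rewrite !ltW.
- apply: continuous_in_subspaceT => x; rewrite inE/= in_itv/= => /hk[dk _].
  by apply/differentiable_continuous/derivable1_diffP.
rewrite in_itv/= in cab; have := dfg _ cab; move: cab => /andP[ac cb] h.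
rewrite /k => e; have : 0 <= (dg c - df c) * (b - a) by nra.
lra.
Qed.

Lemma has_deriv_powR (c t r : R) : r < t ->
  has_deriv (fun s => (t - s) `^ c : R^o) r (- (c * (t - r) `^ (c - 1))).
Proof.
move=> rt; apply: (@has_deriv_rev R^o (fun s => s `^ c)).
by apply/has_derivP/is_derive1_powR; rewrite subr_gt0.
Qed.

End deriv.

Definition eps_continuous (R : realType) (V : normedModType R) (D : set R)
    (f : R -> V) :=
  forall r, D r -> forall e : R, 0 < e -> exists2 del : R, 0 < del &
    forall s, D s -> `|s - r| <= del -> `|f s - f r| <= e.

Section vector_calculus.
Context {R : realType} {H : normedModType R} {dot : H -> H -> R}.
Hypothesis hH : hilbert_dot dot.

Local Notation dotC := (dotC hH).
Local Notation dotE := (dotE hH).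
Local Notation dotlin := (dotlin hH).

Lemma has_deriv_dot (x y : R -> H) r dx dy : has_deriv x r dx -> has_deriv y r dy ->
  has_deriv (fun s => dot (x s) (y s) : R^o) r (dot dx (y r) + dot (x r) dy).
Proof.
move=> hx hy e e0.
have y1 : 0 < `|y r| + 1 by have := normr_ge0 (y r); lra.
have x1 : 0 < `|x r| + 1 by have := normr_ge0 (x r); lra.
have dx1 : 0 < `|dx| + 1 by have := normr_ge0 dx; lra.
have [d1 d10 h1] := hx (e / 3 / (`|y r| + 1)) ltac:(by rewrite !divr_gt0).
have [d2 d20 h2] := hy (e / 3 / (`|x r| + 1)) ltac:(by rewrite !divr_gt0).
have [d3 d30 h3] := has_deriv_cvg hy (e := e / 3 / (`|dx| + 1)) ltac:(by rewrite !divr_gt0).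
have [d4 d40 h4] := has_deriv_cvg hy ltr01.
exists (Num.min (Num.min d1 d2) (Num.min d3 d4)).
  by rewrite !lt_min d10 d20 d30 d40.
move=> h; rewrite !le_min => /andP[/andP[/h1 a /h2 b]] /andP[c d].
have rhr : r + h - r = h by rewrite addrC addKr.
have {}c := h3 (r + h) ltac:(by rewrite rhr).
have {}d := h4 (r + h) ltac:(by rewrite rhr).
have -> : dot (x (r + h)) (y (r + h)) - dot (x r) (y r) -
    h *: (dot dx (y r) + dot (x r) dy : R^o) =
  dot (x (r + h) - x r - h *: dx) (y (r + h)) + h * dot dx (y (r + h) - y r)
  + dot (x r) (y (r + h) - y r - h *: dy).
  rewrite !dotlin /GRing.scale/=; ring.
have yh : `|y (r + h)| <= `|y r| + 1.
  by rewrite -[y (r + h)](subrK (y r)) (le_trans (ler_normD _ _))//; lra.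
have A : `|dot (x (r + h) - x r - h *: dx) (y (r + h))| <= e / 3 * `|h|.
  rewrite (le_trans (dot_abs hH _ _))// (le_trans (ler_pM _ _ a yh))//.
  by rewrite mulrAC divfK// gt_eqF.
have B : `|h * dot dx (y (r + h) - y r)| <= e / 3 * `|h|.
  rewrite normrM mulrC ler_wpM2r// (le_trans (dot_abs hH _ _))//.
  rewrite (@le_trans _ _ ((`|dx| + 1) * (e / 3 / (`|dx| + 1))))//.
    by rewrite ler_pM//; lra.
  by rewrite mulrC divfK// gt_eqF.
have C : `|dot (x r) (y (r + h) - y r - h *: dy)| <= e / 3 * `|h|.
  rewrite (le_trans (dot_abs hH _ _))//.
  rewrite (@le_trans _ _ ((`|x r| + 1) * (e / 3 / (`|x r| + 1) * `|h|)))//.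
    by rewrite ler_pM//; lra.
  by rewrite mulrA [_ * (e / _ / _)]mulrC divfK// gt_eqF.
rewrite (le_trans (ler_normD _ _))// (splitr e).
have := ler_normD (dot (x (r + h) - x r - h *: dx) (y (r + h)))
  (h * dot dx (y (r + h) - y r)).
lra.
Qed.

Lemma has_deriv_dotr (x : R -> H) r dx v : has_deriv x r dx ->
  has_deriv (fun s => dot (x s) v : R^o) r (dot dx v).
Proof.
move=> hx; have := has_deriv_dot hx (has_deriv_cst v r).
by rewrite (dot0r hH) addr0.
Qed.

Lemma has_deriv_sqr_norm (x : R -> H) r dx : has_deriv x r dx ->
  has_deriv (fun s => `|x s| ^+ 2 : R^o) r (2 * dot dx (x r)).
Proof.
move=> hx; have := has_deriv_dot hx hx; rewrite [dot (x r) _]dotC.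
rewrite -mulr2n -[_ *+ 2]mulr_natl.
by apply: has_deriv_ext => s; rewrite dotE.
Qed.

Lemma norm_mean_le (x dx : R -> H) (g dg : R -> R) a b : a <= b ->
  (forall r, a <= r <= b -> has_deriv x r (dx r)) ->
  (forall r, a <= r <= b -> has_deriv (g : R -> R^o) r (dg r)) ->
  (forall r, a < r < b -> `|dx r| <= dg r) -> `|x b - x a| <= g b - g a.
Proof.
move=> ab hx hg dxg; apply: (norm_le_dot hH) => v v1.
have -> : dot (x b - x a) v = dot (x b) v - dot (x a) v by rewrite !dotlin.
have hxv r (r1 : a <= r <= b) := has_deriv_dotr v (hx r r1).
apply: (mean_le ab hxv hg) => r /dxg h.
rewrite (le_trans (dot_le hH _ _))// (le_trans _ h)// ler_piMr//.
Qed.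

Lemma deriv_uniq (f g df : R -> R) a b : a <= b ->
  (forall r, a <= r <= b -> has_deriv (f : R -> R^o) r (df r)) ->
  (forall r, a <= r <= b -> has_deriv (g : R -> R^o) r (df r)) ->
  f b - f a = g b - g a.
Proof.
by move=> ab hf hg; apply/eqP; rewrite eq_le !(mean_le (df := df) (dg := df)).
Qed.

(** The integral starts at -2, to the left of the times of interest, because the fundamental theorem
    gives two-sided derivatives only at interior points. *)
Lemma real_primitive (g : R -> R) : eps_continuous setT (g : R -> R^o) ->
  exists2 G : R -> R, G (-1) = 0 &
    forall t, -2 < t -> has_deriv (G : R -> R^o) t (g t).
Proof.
move=> cg; have {}cg : continuous (g : R^o -> R^o).
  move=> t; apply/cvgrPdist_le => e e0; have [del del0 h] := cg t I e e0.
  by apply/nbhs_ballP; exists del => //= s sd; rewrite distrC h// distrC ltW.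
pose F t := (\int[lebesgue_measure]_(s in `[(-2), t]) g s).
exists (fun t => F t - F (-1)) => [|t t2]; first by rewrite subrr.
have [] := @continuous_FTC1_closed _ g (-2) t (t + 1).
- by rewrite ltrDl.
- apply: continuous_compact_integrable; first exact: segment_compact.
  exact: continuous_subspaceT.
- exact: t2.
- exact: cg.
move=> dF Fg; rewrite -[g t]subr0; apply: has_derivB; last exact: has_deriv_cst.
apply/has_derivP; split; first exact: dF.
by rewrite -derive1E; exact: Fg.
Qed.

(** A weak integral: the scalar primitives [G v] of [dot (f t) v] are linear in [v] and bounded by
    the primitive [N] of the norm, so that Riesz represents them by a vector. It is differentiable
    in norm because the increments are estimated uniformly over unit vectors [v]. *)
Lemma primitive (f : R -> H) : eps_continuous setT f ->
  exists2 F : R -> H, F 0 = 0 & forall t, -1 < t -> has_deriv F t (f t).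
Proof.
move=> cf.
have cv v : eps_continuous setT (fun t => dot (f t) v : R^o).
  move=> r _ e e0; have v1 : 0 < `|v| + 1 by have := normr_ge0 v; lra.
  have [del d0 h] := cf r I (e / (`|v| + 1)) ltac:(by rewrite divr_gt0).
  exists del => // s _ /(h s I) {}h.
  have -> : dot (f s) v - dot (f r) v = dot (f s - f r) v by rewrite !dotlin.
  rewrite (le_trans (dot_abs hH _ _))// (le_trans (ler_wpM2r _ h))//.
  by rewrite mulrAC -mulrA ler_piMr ?ltW// ltr_pdivrMr//; lra.
have cn : eps_continuous setT (fun t => `|f t| : R^o).
  move=> r _ e /(cf r I e)[del d0 h]; exists del => // s _ /(h s I).
  by apply: le_trans; exact: ler_dist_dist.
have [N N0 dN] := real_primitive cn.
pose G v := s2val (cid2 (real_primitive (cv v))).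
have G0 v : G v (-1) = 0 by exact: (s2valP (cid2 (real_primitive (cv v)))).
have dG v : forall t, -2 < t -> has_deriv (G v : R -> R^o) t (dot (f t) v).
  exact: (s2valP' (cid2 (real_primitive (cv v)))).
have zP t : exists z, -1 <= t -> forall v, G v t = dot z v.
  have [t1|t1] := leP (-1) t; last by exists 0.
  have [a u v|u|z hz] := riesz hH (f := G^~ t) (K := N t).
  - have := @deriv_uniq (G (a *: u + v)) (fun t => a * G u t + G v t)
      (fun r => dot (f r) (a *: u + v)) _ _ t1.
    rewrite !G0 mulr0 addr0 !subr0; apply => r /andP[r1 _].
      by apply: dG; lra.
    rewrite !dotlin; apply: has_derivD; last by apply: dG; lra.
    by apply: (@has_derivZ _ R^o); apply: dG; lra.
  - have hN : forall r, -1 <= r <= t ->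
        has_deriv (fun t => `|u| * N t : R^o) r (`|u| * `|f r|).
      by move=> r /andP[r1 _]; apply: (@has_derivZ _ R^o); apply: dN; lra.
    have hG : forall r, -1 <= r <= t -> has_deriv (G u : R -> R^o) r (dot (f r) u).
      by move=> r /andP[r1 _]; apply: dG; lra.
    have fu r := dot_abs hH (f r) u.
    rewrite ler_norml mulrC; apply/andP; split; last first.
      have := mean_le t1 hG hN; rewrite G0 N0 mulr0 !subr0; apply => r _.
      by have := fu r; rewrite ler_norml mulrC => /andP[].
    have hN' : forall r, -1 <= r <= t ->
        has_deriv (fun t => - `|u| * N t : R^o) r (- `|u| * `|f r|).
      by move=> r /andP[r1 _]; apply: (@has_derivZ _ R^o); apply: dN; lra.
    have := mean_le t1 hN' hG; rewrite G0 N0 mulr0 !subr0 mulNr; apply => r _.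
    by have := fu r; rewrite mulNr ler_norml mulrC => /andP[].
  - by exists z.
pose F t := sval (cid (zP t)).
have FE t v : -1 <= t -> G v t = dot (F t) v.
  by move=> t1; exact: (svalP (cid (zP t)) t1 v).
exists (fun t => F t - F 0) => [|t t1]; first by rewrite subrr.
rewrite -[f t]subr0; apply: has_derivB; last exact: has_deriv_cst.
move=> e e0; have [del d0 hd] := cf t I e e0.
exists (Num.min del (t + 1)); first by rewrite lt_min d0; lra.
move=> h; rewrite le_min => /andP[hdel ht].
have /andP[th1 th2] : - (t + 1) <= h <= t + 1 by rewrite -ler_norml.
apply: (norm_le_dot hH) => v v1.
have -> : dot (F (t + h) - F t - h *: f t) v =
    (G v (t + h) - G v t) - h * dot (f t) v.
  by rewrite !FE ?dotlin; [ring|lra|lra].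
have bnd r : `|r - t| <= `|h| -> `|dot (f r) v - dot (f t) v| <= e.
  move=> rh; have -> : dot (f r) v - dot (f t) v = dot (f r - f t) v by rewrite !dotlin.
  rewrite (le_trans (dot_abs hH _ _))// (le_trans _ (hd r I _))//.
    by rewrite ler_piMr.
  exact: le_trans hdel.
have lin (c r : R) : has_deriv (fun r => c * r : R^o) r c.
  by rewrite -[X in has_deriv _ _ X]mulr1; apply: (@has_derivZ _ R^o); exact: has_deriv_id.
have [h0|h0] := leP 0 h.
  have th : t <= t + h by lra.
  have dGh : forall r, t <= r <= t + h -> has_deriv (G v : R -> R^o) r (dot (f r) v).
    by move=> r /andP[r1 _]; apply: dG; lra.
  have := mean_le th dGh (fun r _ => lin (dot (f t) v + e) r) => H1.
  rewrite ger0_norm//; suff : G v (t + h) - G v t <= (dot (f t) v + e) * (t + h)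
    - (dot (f t) v + e) * t by lra.
  apply: H1 => r /andP[tr rt].
  have := bnd r; rewrite (ger0_norm h0) ger0_norm; last lra.
  move=> /(_ ltac:(lra)).
  by rewrite ler_norml; lra.
have th : t + h <= t by lra.
have dGh : forall r, t + h <= r <= t -> has_deriv (G v : R -> R^o) r (dot (f r) v).
  by move=> r /andP[r1 _]; apply: dG; lra.
have := mean_le th (fun r _ => lin (dot (f t) v - e) r) dGh => H1.
rewrite ltr0_norm//; suff : (dot (f t) v - e) * t - (dot (f t) v - e) * (t + h) <=
  G v t - G v (t + h) by lra.
apply: H1 => r /andP[tr rt].
have := bnd r; rewrite (ltr0_norm h0) ltr0_norm; last lra.
move=> /(_ ltac:(lra)).
by rewrite ler_norml; lra.
Qed.

End vector_calculus.

(** * Linear differential equations with bounded generators *)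

Section ode.
Context {R : realType} {H : normedModType R} {dot : H -> H -> R}.
Hypothesis hH : hilbert_dot dot.

Lemma expr2V_small (e : R) : 0 < e -> exists n, forall i, (n <= i)%N ->
  2^-1 ^+ i <= e.
Proof.
move=> /invS_small[n h]; exists n => i /h; apply: le_trans.
by rewrite exprVn -natrX lef_pV2 ?posrE// ?ltr0n ?expn_gt0// ler_nat ltn_expl.
Qed.

Lemma geometric_lim (u : nat -> H) C : 0 <= C ->
  (forall n, `|u n.+1 - u n| <= C * 2^-1 ^+ n) ->
  exists2 l, seq_lim u l & forall n, `|l - u n| <= 2 * C * 2^-1 ^+ n.
Proof.
move=> C0 h.
have hk n k : `|u (n + k)%N - u n| <= 2 * C * 2^-1 ^+ n - 2 * C * 2^-1 ^+ (n + k).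
  elim: k => [|k IH]; first by rewrite addn0 !subrr normr0.
  rewrite addnS -(subrKA (u (n + k)%N)) (le_trans (ler_normD _ _))//.
  by have := h (n + k)%N; rewrite exprS; lra.
have hk' n k : `|u (n + k)%N - u n| <= 2 * C * 2^-1 ^+ n.
  rewrite (le_trans (hk n k))// gerBl mulr_ge0 ?exprn_ge0//; lra.
have [l ul] : exists l, seq_lim u l.
  apply: (hilbert_complete hH) => e e0.
  have C1 : 0 < 2 * C + 1 by lra.
  have [n hn] := expr2V_small (e := e / (2 * C + 1) / 2) ltac:(by rewrite !divr_gt0).
  have small i : (n <= i)%N -> `|u i - u n| <= e / 2.
    move=> /subnKC <-; rewrite (le_trans (hk' _ _))//.
    have := hn n (leqnn _); rewrite mulrAC ler_pdivlMr//.
    have : 0 <= 2^-1 ^+ n :> R by rewrite exprn_ge0.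
    lra.
  exists n => i j /small a /small b.
  rewrite -(subrKA (u n)) (le_trans (ler_normD _ _))// [`|u n - _|]distrC; lra.
exists l => // n.
apply: (seq_lim_norm_le hH (u := fun k => u (n + k)%N - u n)) => [k|e /ul[m hm]].
  exact: hk'.
exists m => i mi; rewrite opprB addrA subrK; apply: hm.
exact: leq_trans mi (leq_addl _ _).
Qed.

Lemma has_deriv_exp (c a r : R) :
  has_deriv (fun t => c * expR (a * t) : R^o) r (c * (a * expR (a * r))).
Proof.
apply: (@has_derivZ _ R^o); apply/has_derivP.
have := @is_derive1_comp _ (@expR R) (fun t => a * t) r _ _ (is_derive_expR _).
move=> /(_ a); rewrite mulrC; apply.
by apply/has_derivP; rewrite -[X in has_deriv _ _ X]mulr1; apply: (@has_derivZ _ R^o);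
  exact: has_deriv_id.
Qed.

Lemma has_deriv_continuous (x dx : R -> H) (D : set R) :
  (forall r, D r -> has_deriv x r (dx r)) -> eps_continuous D x.
Proof.
move=> h r Dr e /(has_deriv_cvg (h r Dr))[del d0 hd].
by exists del => // s _; exact: hd.
Qed.

Record bounded_family (B : R -> H -> H) (M : R) : Prop := BoundedFamily {
  bf_lin : forall r (a : R) u v, B r (a *: u + v) = a *: B r u + B r v;
  bf_bound : forall r u, `|B r u| <= M * `|u|;
  bf_cont : forall r e, 0 < e -> exists2 del : R, 0 < del &
    forall s, `|s - r| <= del -> forall x, `|B s x - B r x| <= e * `|x| }.

Section solution.
Variables (B : R -> H -> H) (M : R).
Hypothesis hB : bounded_family B M.

Lemma bf0 r : B r 0 = 0.
Proof.
by have := bf_lin hB r (-1) 0 0; rewrite scaler0 addr0 scaleN1r addNr.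
Qed.

Lemma bfB r u v : B r (u - v) = B r u - B r v.
Proof.
by have := bf_lin hB r (-1) v u; rewrite !scaleN1r addrC [- B r v + _]addrC.
Qed.

Lemma bfZ r (a : R) u : B r (a *: u) = a *: B r u.
Proof. by have := bf_lin hB r a u 0; rewrite bf0 !addr0. Qed.

Lemma bfD r u v : B r (u + v) = B r u + B r v.
Proof. by have := bf_lin hB r 1 u v; rewrite !scale1r. Qed.

Lemma bf_has_deriv r (x : R -> H) t dx :
  has_deriv x t dx -> has_deriv (fun s => B r (x s)) t (B r dx).
Proof. apply: has_deriv_lin; [exact: bf_lin hB r|exact: bf_bound hB r]. Qed.

Hypothesis M0 : 0 < M.

Lemma bf_continuous D (x : R -> H) : eps_continuous D x ->
  eps_continuous D (fun r => B r (x r)).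
Proof.
move=> cx r Dr e e0; have x1 : 0 < `|x r| + 1 by have := normr_ge0 (x r); lra.
have [d1 d10 h1] := bf_cont hB r (e := e / 2 / (`|x r| + 1)) ltac:(by rewrite !divr_gt0).
have [d2 d20 h2] := cx r Dr (e / 2 / M) ltac:(by rewrite !divr_gt0).
exists (Num.min d1 d2) => [|s Ds]; first by rewrite lt_min d10.
rewrite le_min => /andP[/h1 /(_ (x r)) a /(h2 s Ds)].
rewrite ler_pdivlMr// => b.
rewrite -(subrKA (B s (x r))) (le_trans (ler_normD _ _))// (splitr e) lerD//.
  by rewrite -bfB (le_trans (bf_bound hB _ _))// mulrC.
rewrite (le_trans a)// mulrAC -mulrA ler_piMr//; first lra.
by rewrite ler_pdivrMr//; lra.
Qed.

Let nneg : set R := [set r | 0 <= r].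
(** Integrands are frozen at their value at 0 for negative times, so that the primitive has a
    two-sided derivative at 0. *)
Let mx (r : R) := Num.max r 0.

Let mx_id r : 0 <= r -> mx r = r. Proof. by move=> r0; rewrite /mx max_l. Qed.

Let mx_ge0 r : nneg (mx r). Proof. by rewrite /nneg/= /mx le_max lexx orbT. Qed.

Let mx_continuous (f : R -> H) : eps_continuous nneg f ->
  eps_continuous setT (fun r => f (mx r)).
Proof.
move=> cf r _ e /(cf (mx r) (mx_ge0 r))[del d0 h]; exists del => // s _ sr.
apply: h; first exact: mx_ge0.
rewrite (le_trans _ sr)// /mx.
have [s0|s0] := leP s 0; have [r0|r0] := leP r 0; rewrite ?(subrr, normr0, normr_ge0)//.
- by rewrite sub0r normrN gtr0_norm// distrC (le_trans _ (ler_norm _))//; lra.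
- by rewrite subr0 gtr0_norm// (le_trans _ (ler_norm _))//; lra.
Qed.

Variable u0 : H.

Let prim (f : R -> H) : R -> H := xget (fun=> 0)
  [set F | F 0 = 0 /\ forall t, -1 < t -> has_deriv F t (f t)].

Let primP f : eps_continuous setT f ->
  prim f 0 = 0 /\ forall t, -1 < t -> has_deriv (prim f) t (f t).
Proof.
move=> /(primitive hH)[F F0 dF]; rewrite /prim; case: xgetP => [G _ //|] h.
by case: (h F).
Qed.

Let picard (x : R -> H) (t : R) : H := u0 + prim (fun r => B (mx r) (x (mx r))) t.

Let picardP x : eps_continuous nneg x -> picard x 0 = u0 /\
  forall t, 0 <= t -> has_deriv (picard x) t (B t (x t)).
Proof.
move=> cx.
have /primP[F0 dF] := mx_continuous (bf_continuous cx).
split=> [|t t0]; first by rewrite /picard F0 addr0.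
rewrite -[B t _]add0r; apply: has_derivD; first exact: has_deriv_cst.
by have := dF t; rewrite mx_id//; apply; lra.
Qed.

Let u_ n := iter n picard (fun=> u0).

Let u_continuous n : eps_continuous nneg (u_ n).
Proof.
elim: n => [|n IH]; last exact: has_deriv_continuous (picardP IH).2.
by move=> r _ e e0; exists 1 => // s _ _; rewrite subrr normr0 ltW.
Qed.

(** The rate [2 * M] is twice the Lipschitz constant: integrating [M * expR (2 * M * r)] gives at
    most half of [expR (2 * M * t)], hence a factor [2^-1] per iteration without restriction on
    [t]. *)
Let u_dist n t : 0 <= t ->
  `|u_ n.+1 t - u_ n t| <= `|u0| * expR (2 * M * t) * 2^-1 ^+ n.
Proof.
elim: n t => [|n IH] t t0.
  have [p0 dp] := picardP (u_continuous 0).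
  have -> : u_ 1 t - u_ 0 t = picard (u_ 0) t - picard (u_ 0) 0 by rewrite p0.
  rewrite expr0 mulr1.
  have := @norm_mean_le _ _ _ hH (picard (u_ 0)) (fun r => B r (u_ 0 r))
    (fun r => `|u0| / 2 * expR (2 * M * r)) _ 0 t t0
    (fun r hr => dp r (andP hr).1) (fun r _ => has_deriv_exp _ _ r).
  rewrite mulr0 expR0 => h; rewrite (le_trans (h _))//; last first.
    have := normr_ge0 u0; have := expR_gt0 (2 * M * t); nra.
  move=> r /andP[r0 _]; rewrite (le_trans (bf_bound hB _ _))//=.
  have e1 : 1 <= expR (2 * M * r) by rewrite -expR0 ler_expR !mulr_ge0// ltW.
  have := ler_wpM2l (mulr_ge0 (ltW M0) (normr_ge0 u0)) e1; lra.
have [p0 dp] := picardP (u_continuous n.+1).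
have [q0 dq] := picardP (u_continuous n).
have := @norm_mean_le _ _ _ hH (fun r => u_ n.+2 r - u_ n.+1 r)
  (fun r => B r (u_ n.+1 r) - B r (u_ n r))
  (fun r => `|u0| * 2^-1 ^+ n / 2 * expR (2 * M * r)) _ 0 t t0
  (fun r hr => has_derivB (dp r (andP hr).1) (dq r (andP hr).1))
  (fun r _ => has_deriv_exp _ _ r).
have E2 : u_ n.+2 0 = u0 := p0; have E1 : u_ n.+1 0 = u0 := q0.
rewrite E2 E1 subrr subr0 => h; rewrite (le_trans (h _))//.
  move=> r /andP[r0 _]; rewrite -bfB (le_trans (bf_bound hB _ _))//.
  have := ler_wpM2l (ltW M0) (IH r (ltW r0)); lra.
rewrite mulr0 expR0 exprS.
have := mulr_ge0 (normr_ge0 u0) (exprn_ge0 n (_ : 0 <= 2^-1 :> R)).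
rewrite invr_ge0 => /(_ ltac:(by [])); lra.
Qed.

Lemma ode_solution0 : exists2 x : R -> H, x 0 = u0 &
  forall t, 0 <= t -> has_deriv x t (B t (x t)).
Proof.
have lim_ex t : exists l, 0 <= t ->
    forall n, `|l - u_ n t| <= 2 * (`|u0| * expR (2 * M * t)) * 2^-1 ^+ n.
  have [t0|t0] := leP 0 t; last by exists 0.
  have [|l _ h] := @geometric_lim (fun n => u_ n t) (`|u0| * expR (2 * M * t)) _
    (fun n => u_dist n t0).
    by rewrite mulr_ge0// expR_ge0.
  by exists l.
pose x t := sval (cid (lim_ex t)).
have xu t n : 0 <= t -> `|x t - u_ n t| <= 2 * (`|u0| * expR (2 * M * t)) * 2^-1 ^+ n.
  by move=> t0; exact: (svalP (cid (lim_ex t)) t0 n).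
have cx : eps_continuous nneg x.
  move=> r r0 e e0; set K := 2 * (`|u0| * expR (2 * M * (r + 1))) + 1.
  have K0 : 0 < K.
    by have := mulr_ge0 (normr_ge0 u0) (expR_ge0 (2 * M * (r + 1))); rewrite /K; lra.
  have [n /(_ n (leqnn _)) hn] := expr2V_small (e := e / 3 / K) ltac:(by rewrite !divr_gt0).
  have [del d0 hd] := @u_continuous n r r0 (e / 3) ltac:(lra).
  have near_u s : 0 <= s -> s <= r + 1 -> `|x s - u_ n s| <= e / 3.
    move=> s0 sr; rewrite (le_trans (xu s n s0))//.
    rewrite (@le_trans _ _ (K * 2^-1 ^+ n))//; last by rewrite mulrC -ler_pdivlMr.
    rewrite ler_wpM2r ?exprn_ge0//.
    have : expR (2 * M * s) <= expR (2 * M * (r + 1)) by rewrite ler_expR ler_pM2l// mulr_gt0.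
    by move=> /(ler_wpM2l (normr_ge0 u0)); rewrite /K; lra.
  exists (Num.min del 1) => [|s s0]; first by rewrite lt_min d0 ltr01.
  rewrite le_min => /andP[/(hd s s0) a]; rewrite ler_norml => /andP[_ b].
  have A := near_u s s0 ltac:(lra); have C := near_u r r0 ltac:(lra).
  rewrite -(subrKA (u_ n s)) (le_trans (ler_normD _ _))//.
  rewrite -(subrKA (u_ n r) (u_ n s)).
  have := ler_normD (u_ n s - u_ n r) (u_ n r - x r).
  by rewrite [`|u_ n r - x r|]distrC; lra.
have [p0 dp] := picardP cx.
(* The solution is [picard x], which agrees with the limit [x] for nonnegative times and is also
   differentiable from the left at 0. *)
suff xE t : 0 <= t -> picard x t = x t.
  by exists (picard x) => // t t0; rewrite xE//; exact: dp.
move=> t0; apply/eqP; rewrite -subr_eq0 -normr_le0; apply/ler_addgt0Pr => e e0.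
rewrite add0r; set K := `|u0| * expR (2 * M * t).
have K0 : 0 <= K by rewrite mulr_ge0// expR_ge0.
have [n /(_ n (leqnn _)) hn] := expr2V_small (e := e / (2 * K + 1)) ltac:(by rewrite divr_gt0//; lra).
have [q0 dq] := picardP (u_continuous n).
have := @norm_mean_le _ _ _ hH (fun r => picard x r - u_ n.+1 r)
  (fun r => B r (x r) - B r (u_ n r))
  (fun r => `|u0| * 2^-1 ^+ n * expR (2 * M * r)) _ 0 t t0
  (fun r hr => has_derivB (dp r (andP hr).1) (dq r (andP hr).1))
  (fun r _ => has_deriv_exp _ _ r).
have E1 : u_ n.+1 0 = u0 := q0.
rewrite p0 E1 subrr subr0 => h.
have {}h : `|picard x t - u_ n.+1 t| <= `|u0| * 2^-1 ^+ n * expR (2 * M * t)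
    - `|u0| * 2^-1 ^+ n * expR (2 * M * 0).
  apply: h => r /andP[r0 _]; rewrite -bfB (le_trans (bf_bound hB _ _))//.
  have := ler_wpM2l (ltW M0) (xu r n (ltW r0)); lra.
have h2 := xu t n.+1 t0.
rewrite -(subrKA (u_ n.+1 t)) (le_trans (ler_normD _ _))//.
rewrite [`|_ - x t|]distrC; move: h h2; rewrite exprS mulr0 expR0 => h h2.
have p2 : 0 <= `|u0| * 2^-1 ^+ n :> R by rewrite mulr_ge0// exprn_ge0.
move: hn; rewrite ler_pdivlMr; last lra.
rewrite -/K in h2; rewrite mulrAC -/K in h.
have : 0 <= 2^-1 ^+ n :> R by rewrite exprn_ge0.
lra.
Qed.

End solution.

Lemma ode_solution B M tau u0 : bounded_family B M -> 0 < M ->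
  exists2 x : R -> H, x tau = u0 &
  forall t, tau <= t -> has_deriv x t (B t (x t)).
Proof.
move=> hB M0; have hB' : bounded_family (fun r => B (r + tau)) M.
  split=> [r|r|r e /(bf_cont hB (r + tau))[del d0 h]].
  - exact: bf_lin hB _.
  - exact: bf_bound hB _.
  - by exists del => // s sr x; apply: h; rewrite opprD addrACA subrr addr0.
have [x x0 dx] := ode_solution0 hB' M0 u0.
exists (fun t => x (t - tau)) => [|t t0]; first by rewrite subrr.
apply: has_deriv_shift; have := dx (t - tau); rewrite subrK; apply.
by rewrite subr_ge0.
Qed.

End ode.

(** * Dissipative families whose forms are Hoelder continuous in time *)

Section dissipative.
Context {R : realType} {H : normedModType R} {dot : H -> H -> R}.
Hypothesis hH : hilbert_dot dot.

Local Notation dotC := (dotC hH).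
Local Notation dotE := (dotE hH).
Local Notation dotlin := (dotlin hH).

Lemma has_derivM (f g : R -> R) r df dg :
  has_deriv (f : R -> R^o) r df -> has_deriv (g : R -> R^o) r dg ->
  has_deriv (fun t => f t * g t : R^o) r (f r * dg + g r * df).
Proof.
move=> /has_derivP hf /has_derivP hg; exact/has_derivP.
Qed.

Lemma has_derivZl (a r : R) : has_deriv (fun t => a * t : R^o) r a.
Proof.
by rewrite -[X in has_deriv _ _ X]mulr1; apply: (@has_derivZ _ R^o); exact: has_deriv_id.
Qed.

(** Reaches the endpoint [t] when the comparison function contains a power of [t - r], which may
    fail to be differentiable at [r = t]. *)
Lemma left_limit_le (f : R -> R) tau t d K : tau < t ->
  has_deriv (f : R -> R^o) t d -> (forall r, tau <= r < t -> f r <= K) -> f t <= K.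
Proof.
move=> taut df h; apply/ler_addgt0Pr => e e0.
have [del d0 hd] := has_deriv_cvg df e0.
pose r := Num.max tau (t - del).
have r1 : tau <= r < t by rewrite /r le_max lexx /= gt_max taut /= gtrBl.
have r2 : `|r - t| <= del.
  rewrite distrC ger0_norm; last by rewrite subr_ge0 ltW//; case/andP: r1.
  by rewrite lerBlDl -lerBlDr /r le_max lexx orbT.
have := h r r1; have := hd r r2; rewrite ler_norml => /andP[]; lra.
Qed.

Definition is_sol (B : R -> H -> H) (tau : R) (x : R -> H) :=
  forall r, tau <= r -> has_deriv x r (B r (x r)).

Definition form (B : R -> H -> H) (r : R) (x : H) : R := - dot (B r x) x.

(** The constant [M] provides solutions only: it is [(lam n)^-1] for the Yosida approximations,
    hence unbounded, and the constants below are built from [C], [eta] and [T]. *)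
Record dissipative (B : R -> H -> H) (M C eta : R) : Prop := Dissipative {
  ds_bf : bounded_family B M;
  ds_M : 0 < M;
  ds_C : 0 < C;
  ds_sym : forall r x y, dot (B r x) y = dot x (B r y);
  ds_neg : forall r x, dot (B r x) x <= 0;
  ds_close : forall r s x y, `|dot (B r x) y - dot (B s x) y| <=
    C * `|r - s| `^ eta / 2 * (form B r x + form B s y) }.

Lemma dissipative_rev B M C eta : dissipative B M C eta ->
  dissipative (fun r => B (- r)) M C eta.
Proof.
case=> [[lin bd ct] M0 C0 sym neg cl]; split=> // [|r s x y]; last first.
  have -> : `|r - s| = `|- r - - s| by rewrite -opprD normrN.
  exact: cl.
split=> // r e /(ct (- r))[del d0 h]; exists del => // s sr x; apply: h.
by rewrite -opprD normrN.
Qed.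

Lemma dissipative_frozen B M C eta t : dissipative B M C eta ->
  dissipative (fun=> B t) M C eta.
Proof.
case=> [[lin bd ct] M0 C0 sym neg cl]; split=> // [|r s x y]; last first.
  rewrite subrr normr0 !mulr_ge0 ?(ltW C0) ?powR_ge0//.
  by rewrite addr_ge0// oppr_ge0.
by split=> // r e e0; exists 1 => // s _ x; rewrite subrr normr0 mulr_ge0// ltW.
Qed.

Section estimates.
Variables (B : R -> H -> H) (M C eta : R).
Hypothesis hB : dissipative B M C eta.

Let lin := bfZ (ds_bf hB).

Lemma form_ge0 r x : 0 <= form B r x.
Proof. by rewrite oppr_ge0; exact: ds_neg hB r x. Qed.

Lemma formZ r a x : form B r (a *: x) = a ^+ 2 * form B r x.
Proof. by rewrite /form lin !dotlin; ring. Qed.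

(** Scaling [x] by [sqrt k] and [y] by its inverse leaves the left-hand side unchanged, and allows
    one form to be made small at the expense of the other. *)
Lemma ds_close_scaled k r s x y : 0 < k ->
  `|dot (B r x) y - dot (B s x) y| <=
    C * `|r - s| `^ eta / 2 * (k * form B r x + k^-1 * form B s y).
Proof.
move=> k0; have a0 : 0 < Num.sqrt k by rewrite sqrtr_gt0.
have := ds_close hB r s (Num.sqrt k *: x) ((Num.sqrt k)^-1 *: y).
rewrite !lin !formZ exprVn sqr_sqrtr ?(ltW k0)// !dotlin.
by rewrite ![(Num.sqrt k)^-1 * _]mulrC ![Num.sqrt k * (_ * _)]mulrCA mulfV
  ?gt_eqF// !mulr1.
Qed.

Lemma ds_close_mul a b r s x y : 0 < a -> 0 < b ->
  form B r x <= a ^+ 2 -> form B s y <= b ^+ 2 ->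
  `|dot (B r x) y - dot (B s x) y| <= C * `|r - s| `^ eta * (a * b).
Proof.
move=> a0 b0 ha hb; rewrite (le_trans (ds_close_scaled r s x y (k := b / a) _))//.
  by rewrite divr_gt0.
rewrite -mulrA ler_wpM2l ?(mulr_ge0 (ltW (ds_C hB)) (powR_ge0 _ _))//.
rewrite invf_div ler_pdivrMl//.
have h1 : b / a * form B r x <= b * a.
  by rewrite mulrAC ler_pdivrMr// -mulrA -expr2 ler_pM2l.
have h2 : a / b * form B s y <= a * b.
  by rewrite mulrAC ler_pdivrMr// -mulrA -expr2 ler_pM2l.
lra.
Qed.

Lemma form_cauchy k r x y : 0 < k ->
  `|dot (B r x) y| <= (k * form B r x + k^-1 * form B r y) / 2.
Proof.
move=> k0; have a0 : 0 < Num.sqrt k by rewrite sqrtr_gt0.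
have h1 := form_ge0 r (Num.sqrt k *: x + (Num.sqrt k)^-1 *: y).
have h2 := form_ge0 r (Num.sqrt k *: x - (Num.sqrt k)^-1 *: y).
have e1 : dot (B r y) x = dot (B r x) y by rewrite (ds_sym hB) dotC.
have kk : Num.sqrt k * (Num.sqrt k)^-1 = 1 by rewrite mulfV ?gt_eqF.
have k1 : Num.sqrt k ^+ 2 = k by rewrite sqr_sqrtr ?(ltW k0).
have k2 : (Num.sqrt k)^-1 ^+ 2 = k^-1 by rewrite exprVn k1.
have kX u : Num.sqrt k * (Num.sqrt k * u) = k * u by rewrite mulrA -expr2 k1.
have kY u : (Num.sqrt k)^-1 * ((Num.sqrt k)^-1 * u) = k^-1 * u.
  by rewrite mulrA -expr2 k2.
have kZ u : Num.sqrt k * ((Num.sqrt k)^-1 * u) = u by rewrite mulrA kk mul1r.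
have kW u : (Num.sqrt k)^-1 * (Num.sqrt k * u) = u by rewrite mulrCA kZ.
move: h1 h2; rewrite /form (bfB (ds_bf hB)) (bfD (ds_bf hB)) !lin !dotlin e1.
rewrite !mulrN !(kX, kY, kZ, kW) => h1 h2.
by rewrite ler_norml; apply/andP; split; lra.
Qed.

Lemma sol_sqr_norm tau x r : is_sol B tau x -> tau <= r ->
  has_deriv (fun s => `|x s| ^+ 2 : R^o) r (- 2 * form B r (x r)).
Proof.
move=> sx /sx dx; have := has_deriv_sqr_norm hH dx.
by rewrite /form mulrNN.
Qed.

Lemma sol_le tau x s r : is_sol B tau x -> tau <= s -> s <= r -> `|x r| <= `|x s|.
Proof.
move=> sx ts sr; apply: le_of_sqr => //.
have d1 : forall p, s <= p <= r ->
    has_deriv (fun s => `|x s| ^+ 2 : R^o) p (- 2 * form B p (x p)).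
  by move=> p /andP[sp _]; apply: sol_sqr_norm sx _; exact: le_trans sp.
have := mean_le sr d1 (fun p _ => has_deriv_cst (0 : R^o) p).
rewrite subrr => h; rewrite -subr_le0; apply: h => p _.
by have := form_ge0 p (x p); lra.
Qed.

Lemma sol_uniq tau x y r : is_sol B tau x -> is_sol B tau y -> tau <= r ->
  x tau = y tau -> x r = y r.
Proof.
move=> sx sy tr xy; have sxy : is_sol B tau (fun s => x s - y s).
  by move=> s ts; rewrite (bfB (ds_bf hB)); apply: has_derivB; [exact: sx|exact: sy].
have := sol_le sxy (lexx _) tr; rewrite xy subrr normr0 normr_le0 subr_eq0.
by move/eqP.
Qed.

Lemma sol_ex tau u : exists2 x, x tau = u & is_sol B tau x.
Proof. exact: (ode_solution hH tau u (ds_bf hB) (ds_M hB)). Qed.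

Section frozen.
Variables (t : R) (z : R -> H).
Hypothesis sz : is_sol (fun=> B t) 0 z.

(** A chain in which each function has -2 times the next one as derivative. The sum
    [e0 / 2 + s e1 + s^2 e2 + (2/3) s^3 e3], truncated anywhere, is nonincreasing: its coefficients
    satisfy [n c_n = 2 c_(n-1)], so that the derivative telescopes to one nonpositive term. The
    bounds below compare such a sum at [s] and at 0; those in terms of the initial form start the
    chain at [e1]. *)
Let e0 s := `|z s| ^+ 2.
Let e1 s := form B t (z s).
Let e2 s := `|B t (z s)| ^+ 2.
Let e3 s := form B t (B t (z s)).

Let de0 s : 0 <= s -> has_deriv (e0 : R -> R^o) s (- 2 * e1 s).
Proof.
move=> /sz dz; have := has_deriv_sqr_norm hH dz.
by rewrite /e1 /form mulrNN.
Qed.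

Let dBz s : 0 <= s -> has_deriv (fun s => B t (z s)) s (B t (B t (z s))).
Proof. by move=> /sz; exact: bf_has_deriv (ds_bf hB) t _ _ _. Qed.

Let de1 s : 0 <= s -> has_deriv (e1 : R -> R^o) s (- 2 * e2 s).
Proof.
move=> s0; have := has_derivN (has_deriv_dot hH (dBz s0) (sz s0)).
rewrite (ds_sym hB) dotE => h.
by have -> : - 2 * e2 s = - (e2 s + e2 s) by ring.
Qed.

Let de2 s : 0 <= s -> has_deriv (e2 : R -> R^o) s (- 2 * e3 s).
Proof.
by move=> s0; have := has_deriv_sqr_norm hH (dBz s0); rewrite /e3 /form mulrNN.
Qed.

Let de3 s : 0 <= s -> has_deriv (e3 : R -> R^o) s (- 2 * `|B t (B t (z s))| ^+ 2).
Proof.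
move=> s0; have := has_derivN (has_deriv_dot hH
  (bf_has_deriv (ds_bf hB) t (dBz s0)) (dBz s0)).
rewrite (ds_sym hB) dotE => h.
have -> : - 2 * `|B t (B t (z s))| ^+ 2 =
  - (`|B t (B t (z s))| ^+ 2 + `|B t (B t (z s))| ^+ 2) by ring.
exact: h.
Qed.

Let decr (f df : R -> R) s : 0 <= s ->
  (forall r, 0 <= r -> has_deriv (f : R -> R^o) r (df r)) ->
  (forall r, 0 < r -> df r <= 0) -> f s <= f 0.
Proof.
move=> s0 hf hdf; have hf' r (hr : 0 <= r <= s) := hf r (andP hr).1.
have := mean_le s0 hf' (fun r _ => has_deriv_cst (0 : R^o) r).
by rewrite subrr subr_le0; apply => r /andP[r0 _]; exact: hdf.
Qed.

Let dmul (f : R -> R) (d c : R) n s : has_deriv (f : R -> R^o) s d ->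
  has_deriv (fun r => c * r ^+ n * f r : R^o) s
    (c * s ^+ n * d + c * n%:R * s ^+ n.-1 * f s).
Proof.
move=> hf; have dn : has_deriv (fun r => r ^+ n : R^o) s (n%:R * s ^+ n.-1).
  apply/has_derivP; have := @is_deriveX _ R^o id n s 1 1 (is_derive_id _ _).
  by rewrite exprfctE /GRing.scale/= mulr1.
have := has_derivM (@has_derivZ _ R^o c _ _ _ dn) hf.
rewrite /GRing.scale/= => h.
by have -> : c * n%:R * s ^+ n.-1 * f s = f s * (c * (n%:R * s ^+ n.-1)) by ring.
Qed.

Lemma frozen_form s : 0 <= s -> 2 * s * form B t (z s) <= `|z 0| ^+ 2.
Proof.
move=> s0; have := decr s0 (fun r r0 => has_derivD (dmul 2^-1 0 (de0 r0))
  (dmul 1 1 (de1 r0))).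
rewrite /= => /(_ _)h; have {}h := h ltac:(by move=> r r0;
  rewrite !expr0 expr1; have := mulr_ge0 (ltW r0) (sqr_ge0 `|B t (z r)|);
  rewrite -/(e2 r); lra).
by move: h; rewrite !expr0 !expr1 -/(e1 s) -/(e0 0);
  have := sqr_ge0 `|z s|; rewrite -/(e0 s); lra.
Qed.

Lemma frozen_norm s : 0 <= s -> 2 * s ^+ 2 * `|B t (z s)| ^+ 2 <= `|z 0| ^+ 2.
Proof.
move=> s0; have := decr s0 (fun r r0 => has_derivD (has_derivD (dmul 2^-1 0 (de0 r0))
  (dmul 1 1 (de1 r0))) (dmul 1 2 (de2 r0))).
rewrite /= => /(_ _)h; have {}h := h ltac:(by move=> r r0;
  rewrite !expr0 expr1; have := mulr_ge0 (sqr_ge0 r) (form_ge0 t (B t (z r)));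
  rewrite -/(e3 r); lra).
by move: h; rewrite !expr0 !expr1 expr0n/= -/(e2 s) -/(e0 0);
  have := sqr_ge0 `|z s|; rewrite -/(e0 s);
  have := mulr_ge0 s0 (form_ge0 t (z s)); rewrite -/(e1 s); lra.
Qed.

Lemma frozen_form_gen s : 0 <= s ->
  4 * s ^+ 3 * form B t (B t (z s)) <= 3 * `|z 0| ^+ 2.
Proof.
move=> s0; have := decr s0 (fun r r0 => has_derivD (has_derivD (has_derivD
  (dmul 2^-1 0 (de0 r0)) (dmul 1 1 (de1 r0))) (dmul 1 2 (de2 r0)))
  (dmul (2 / 3) 3 (de3 r0))).
rewrite /= => /(_ _)h; have {}h := h ltac:(by move=> r r0;
  rewrite !expr0 expr1;
  have := mulr_ge0 (exprn_ge0 3 (ltW r0)) (sqr_ge0 `|B t (B t (z r))|); lra).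
by move: h; rewrite !expr0 !expr1 !expr0n/= -/(e3 s) -/(e0 0);
  have := sqr_ge0 `|z s|; rewrite -/(e0 s);
  have := mulr_ge0 s0 (form_ge0 t (z s)); rewrite -/(e1 s);
  have := mulr_ge0 (sqr_ge0 s) (sqr_ge0 `|B t (z s)|); rewrite -/(e2 s); lra.
Qed.

Lemma frozen_norm_form s : 0 <= s -> 2 * s * `|B t (z s)| ^+ 2 <= form B t (z 0).
Proof.
move=> s0; have := decr s0 (fun r r0 => has_derivD
  (dmul 2^-1 0 (de1 r0)) (dmul 1 1 (de2 r0))).
rewrite /= => /(_ _)h; have {}h := h ltac:(by move=> r r0;
  rewrite !expr0 expr1; have := mulr_ge0 (ltW r0) (form_ge0 t (B t (z r)));
  rewrite -/(e3 r); lra).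
by move: h; rewrite !expr0 !expr1 -/(e2 s) -/(e1 0);
  have := form_ge0 t (z s); rewrite -/(e1 s); lra.
Qed.

Lemma frozen_form_gen_form s : 0 <= s ->
  2 * s ^+ 2 * form B t (B t (z s)) <= form B t (z 0).
Proof.
move=> s0; have := decr s0 (fun r r0 => has_derivD (has_derivD
  (dmul 2^-1 0 (de1 r0)) (dmul 1 1 (de2 r0))) (dmul 1 2 (de3 r0))).
rewrite /= => /(_ _)h; have {}h := h ltac:(by move=> r r0;
  rewrite !expr0 expr1;
  have := mulr_ge0 (sqr_ge0 r) (sqr_ge0 `|B t (B t (z r))|); lra).
by move: h; rewrite !expr0 !expr1 expr0n/= -/(e3 s) -/(e1 0);
  have := form_ge0 t (z s); rewrite -/(e1 s);
  have := mulr_ge0 s0 (sqr_ge0 `|B t (z s)|); rewrite -/(e2 s); lra.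
Qed.

End frozen.

Lemma bfN r u : B r (- u) = - B r u.
Proof. by rewrite -[- u]scaleN1r lin scaleN1r. Qed.

Lemma frozen_ex t v : exists2 z, z 0 = v & is_sol (fun=> B t) 0 z.
Proof.
exact: (ode_solution hH 0 v (ds_bf (dissipative_frozen t hB)) (ds_M hB)).
Qed.

Lemma frozen_back t c z r : is_sol (fun=> B t) 0 z -> r <= c ->
  has_deriv (fun s => B t (z (c - s))) r (- B t (B t (z (c - r)))).
Proof.
move=> sz rt; rewrite -bfN; apply: bf_has_deriv (ds_bf hB) _ _ _ _ _.
by apply: has_deriv_rev; apply: sz; rewrite subr_ge0.
Qed.

(** By symmetry the backward motion of [z] can be moved onto [x r] as [- B t (x r)]; only the
    difference of the generators at times [r] and [t] remains. *)
Lemma pairing_frozen tau x t z r : is_sol B tau x -> is_sol (fun=> B t) 0 z ->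
  tau <= r <= t ->
  has_deriv (fun s => dot (x s) (B t (z (t - s))) : R^o) r
    (dot (B r (x r)) (B t (z (t - r))) - dot (B t (x r)) (B t (z (t - r)))).
Proof.
move=> sx sz /andP[tr rt].
have := has_deriv_dot hH (sx r tr) (frozen_back sz rt).
by rewrite dotlin -(ds_sym hB t (x r)).
Qed.

(** * Bounds along solutions of the nonautonomous equation *)

Variable T : R.
Hypotheses (T0 : 0 < T) (eta2 : 2^-1 < eta).

Let gam1 := 2 * eta - 1.
Let gam2 := eta - 2^-1.

Let gam1_gt0 : 0 < gam1. Proof. by have := eta2; rewrite /gam1; lra. Qed.
Let gam2_gt0 : 0 < gam2. Proof. by have := eta2; rewrite /gam2; lra. Qed.

(** In [form_sol_le] the bound obtained is [p^-1 + a / 2], with [p = t - tau] and [a] the quantity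
    in parentheses; multiplied by [p <= T] it is at most this constant. *)
Definition form_const : R := 1 + (C ^+ 2 * T `^ gam1 / gam1) * T / 2.

Definition gen_const : R :=
  2 + C / gam2 * Num.sqrt (2 * form_const * T) * T `^ gam2.

Let C0 : 0 < C := ds_C hB.

Lemma form_const_gt0 : 0 < form_const.
Proof.
have : 0 <= (C ^+ 2 * T `^ gam1 / gam1) * T.
  by rewrite mulr_ge0 ?divr_ge0 ?mulr_ge0 ?sqr_ge0 ?powR_ge0// ltW.
by rewrite /form_const; lra.
Qed.

Lemma gen_const_gt0 : 0 < gen_const.
Proof.
have : 0 <= C / gam2 * Num.sqrt (2 * form_const * T) * T `^ gam2.
  by rewrite mulr_ge0 ?powR_ge0// mulr_ge0 ?sqrtr_ge0// divr_ge0 ?ltW.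
by rewrite /gen_const; lra.
Qed.

Let powR_sqr s : 0 < s -> (s `^ eta) ^+ 2 = s `^ (gam1 - 1) * s ^+ 2.
Proof.
move=> s0; rewrite -(powR_mulrn 2 (powR_ge0 _ _)) -powRrM -(powR_mulrn 2 (ltW s0)).
rewrite -powRD; last by rewrite [s == 0]gt_eqF// implybT.
congr (_ `^ _); rewrite /gam1; ring.
Qed.

Let powR_ler_T g s : 0 <= g -> 0 <= s -> s <= T -> s `^ g <= T `^ g.
Proof. by move=> g0 s0 sT; rewrite ge0_ler_powR// ?nnegrE// ltW. Qed.

(* Differentiate [(x r, B t (exp ((t - r) B t) (x t)))] in [r]: by [ds_close] and
   AM-GM the derivative is absorbed by the dissipated [form B r (x r)] plus a
   multiple of [(t - r) `^ (2 * eta - 2)], which is integrable since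
   [eta > 1 / 2]. *)
Lemma form_sol_le tau t x : is_sol B tau x -> `|x tau| <= 1 -> tau < t ->
  t - tau <= T -> form B t (x t) <= form_const / (t - tau).
Proof.
move=> sx x1 taut tT; set Q := form B t (x t); set p := t - tau.
have Q0 : 0 <= Q by exact: form_ge0.
have p0 : 0 < p by rewrite subr_gt0.
have [z z0 sz] := frozen_ex t (x t).
(* The weight [a] of the dissipated form is chosen such that [c * T^gam1 = Q / 4], where [c] is what
   AM-GM leaves in front of the power of [t - r]. With the [Q / 4] in [phi0] this makes [Q / 2],
   which is absorbed on the left. *)
have [a aE] : exists a, a = C ^+ 2 * T `^ gam1 / gam1 by exists (C ^+ 2 * T `^ gam1 / gam1).
have a0 : 0 < a by rewrite aE divr_gt0// mulr_gt0 ?exprn_gt0 ?powR_gt0.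
have [c cE] : exists c, c = C ^+ 2 * Q / (4 * a * gam1).
  by exists (C ^+ 2 * Q / (4 * a * gam1)).
have c0 : 0 <= c.
  rewrite cE; apply: divr_ge0; first exact: mulr_ge0 (sqr_ge0 _) Q0.
  exact: mulr_ge0 (mulr_ge0 (ler0n _ 4) (ltW a0)) (ltW gam1_gt0).
have phi0 : - dot (x tau) (B t (z p)) <= Q / 4 + p^-1 / 2.
  have w0 := normr_ge0 (B t (z p)).
  have wQ := frozen_norm_form sz (ltW p0); rewrite z0 -/Q in wQ.
  have xw : - dot (x tau) (B t (z p)) <= `|B t (z p)|.
    have := dot_abs hH (x tau) (B t (z p)); rewrite ler_norml => /andP[h _].
    by have := ler_wpM2r w0 x1; lra.
  rewrite (le_trans xw)//.
  have := mulr_ge0 (ltW p0) (sqr_ge0 (`|B t (z p)| - p^-1)).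
  have -> : p * (`|B t (z p)| - p^-1) ^+ 2 =
    p * `|B t (z p)| ^+ 2 - 2 * `|B t (z p)| + p^-1 by field; rewrite gt_eqF.
  by move: wQ; lra.
have main r : tau <= r < t ->
    - dot (x r) (B t (z (t - r))) <= Q / 2 + p^-1 / 2 + a / 4.
  move=> /andP[taur rt].
  have hf s : tau <= s <= r -> has_deriv (fun s => - dot (x s) (B t (z (t - s))) : R^o) s
     (- (dot (B s (x s)) (B t (z (t - s))) - dot (B t (x s)) (B t (z (t - s))))).
    move=> /andP[ts sr]; apply: (@has_derivN _ R^o); apply: pairing_frozen sx sz _.
    by rewrite ts (le_trans sr (ltW rt)).
  have hg s : tau <= s <= r -> has_deriv
      (fun s => - (a / 4) * `|x s| ^+ 2 + - c * (t - s) `^ gam1 : R^o) s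
      (- (a / 4) * (- 2 * form B s (x s)) +
       - c * (- (gam1 * (t - s) `^ (gam1 - 1)))).
    move=> /andP[ts sr]; apply: has_derivD; apply: (@has_derivZ _ R^o).
      exact: sol_sqr_norm sx ts.
    by apply: has_deriv_powR; exact: le_lt_trans rt.
  have := mean_le taur hf hg => h; rewrite -/p in h.
  have {}h : - dot (x r) (B t (z (t - r))) - - dot (x tau) (B t (z p)) <=
    - (a / 4) * `|x r| ^+ 2 + - c * (t - r) `^ gam1 -
    (- (a / 4) * `|x tau| ^+ 2 + - c * p `^ gam1).
    apply: h => s /andP[ts sr]; set q := t - s.
    have q0 : 0 < q by rewrite subr_gt0 (lt_trans sr).
    set e := q `^ eta; set w := q `^ (gam1 - 1).
    have e0 : 0 < e by rewrite powR_gt0.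
    have w0 : 0 <= w by rewrite powR_ge0.
    have ew : e ^+ 2 = w * q ^+ 2 by exact: powR_sqr.
    have := ds_close_scaled s t (x s) (B t (z q)) (k := a / (C * e)).
    rewrite divr_gt0 ?mulr_gt0// => /(_ isT); rewrite [`|s - t|]distrC -/q (gtr0_norm q0) -/e.
    rewrite ler_norml => /andP[k _].
    have E : C * e / 2 * (a / (C * e) * form B s (x s) +
        (a / (C * e))^-1 * form B t (B t (z q))) =
        a / 2 * form B s (x s) + C ^+ 2 / (2 * a) * (e ^+ 2 * form B t (B t (z q))).
      by field; rewrite !gt_eqF.
    rewrite E ew in k.
    have k2 := frozen_form_gen_form sz (ltW q0); rewrite z0 -/Q in k2.
    have k3 : C ^+ 2 / (2 * a) * (w * q ^+ 2 * form B t (B t (z q))) <=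
       c * gam1 * w.
      have -> : c * gam1 * w = C ^+ 2 / (4 * a) * w * Q.
        by rewrite cE; field; rewrite !gt_eqF.
      have -> : C ^+ 2 / (2 * a) * (w * q ^+ 2 * form B t (B t (z q))) =
        C ^+ 2 / (4 * a) * w * (2 * q ^+ 2 * form B t (B t (z q))).
        by field; rewrite gt_eqF.
      by rewrite ler_wpM2l// mulr_ge0// divr_ge0 ?sqr_ge0// mulr_ge0// ltW.
    lra.
  have cp : c * p `^ gam1 <= Q / 4.
    have -> : Q / 4 = c * T `^ gam1.
      have Tg : 0 < T `^ gam1 by exact: powR_gt0.
      by rewrite cE aE; field; rewrite !gt_eqF.
    by rewrite ler_wpM2l// powR_ler_T// ltW.
  have n1 : 0 <= a / 4 * `|x r| ^+ 2 by rewrite mulr_ge0 ?sqr_ge0// divr_ge0// ltW.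
  have n2 : 0 <= c * (t - r) `^ gam1 by rewrite mulr_ge0 ?powR_ge0.
  have n3 : a / 4 * `|x tau| ^+ 2 <= a / 4.
    by rewrite ler_piMr ?divr_ge0 ?(ltW a0)// expr_le1.
  lra.
have := left_limit_le taut _ main => /(_ _ _)h.
have dt : has_deriv (fun s => - dot (x s) (B t (z (t - s))) : R^o) t
   (- (dot (B t (x t)) (B t (z (t - t))) - dot (B t (x t)) (B t (z (t - t))))).
  apply: (@has_derivN _ R^o); apply: pairing_frozen sx sz _.
  by rewrite lexx ltW.
have := h _ dt; rewrite subrr z0 -(ds_sym hB) -/(form B t (x t)) -/Q => k.
have k2 : Q <= p^-1 + a / 2 by lra.
rewrite (le_trans k2)// ler_pdivlMr// mulrDl mulVf ?gt_eqF// /form_const -aE.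
rewrite lerD2l; have : a * p <= a * T by rewrite ler_pM2l.
lra.
Qed.

(** On [[sg, t]] at least half of the time since [tau] has elapsed, so that the form of [x] is at
    most [A^2]; that of [B t (z (t - s))] is at most [(t - s)^-3]. By [ds_close_mul] the pairing
    moves at speed at most [C A (t - s)^(eta - 3/2)], and the right-hand side is the integral of
    this. *)
Lemma gen_sol_near tau t sg x z : is_sol B tau x -> `|x tau| <= 1 ->
  is_sol (fun=> B t) 0 z -> `|z 0| <= 1 -> tau < t -> t - tau <= T ->
  (tau + t) / 2 <= sg < t ->
  `|dot (x t) (B t (z 0)) - dot (x sg) (B t (z (t - sg)))| <=
    C / gam2 * Num.sqrt (2 * form_const / (t - tau)) * (t - sg) `^ gam2.
Proof.
move=> sx x1 sz z1 taut tT /andP[sg1 sgt].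
have p0 : 0 < t - tau by rewrite subr_gt0.
have Kf := form_const_gt0.
have [A [A0 A2]] : exists A, 0 < A /\ A ^+ 2 = 2 * form_const / (t - tau).
  have k0 : 0 < 2 * form_const / (t - tau) by rewrite divr_gt0// mulr_gt0.
  exists (Num.sqrt (2 * form_const / (t - tau))).
  by rewrite sqrtr_gt0 sqr_sqrtr ?(ltW k0).
have -> : Num.sqrt (2 * form_const / (t - tau)) = A.
  by rewrite -A2 sqrtr_sqr gtr0_norm.
pose phi s := dot (x s) (B t (z (t - s))).
have dphi r : sg <= r <= t -> has_deriv (phi : R -> R^o) r
    (dot (B r (x r)) (B t (z (t - r))) - dot (B t (x r)) (B t (z (t - r)))).
  by move=> /andP[sr rt]; apply: pairing_frozen sx sz _; rewrite rt andbT; lra.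
pose c := C * A / gam2.
have c0 : 0 <= c by rewrite divr_ge0 ?(ltW gam2_gt0)// mulr_ge0 ?(ltW A0) ?(ltW C0).
have bound s : sg < s < t ->
    `|dot (B s (x s)) (B t (z (t - s))) - dot (B t (x s)) (B t (z (t - s)))| <=
    - c * (- (gam2 * (t - s) `^ (gam2 - 1))).
  move=> /andP[sgs st]; have q0 : 0 < t - s by rewrite subr_gt0.
  have fx : form B s (x s) <= A ^+ 2.
    have := form_sol_le sx x1 (t := s) ltac:(lra) ltac:(lra).
    rewrite A2 => /le_trans; apply.
    rewrite ler_pdivrMr; last lra.
    rewrite mulrAC ler_pdivlMr//.
    have : form_const * (t - tau) <= form_const * (2 * (s - tau)).
      by rewrite ler_pM2l//; lra.
    lra.
  pose b := (t - s) `^ (- (3 / 2)).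
  have b0 : 0 < b by rewrite powR_gt0.
  have b2 : b ^+ 2 * (t - s) ^+ 3 = 1.
    rewrite /b -(powR_mulrn 2 (powR_ge0 _ _)) -powRrM.
    rewrite -(powR_mulrn 3 (ltW q0)) -powRD; last by rewrite [t - s == 0]gt_eqF// implybT.
    have -> : - (3 / 2) * 2 + 3 = 0 :> R by lra.
    by rewrite powRr0.
  have fz : form B t (B t (z (t - s))) <= b ^+ 2.
    have := frozen_form_gen sz (ltW q0).
    have q3 : 0 < (t - s) ^+ 3 by rewrite exprn_gt0.
    have zz : `|z 0| ^+ 2 <= 1 by rewrite expr_le1.
    by move=> h; rewrite -(ler_pM2r q3) b2; lra.
  have := ds_close_mul A0 b0 fx fz; rewrite [`|s - t|]distrC (gtr0_norm q0).
  move/le_trans; apply.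
  have -> : - c * - (gam2 * (t - s) `^ (gam2 - 1)) = C * A * (t - s) `^ (gam2 - 1).
    by rewrite /c; field; rewrite gt_eqF.
  have -> : (t - s) `^ (gam2 - 1) = (t - s) `^ eta * b.
    rewrite /b -powRD; last by rewrite [t - s == 0]gt_eqF// implybT.
    by congr (_ `^ _); rewrite /gam2; lra.
  by rewrite le_eqVlt; apply/orP; left; apply/eqP; ring.
have hg s : s < t -> has_deriv (fun s => - c * (t - s) `^ gam2 : R^o) s
    (- c * (- (gam2 * (t - s) `^ (gam2 - 1)))).
  by move=> st; apply: (@has_derivZ _ R^o); exact: has_deriv_powR.
set K := C / gam2 * A * _; have KE : K = c * (t - sg) `^ gam2 by rewrite /K /c; ring.
have le_r r : sg <= r < t -> `|phi r - phi sg| <= K.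
  move=> /andP[sr rt]; have dphi' s (h : sg <= s <= r) := dphi s ltac:(lra).
  have dg' s (h : sg <= s <= r) := hg s ltac:(lra).
  have dgN s (h : sg <= s <= r) := @has_derivN _ R^o _ _ _ (dg' s h).
  have pw : 0 <= c * (t - r) `^ gam2 by rewrite mulr_ge0 ?powR_ge0.
  have bnd s : sg < s < r -> - (- c * (- (gam2 * (t - s) `^ (gam2 - 1)))) <=
      dot (B s (x s)) (B t (z (t - s))) - dot (B t (x s)) (B t (z (t - s))) <=
      - c * (- (gam2 * (t - s) `^ (gam2 - 1))).
    by move=> h; rewrite -ler_norml; apply: bound; lra.
  have h1 := mean_le sr dphi' dg' (fun s h => (andP (bnd s h)).2).
  have h2 := mean_le sr dgN dphi' (fun s h => (andP (bnd s h)).1).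
  rewrite ler_norml KE; apply/andP; split; first by move: h2 => /=; lra.
  by move: h1 => /=; lra.
have tt : sg <= t <= t by lra.
have h1 := left_limit_le sgt (has_derivB (dphi t tt) (has_deriv_cst (phi sg : R^o) t))
  (fun r h => le_trans (ler_norm _) (le_r r h)).
have h2 := left_limit_le sgt (has_derivB (has_deriv_cst (phi sg : R^o) t) (dphi t tt))
  (fun r h => le_trans (ler_norm _) (eq_ind_r (fun a => a <= K) (le_r r h)
    (distrC (phi sg) (phi r)))).
rewrite ler_norml; move: h1 h2; rewrite /phi subrr; lra.
Qed.

Lemma gen_sol_le tau t x : is_sol B tau x -> `|x tau| <= 1 -> tau < t ->
  t - tau <= T -> `|B t (x t)| <= gen_const / (t - tau).
Proof.
move=> sx x1 taut tT; apply: (norm_le_dot hH) => v v1; rewrite (ds_sym hB).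
have [z z0 sz] := frozen_ex t v.
have p0 : 0 < t - tau by rewrite subr_gt0.
have := @gen_sol_near tau t ((tau + t) / 2) x z sx x1 sz.
rewrite z0 => /(_ v1 taut tT ltac:(lra)); rewrite ler_norml => /andP[_].
have -> : t - (tau + t) / 2 = (t - tau) / 2 by lra.
set p := t - tau in p0 tT *.
have q0 : 0 < p / 2 by lra.
have zn : `|B t (z (p / 2))| <= 2 / p.
  have zz : `|z 0| ^+ 2 <= 1 by rewrite z0 expr_le1.
  have := frozen_norm sz (ltW q0); set w := `|_| => h.
  rewrite ler_pdivlMr//; apply: le_of_sqr => //; rewrite exprMn.
  by have := sqr_ge0 (w * p); rewrite exprMn; lra.
have d1 : dot (x ((tau + t) / 2)) (B t (z (p / 2))) <= 2 / p.
  rewrite (le_trans (dot_le hH _ _))// (le_trans _ zn)// ler_piMl//.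
  by rewrite (le_trans (sol_le sx (lexx _) _))//; lra.
have Kf := form_const_gt0.
have k0 : 0 <= 2 * form_const by lra.
have -> : Num.sqrt (2 * form_const / p) = Num.sqrt (2 * form_const * p) / p.
  have -> : 2 * form_const / p = 2 * form_const * p * p^-1 ^+ 2.
    by field; rewrite gt_eqF.
  have kp : 0 <= 2 * form_const * p by exact: mulr_ge0 k0 (ltW p0).
  by rewrite (sqrtrM _ kp) sqrtr_sqr ger0_norm// invr_ge0 ltW.
have h1 : Num.sqrt (2 * form_const * p) <= Num.sqrt (2 * form_const * T).
  by rewrite ler_wsqrtr// ler_wpM2l.
have h2 : (p / 2) `^ gam2 <= T `^ gam2 by rewrite powR_ler_T ?(ltW gam2_gt0)//; lra.
have Cg : 0 <= C / gam2 by rewrite divr_ge0 ?ltW.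
have h3 : C / gam2 * (Num.sqrt (2 * form_const * p) / p) * (p / 2) `^ gam2 <=
   C / gam2 * Num.sqrt (2 * form_const * T) * T `^ gam2 / p.
  rewrite mulrA mulrAC ler_pM2r ?invr_gt0//.
  apply: ler_pM => //; first exact: mulr_ge0 Cg (sqrtr_ge0 _).
    exact: powR_ge0.
  exact: ler_wpM2l.
rewrite /gen_const; move: h3 d1; lra.
Qed.

Lemma sol_lip tau m x r r' : is_sol B tau x -> `|x tau| <= 1 -> 0 < m ->
  m <= r - tau -> r <= r' -> r' - tau <= T ->
  `|x r' - x r| <= gen_const / m * (r' - r).
Proof.
move=> sx x1 m0 mr rr' r'T.
have dx s (h : r <= s <= r') : has_deriv x s (B s (x s)) by apply: sx; lra.
have := norm_mean_le hH rr' dx (fun s _ => has_derivZl (gen_const / m) s).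
rewrite -mulrBr; apply => s h.
have := gen_sol_le sx x1 (t := s) ltac:(lra) ltac:(lra) => /le_trans; apply.
rewrite ler_pM2l; last exact: gen_const_gt0.
by rewrite lef_pV2 ?posrE//; lra.
Qed.

(** With weight [s^-1] in [ds_close_scaled], the form of [a] is dissipated and integrates to a
    multiple of [|a 0|^2], while [b] has still run for at least [s / 2], which bounds the form of
    [B t b] by [6 / s^3]. Stopping at [s / 2] keeps away from the singularity at [r = s]. *)
Lemma frozen_half t t' a b s : is_sol (fun=> B t') 0 a -> is_sol (fun=> B t) 0 b ->
  `|a 0| <= 1 -> `|b 0| <= 1 -> 0 < s ->
  `|dot (a (s / 2)) (B t (b (s / 2))) - dot (a 0) (B t (b s))| <=
    7 / 4 * (C * `|t' - t| `^ eta) / s.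
Proof.
move=> sa sb a1 b1 s0; set rho := C * _.
have rho0 : 0 <= rho by rewrite mulr_ge0 ?powR_ge0 ?(ltW C0).
pose phi r := dot (a r) (B t (b (s - r))).
have dphi r : 0 <= r <= s / 2 -> has_deriv (phi : R -> R^o) r
    (dot (B t' (a r)) (B t (b (s - r))) - dot (B t (a r)) (B t (b (s - r)))).
  move=> /andP[r0 rs].
  have := has_deriv_dot hH (sa r r0) (frozen_back sb (c := s) (r := r) ltac:(lra)).
  by rewrite dotlin -(ds_sym hB t (a r)).
have hg r : 0 <= r <= s / 2 -> has_deriv
    (fun r => - (rho / (4 * s)) * `|a r| ^+ 2 + 3 * rho / s ^+ 2 * r : R^o) r
    (- (rho / (4 * s)) * (- 2 * form B t' (a r)) + 3 * rho / s ^+ 2).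
  move=> /andP[r0 _]; apply: has_derivD; last exact: has_derivZl.
  apply: (@has_derivZ _ R^o).
  by have := has_deriv_sqr_norm hH (sa r r0); rewrite /form mulrNN.
have bound r : 0 < r < s / 2 ->
    `|dot (B t' (a r)) (B t (b (s - r))) - dot (B t (a r)) (B t (b (s - r)))| <=
    - (rho / (4 * s)) * (- 2 * form B t' (a r)) + 3 * rho / s ^+ 2.
  move=> /andP[r0 rs]; have q0 : 0 <= s - r by lra.
  have := ds_close_scaled t' t (a r) (B t (b (s - r))) (k := s^-1).
  rewrite invr_gt0 => /(_ s0)/le_trans; apply; rewrite -/rho invrK.
  have zz : `|b 0| ^+ 2 <= 1 by rewrite expr_le1.
  have := frozen_form_gen sb q0.
  set f := form B t (B t _) => h.
  have f0 : 0 <= f by exact: form_ge0.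
  have h2 : s ^+ 3 * f <= 6.
    have : (s / 2) ^+ 3 <= (s - r) ^+ 3 by rewrite lerXn2r ?nnegrE//; lra.
    by move=> /(ler_wpM2r f0); rewrite exprMn; lra.
  have h3 : s * f <= 6 / s ^+ 2.
    rewrite ler_pdivlMr ?exprn_gt0//; lra.
  have := ler_wpM2l rho0 h3; rewrite -[s^-1 * _]mulrC => h4.
  have -> : - (rho / (4 * s)) * (- 2 * form B t' (a r)) =
    rho / 2 * (form B t' (a r) * s^-1) by field; rewrite gt_eqF.
  have -> : 3 * rho / s ^+ 2 = rho * (6 / s ^+ 2) / 2 by field; rewrite gt_eqF.
  lra.
have dgN r (h : 0 <= r <= s / 2) := @has_derivN _ R^o _ _ _ (hg r h).
have bnd r := bound r; have s2 : 0 <= s / 2 by lra.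
have h1 := mean_le s2 dphi hg (fun r h => (andP (etrans (esym (ler_norml _ _)) (bnd r h))).2).
have h2 := mean_le s2 dgN dphi (fun r h => (andP (etrans (esym (ler_norml _ _)) (bnd r h))).1).
have a0 : rho / (4 * s) * `|a 0| ^+ 2 <= rho / (4 * s).
  by rewrite ler_piMr ?expr_le1// divr_ge0// mulr_ge0// ltW.
have a2 : 0 <= rho / (4 * s) * `|a (s / 2)| ^+ 2.
  by rewrite mulr_ge0 ?sqr_ge0// divr_ge0// mulr_ge0// ltW.
have e1 : 7 / 4 * rho / s = rho / (4 * s) + 3 * rho / s ^+ 2 * (s / 2).
  by field; rewrite gt_eqF.
have ss : s - s / 2 = s / 2 by lra.
move: h1 h2; rewrite /phi ss subr0 /= => h1 h2.
rewrite e1 ler_norml; apply/andP; split; lra.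
Qed.

Lemma frozen_gen_sym t a b s : is_sol (fun=> B t) 0 a -> is_sol (fun=> B t) 0 b ->
  0 <= s -> dot (a 0) (B t (b s)) = dot (b 0) (B t (a s)).
Proof.
move=> sa sb s0; pose phi r := dot (a r) (B t (b (s - r))).
have dphi r : 0 <= r <= s -> has_deriv (phi : R -> R^o) r 0.
  move=> /andP[r0 rs].
  have := has_deriv_dot hH (sa r r0) (frozen_back sb rs).
  by rewrite dotlin -(ds_sym hB t (a r)) subrr.
have := deriv_uniq s0 dphi (fun r _ => has_deriv_cst (0 : R^o) r).
rewrite subrr /phi subrr subr0 -(ds_sym hB) [dot (B t (a s)) _]dotC; lra.
Qed.

(** The semigroup [a] frozen at [t'] and started at [u] links the two terms: [frozen_half], used
    twice, moves each of them to time [s / 2], where [ds_close] compares [dot (B t a) b] with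
    [dot (B t' a) b]. The constant is [7/4 + 7/4 + 1]. *)
Lemma frozen_gen_dist t t' b b' s u : is_sol (fun=> B t) 0 b ->
  is_sol (fun=> B t') 0 b' -> b 0 = b' 0 -> `|b 0| <= 1 -> `|u| <= 1 -> 0 < s ->
  `|dot u (B t (b s)) - dot u (B t' (b' s))| <= 9 / 2 * (C * `|t' - t| `^ eta) / s.
Proof.
move=> sb sb' bb' b1 u1 s0; have [a a0 sa] := frozen_ex t' u.
have s2 : 0 <= s / 2 by lra.
have h1 := frozen_half sa sb (eq_ind_r (fun v => `|v| <= 1) u1 a0) b1 s0.
have h2 := frozen_half sb sa b1 (eq_ind_r (fun v => `|v| <= 1) u1 a0) s0.
have h3 := ds_close hB t' t (a (s / 2)) (b (s / 2)).
have a1 : `|a 0| <= 1 by rewrite a0.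
have aa : `|a 0| ^+ 2 <= 1 by rewrite expr_le1.
have bb : `|b 0| ^+ 2 <= 1 by rewrite expr_le1.
have fa := frozen_form sa s2; have fb := frozen_form sb s2.
have e := frozen_gen_sym sa sb' (ltW s0).
rewrite -bb' a0 in e; rewrite a0 in h1.
move: h2; rewrite distrC [`|t - t'|]distrC; set rho := C * _ in h1 h3 *.
have rho0 : 0 <= rho by rewrite mulr_ge0 ?powR_ge0 ?(ltW C0).
rewrite -/rho -e => h2.
have e2 : dot (a (s / 2)) (B t (b (s / 2))) = dot (B t (a (s / 2))) (b (s / 2)).
  by rewrite (ds_sym hB).
have e3 : dot (b (s / 2)) (B t' (a (s / 2))) = dot (B t' (a (s / 2))) (b (s / 2)).
  by rewrite dotC.
rewrite e3 in h2; rewrite e2 in h1.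
have h3' : rho / 2 * (form B t' (a (s / 2)) + form B t (b (s / 2))) <= rho / s.
  have sab : s * (form B t' (a (s / 2)) + form B t (b (s / 2))) <= 2 by lra.
  by rewrite ler_pdivlMr//; have := ler_wpM2l rho0 sab; lra.
move: h1 h2 (le_trans h3 h3'); rewrite !ler_norml => /andP[h11 h12] /andP[h21 h22].
by move=> /andP[h31 h32]; apply/andP; split; lra.
Qed.

Definition gen_modulus (m s h : R) : R :=
  2 * (C / gam2 * Num.sqrt (2 * form_const / m) * s `^ gam2) +
  9 / 2 * (C * h `^ eta) / s + 2 * gen_const * h / (m * s).

Lemma gen_sol_cont tau t t' m s x v : is_sol B tau x -> `|x tau| <= 1 ->
  `|v| <= 1 -> 0 < m -> m <= t - tau -> m <= t' - tau -> t - tau <= T ->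
  t' - tau <= T -> 0 < s -> 2 * s <= m ->
  `|dot (B t (x t)) v - dot (B t' (x t')) v| <= gen_modulus m s `|t' - t|.
Proof.
move=> sx x1 v1 m0 mt mt' tT t'T s0 sm.
have [b b0 sb] := frozen_ex t v; have [b' b'0 sb'] := frozen_ex t' v.
have Kf := form_const_gt0; have Kg := gen_const_gt0.
have near_b (r : R) (z : R -> H) : m <= r - tau -> r - tau <= T ->
    is_sol (fun=> B r) 0 z -> z 0 = v ->
    `|dot (B r (x r)) v - dot (x (r - s)) (B r (z s))| <=
    C / gam2 * Num.sqrt (2 * form_const / m) * s `^ gam2.
  move=> mr rT sz z0; rewrite (ds_sym hB).
  have := gen_sol_near sx x1 sz (sg := r - s).
  have rs : r - (r - s) = s by lra.
  rewrite z0 rs => /(_ v1 ltac:(lra) rT ltac:(lra))/le_trans; apply.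
  rewrite ler_wpM2r ?powR_ge0// ler_wpM2l ?divr_ge0 ?(ltW C0) ?(ltW gam2_gt0)//.
  rewrite ler_wsqrtr// ler_pM2l ?mulr_gt0//.
  by rewrite lef_pV2 ?posrE//; lra.
have h1 := near_b t b mt tT sb b0.
have h2 := near_b t' b' mt' t'T sb' b'0.
have xs : `|x (t - s)| <= 1 by rewrite (le_trans (sol_le sx (lexx _) _))//; lra.
have h3 := frozen_gen_dist sb sb' (etrans b0 (esym b'0))
  (eq_ind_r (fun v => `|v| <= 1) v1 b0) xs s0.
have h4 : `|x (t' - s) - x (t - s)| <= gen_const / (m / 2) * `|t' - t|.
  have [tt'|t't] := leP t t'.
    have := sol_lip (m := m / 2) sx x1 (r := t - s) (r' := t' - s).
    have -> : t' - s - (t - s) = t' - t by lra.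
    by rewrite [`|t' - t|]ger0_norm; [apply; lra|lra].
  have := sol_lip (m := m / 2) sx x1 (r := t' - s) (r' := t - s).
  have -> : t - s - (t' - s) = t - t' by lra.
  rewrite distrC [`|t' - t|]distrC.
  by rewrite [`|t - t'|]ger0_norm; [apply; lra|lra].
have h5 : `|dot (x (t' - s) - x (t - s)) (B t' (b' s))| <=
    2 * gen_const * `|t' - t| / (m * s).
  have bs : `|B t' (b' s)| <= s^-1.
    have zz : `|b' 0| ^+ 2 <= 1 by rewrite b'0 expr_le1.
    have := frozen_norm sb' (ltW s0); set w := `|B t' _| => h.
    rewrite -[s^-1]mul1r ler_pdivlMr//; apply: le_of_sqr => //; rewrite exprMn.
    by have := sqr_ge0 (w * s); rewrite exprMn; lra.
  rewrite (le_trans (dot_abs hH _ _))// (le_trans (ler_pM _ _ h4 bs))//.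
  by rewrite le_eqVlt; apply/orP; left; apply/eqP; field; rewrite !gt_eqF.
have e : dot (x (t' - s) - x (t - s)) (B t' (b' s)) =
  dot (x (t' - s)) (B t' (b' s)) - dot (x (t - s)) (B t' (b' s)) by rewrite !dotlin.
move: h1 h2 h3 h5; rewrite e /gen_modulus !ler_norml.
by move=> /andP[? ?] /andP[? ?] /andP[? ?] /andP[? ?]; apply/andP; split; lra.
Qed.

End estimates. End dissipative.

(** * Comparison of two families by duality, and behaviour near the initial time *)

Section comparison.
Context {R : realType} {H : normedModType R} {dot : H -> H -> R}.
Hypothesis hH : hilbert_dot dot.

Local Notation dotC := (dotC hH).
Local Notation dotE := (dotE hH).
Local Notation dotlin := (dotlin hH).
Local Notation form := (@form R H dot).
Local Notation dissipative := (@dissipative R H dot).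

(** As [x] runs forward and [y] backward, the derivative of their pairing is [kap] times
    [dot (B1 x) (B2 y)]. One square root of [lam] is spent on [lam * |B1 x|^2], which [x]
    dissipates, and the other stays in the bound. The factor 3 is the ratio of [lam - lam / 4] to
    the smaller parameter [lam / 4], met when the roles are exchanged. *)
Lemma compare_half (B1 B2 : R -> H -> H) lam kap P p q x y : 0 < lam ->
  `|kap| <= 3 * lam -> 0 <= P -> p <= q -> `|x p| <= 1 ->
  (forall r, p <= r <= q -> has_deriv x r (B1 r (x r))) ->
  (forall r, p <= r <= q -> has_deriv y r (- B2 r (y r))) ->
  (forall r x, lam * `|B1 r x| ^+ 2 <= form B1 r x) ->
  (forall r x y, dot (B1 r x) y - dot x (B2 r y) =
    kap * dot (B1 r x) (B2 r y)) ->
  (forall r, p < r < q -> `|B2 r (y r)| <= P) ->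
  `|dot (x q) (y q) - dot (x p) (y p)| <=
    3 * Num.sqrt lam * (1 / 4 + P ^+ 2 * (q - p) / 2).
Proof.
move=> lam0 kl P0 pq x1 dx dy lf diff BP.
have [a [a0 a2]] : exists a, 0 < a /\ a ^+ 2 = lam.
  by exists (Num.sqrt lam); rewrite sqrtr_gt0 sqr_sqrtr ?(ltW lam0).
have -> : Num.sqrt lam = a by rewrite -a2 sqrtr_sqr gtr0_norm.
have dphi r : p <= r <= q -> has_deriv (fun r => dot (x r) (y r) : R^o) r
    (dot (B1 r (x r)) (y r) - dot (x r) (B2 r (y r))).
  move=> h; have := has_deriv_dot hH (dx r h) (dy r h).
  by rewrite (dotNr hH).
have hg r : p <= r <= q -> has_deriv
    (fun r => - (3 * a / 4) * `|x r| ^+ 2 + 3 / 2 * a * P ^+ 2 * r : R^o) r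
    (- (3 * a / 4) * (- 2 * form B1 r (x r)) + 3 / 2 * a * P ^+ 2).
  move=> h; apply: has_derivD; last exact: has_derivZl.
  apply: (@has_derivZ _ R^o).
  by have := has_deriv_sqr_norm hH (dx r h); rewrite /form mulrNN.
have dgN r (h : p <= r <= q) := @has_derivN _ R^o _ _ _ (hg r h).
have bnd r : p < r < q ->
    `|dot (B1 r (x r)) (y r) - dot (x r) (B2 r (y r))| <=
    - (3 * a / 4) * (- 2 * form B1 r (x r)) + 3 / 2 * a * P ^+ 2.
  move=> h; rewrite diff normrM.
  have h1 := BP r h; have h2 := lf r (x r).
  have h3 := dot_abs hH (B1 r (x r)) (B2 r (y r)).
  set w := `|B1 r (x r)| in h2 h3; have w0 : 0 <= w by exact: normr_ge0.
  rewrite (le_trans (ler_pM _ _ kl (le_trans h3 (ler_wpM2l w0 h1))))//.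
  have h4 : a * w * P <= (lam * w ^+ 2 + P ^+ 2) / 2.
    by have := sqr_ge0 (a * w - P); rewrite -a2; lra.
  have := ler_wpM2l (ltW a0) h4; have := ler_wpM2l (ltW a0) h2.
  rewrite -a2; lra.
have h1 := mean_le pq dphi hg
  (fun r h => (andP (etrans (esym (ler_norml _ _)) (bnd r h))).2).
have h2 := mean_le pq dgN dphi
  (fun r h => (andP (etrans (esym (ler_norml _ _)) (bnd r h))).1).
have x2 : a * `|x p| ^+ 2 <= a by rewrite ler_piMr ?expr_le1// ltW.
have x3 : 0 <= a * `|x q| ^+ 2 by rewrite mulr_ge0 ?sqr_ge0// ltW.
move: h1 h2 => /= h1 h2; rewrite ler_norml; apply/andP; split; lra.
Qed.

Section two_families.
Variables (B1 B2 : R -> H -> H) (M1 M2 C eta T : R).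
Hypotheses (d1 : dissipative B1 M1 C eta) (d2 : dissipative B2 M2 C eta).
Hypotheses (T0 : 0 < T) (eta2 : 2^-1 < eta).

Lemma back_ex (B : R -> H -> H) M t v : dissipative B M C eta ->
  exists2 y : R -> H, y 0 = v & is_sol (fun r => B (t - r)) 0 y.
Proof.
move=> dB; have [y y0 sy] := sol_ex hH (dissipative_rev dB) (- t) v.
exists (fun r => y (r - t)) => [|r r0]; first by rewrite sub0r.
apply: has_deriv_shift; have := sy (r - t); rewrite opprB; apply; lra.
Qed.

Lemma back_deriv (B : R -> H -> H) t y r : is_sol (fun r => B (t - r)) 0 y ->
  r <= t -> has_deriv (fun s => y (t - s)) r (- B r (y (t - r))).
Proof.
move=> sy rt; apply: has_deriv_rev.
have e : t - (t - r) = r by lra.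
by have := sy (t - r); rewrite e; apply; rewrite subr_ge0.
Qed.

Lemma back_shift (B : R -> H -> H) M t : dissipative B M C eta ->
  dissipative (fun r => B (t - r)) M C eta.
Proof.
move=> /dissipative_rev[[lin bd ct] M0 C0 sym neg cl].
have E r : B (t - r) = B (- (r - t)) by rewrite opprB.
have E2 r s : r - s = (r - t) - (s - t) by rewrite opprB addrA subrK.
split=> // [|r x y|r x|r s x y].
- split=> [r|r|r e e0]; first by rewrite E; exact: lin.
    by rewrite E; exact: bd.
  have [del d0 h] := ct (r - t) e e0; exists del => // s.
  move=> sr x; have sr' : `|s - t - (r - t)| <= del by rewrite -E2.
  by have := h _ sr' x; rewrite -!E.
- by rewrite E; exact: sym.
- by rewrite E; exact: neg.
- by rewrite /form !E (E2 r s); exact: cl.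
Qed.

(** By symmetry the forward and backward generators cancel and the pairing is constant. So the
    adjoint evolution solves the reversed equation and obeys the same bounds. *)
Lemma duality (B : R -> H -> H) tau t x y : 
  (forall r x y, dot (B r x) y = dot x (B r y)) ->
  is_sol B tau x -> is_sol (fun r => B (t - r)) 0 y -> tau <= t ->
  dot (x t) (y 0) = dot (x tau) (y (t - tau)).
Proof.
move=> sym sx sy taut.
have dphi r : tau <= r <= t -> has_deriv (fun r => dot (x r) (y (t - r)) : R^o) r 0.
  move=> /andP[tr rt]; have := has_deriv_dot hH (sx r tr) (back_deriv sy rt).
  by rewrite (dotNr hH) sym subrr.
have := deriv_uniq taut dphi (fun r _ => has_deriv_cst (0 : R^o) r).
by rewrite !subrr => /eqP; rewrite subr_eq0 => /eqP.
Qed.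

(* The times before and after the midpoint are treated separately, because the
   bound [gen_const / _] is only available away from the initial time of the
   forward, respectively backward, solution. *)
Lemma compare_sol lam tau t x1 x2 v : 0 < lam ->
  (forall r x, lam * `|B1 r x| ^+ 2 <= form B1 r x) ->
  (forall r x, lam / 4 * `|B2 r x| ^+ 2 <= form B2 r x) ->
  (forall r x y, dot (B1 r x) y - dot x (B2 r y) =
    (lam - lam / 4) * dot (B1 r x) (B2 r y)) ->
  is_sol B1 tau x1 -> is_sol B2 tau x2 -> x1 tau = x2 tau -> `|x1 tau| <= 1 ->
  `|v| <= 1 -> tau < t -> t - tau <= T ->
  `|dot (x1 t - x2 t) v| <=
    6 * Num.sqrt lam * (1 / 4 + gen_const C eta T ^+ 2 / (t - tau)).
Proof.
move=> lam0 lf1 lf2 diff s1 s2 x12 x1n v1 taut tT.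
have [y y0 sy] := back_ex t v d2.
have Kg := gen_const_gt0 d1 T eta2.
have du := duality (ds_sym d2) s2 sy (ltW taut).
set p := t - tau in tT du *; have p0 : 0 < p by rewrite /p subr_gt0.
have -> : dot (x1 t - x2 t) v = dot (x1 t) (y 0) - dot (x1 tau) (y p).
  by rewrite x12 -du y0 !dotlin.
pose mid := (tau + t) / 2; pose P := gen_const C eta T / (p / 2).
have P0 : 0 <= P by rewrite divr_ge0 ?(ltW Kg)//; lra.
have kl : `|lam - lam / 4| <= 3 * lam by rewrite ger0_norm; lra.
have kl' : `|- (lam - lam / 4)| <= 3 * (lam / 4) by rewrite normrN ger0_norm; lra.
have bP q : p / 2 <= q -> gen_const C eta T / q <= P.
  by move=> pq; rewrite ler_pM2l// lef_pV2 ?posrE//; lra.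
have yn : `|y 0| <= 1 by rewrite y0.
have d2' := back_shift t d2.
have h1 : `|dot (x1 mid) (y (t - mid)) - dot (x1 tau) (y (t - tau))| <=
    3 * Num.sqrt lam * (1 / 4 + P ^+ 2 * (mid - tau) / 2).
  apply: (compare_half (y := fun r => y (t - r)) lam0 kl P0 _ x1n _ _ lf1 diff).
  - by rewrite /mid; rewrite /p in p0; lra.
  - by move=> r /andP[tr _]; exact: s1.
  - by move=> r /andP[_ rm]; apply: back_deriv sy _; move: rm; rewrite /mid; rewrite /p in p0; lra.
  - move=> r /andP[tr rm].
    have tr0 : 0 < t - r by rewrite /mid in rm; lra.
    have := gen_sol_le hH d2' T0 eta2 sy yn tr0.
    have e : t - (t - r) = r by lra.
    rewrite subr0 e => /(_ ltac:(rewrite /p in tT; lra))/le_trans; apply.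
    by apply: bP; rewrite /p; rewrite /mid in rm; lra.
(* After the midpoint [y] is the solution whose dissipation is used, with parameter [lam / 4], and
   [kap] changes sign. *)
have h2 : `|dot (y (t - mid)) (x1 mid) - dot (y 0) (x1 t)| <=
    3 * Num.sqrt (lam / 4) * (1 / 4 + P ^+ 2 * (t - mid - 0) / 2).
  have -> : x1 mid = x1 (t - (t - mid)) by congr x1; lra.
  have -> : x1 t = x1 (t - 0) by rewrite subr0.
  apply: (@compare_half (fun r => B2 (t - r)) (fun r => B1 (t - r)) (lam / 4)
    (- (lam - lam / 4)) P 0 (t - mid) y (fun r => x1 (t - r)) _ kl' P0 _ yn) => //.
  - lra.
  - by rewrite /mid; rewrite /p in p0; lra.
  - by move=> r /andP[r0 _]; exact: sy.
  - move=> r /andP[_ rm]; apply: has_deriv_rev; apply: s1.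
    by rewrite /mid in rm; rewrite /p in p0; lra.
  - move=> r u w; rewrite [dot u _]dotC [dot _ w]dotC [dot (B2 _ _) _]dotC.
    by have := diff (t - r) w u; lra.
  - move=> r /andP[r0 rm].
    have tr0 : tau < t - r by rewrite /mid in rm; rewrite /p in p0; lra.
    have := gen_sol_le hH d1 T0 eta2 s1 x1n tr0.
    move=> /(_ ltac:(rewrite /p in tT; lra))/le_trans; apply.
    by apply: bP; rewrite /p; rewrite /mid in rm; lra.
have sq : Num.sqrt (lam / 4) <= Num.sqrt lam by rewrite ler_wsqrtr//; lra.
have PP : P ^+ 2 * (p / 2) / 2 = gen_const C eta T ^+ 2 / p.
  by rewrite /P; field; rewrite gt_eqF.
have m1 : mid - tau = p / 2 by rewrite /mid /p; lra.
have m2 : t - mid - 0 = p / 2 by rewrite /mid /p; lra.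
rewrite m1 PP in h1; rewrite m2 PP in h2.
have Q0 : 0 <= 1 / 4 + gen_const C eta T ^+ 2 / p.
  by rewrite addr_ge0 ?divr_ge0 ?sqr_ge0// ltW.
have := ler_wpM2r Q0 sq; move: h1 h2.
rewrite [dot (y (t - mid)) _]dotC [dot (y 0) _]dotC -/p !ler_norml.
by move=> /andP[? ?] /andP[? ?] ?; apply/andP; split; lra.
Qed.

End two_families.

(** The weight [(1 + rho)^-1] in [ds_close_scaled] leaves at most half of [form B r w] on the right,
    to be absorbed. Forms at different times are thus comparable, although the domains of the
    generators are not. *)
Lemma form_compare (B : R -> H -> H) M C eta r s w : dissipative B M C eta ->
  form B r w <= (2 + C * `|r - s| `^ eta * (1 + C * `|r - s| `^ eta)) * form B s w.
Proof.
move=> dB; set rho := C * _.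
have rho0 : 0 <= rho by rewrite mulr_ge0 ?powR_ge0// ltW// (ds_C dB).
have r1 : 0 < (1 + rho)^-1 by rewrite invr_gt0; lra.
have := ds_close_scaled hH dB r s w w r1; rewrite -/rho invrK.
have fr := form_ge0 dB r w; have fs := form_ge0 dB s w.
rewrite ler_norml => /andP[h _].
have k : rho * ((1 + rho)^-1 * form B r w) <= form B r w.
  rewrite mulrCA ler_pdivrMl; last lra.
  by rewrite ler_wpM2r//; lra.
by move: h k; rewrite /form; lra.
Qed.

(** After expanding the square only the change of [dot (x r) (x tau)] matters. By [form_cauchy] with
    weight [k = sqrt (t - tau)], its speed is at most half of [k] times the dissipated form plus
    [Mw / k]; both integrate to order [k]. *)
Lemma sol_start (B : R -> H -> H) M C eta tau t x Mw : dissipative B M C eta ->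
  is_sol B tau x -> tau <= t -> (forall r, tau <= r <= t -> form B r (x tau) <= Mw) ->
  `|x t - x tau| ^+ 2 <= Num.sqrt (t - tau) * (`|x tau| ^+ 2 / 2 + Mw).
Proof.
move=> dB sx; rewrite le_eqVlt => /predU1P[-> _|taut fM].
  by rewrite !subrr normr0 expr0n /= sqrtr0 mul0r.
have [k [k0 k2]] : exists k, 0 < k /\ k ^+ 2 = t - tau.
  have h : 0 < t - tau by rewrite subr_gt0.
  by exists (Num.sqrt (t - tau)); rewrite sqrtr_gt0 sqr_sqrtr ?(ltW h).
rewrite -k2 sqrtr_sqr (gtr0_norm k0); set w := x tau in fM *.
have df r : tau <= r <= t -> has_deriv (fun r => - dot (x r) w : R^o) r
    (- dot (B r (x r)) w).
  move=> /andP[tr _]; apply: (@has_derivN _ R^o); apply: (has_deriv_dotr hH).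
  exact: sx.
have hg r : tau <= r <= t -> has_deriv
    (fun r => - (k / 4) * `|x r| ^+ 2 + Mw / (2 * k) * r : R^o) r
    (- (k / 4) * (- 2 * form B r (x r)) + Mw / (2 * k)).
  move=> /andP[tr _]; apply: has_derivD; last exact: has_derivZl.
  by apply: (@has_derivZ _ R^o); exact: sol_sqr_norm sx tr.
have := mean_le (ltW taut) df hg => h.
have {}h := h ltac:(move=> r hr; have := form_cauchy hH dB r (x r) w k0;
  rewrite ler_norml => /andP[h1 _];
  have := ler_wpM2l (ltW (etrans (invr_gt0 k) k0)) (fM r ltac:(lra));
  have -> : Mw / (2 * k) = k^-1 * Mw / 2 by [field; rewrite gt_eqF]; lra).
have kM : Mw / (2 * k) * t - Mw / (2 * k) * tau = k * Mw / 2.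
  by rewrite -mulrBr -k2; field; rewrite gt_eqF.
have n1 : 0 <= k * `|x t| ^+ 2 by rewrite mulr_ge0 ?sqr_ge0// ltW.
have xt : `|x t| ^+ 2 <= `|w| ^+ 2.
  by rewrite ler_sqr ?nnegrE//; exact: (sol_le hH dB sx (lexx _) (ltW taut)).
rewrite (sqr_normB hH); move: h; rewrite -/w dotE => h.
lra.
Qed.

End comparison.

(** * The limit of the approximate evolutions *)

Section limit.
Context {R : realType} {H : normedModType R} {dot : H -> H -> R}.
Hypothesis hH : hilbert_dot dot.

Local Notation dotC := (dotC hH).
Local Notation dotE := (dotE hH).
Local Notation dotlin := (dotlin hH).
Local Notation form := (@form R H dot).
Local Notation dissipative := (@dissipative R H dot).

Lemma powR_small (g e : R) : 0 < g -> 0 < e -> exists2 del : R, 0 < del &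
  forall s, 0 <= s -> s <= del -> s `^ g <= e.
Proof.
move=> g0 e0; exists (e `^ g^-1) => [|s s0 sd]; first exact: powR_gt0.
have -> : e = (e `^ g^-1) `^ g by rewrite -powRrM mulVf ?gt_eqF// powRr1// ltW.
by rewrite ge0_ler_powR// ?nnegrE ?powR_ge0// ltW.
Qed.

Lemma unit_scale (u : H) : exists2 w, `|w| <= 1 & u = `|u| *: w.
Proof.
have [->|u0] := eqVneq u 0; first by exists 0; rewrite ?normr0 ?scale0r.
have u1 : 0 < `|u| by rewrite normr_gt0.
exists (`|u|^-1 *: u); first by rewrite normrZ normfV normr_id mulVf ?gt_eqF.
by rewrite scalerA divff ?scale1r// gt_eqF.
Qed.

Lemma norm_lin_le (f : H -> H) K : (forall (a : R) u, f (a *: u) = a *: f u) ->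
  (forall u, `|u| <= 1 -> `|f u| <= K) -> forall u, `|f u| <= K * `|u|.
Proof.
move=> fZ fK u; have [w w1 uw] := unit_scale u.
by rewrite {1}uw fZ normrZ normr_id mulrC ler_wpM2r// fK.
Qed.

Lemma seq_lim_real_le (u : nat -> R) l K : (forall n, u n <= K) ->
  seq_lim (u : nat -> R^o) l -> l <= K.
Proof.
move=> h ul; apply/ler_addgt0Pr => e e0; have [n hn] := ul e e0.
by have := hn n (leqnn _); have := h n; rewrite ler_norml => ? /andP[]; lra.
Qed.

Lemma seq_lim_dot (u : nat -> H) l v :
  seq_lim u l -> seq_lim (fun n => dot (u n) v : R^o) (dot l v).
Proof.
move=> ul e e0; have v1 : 0 < `|v| + 1 by have := normr_ge0 v; lra.
have [n h] := ul (e / (`|v| + 1)) ltac:(by rewrite divr_gt0).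
exists n => i /h {}h.
have -> : dot (u i) v - dot l v = dot (u i - l) v by rewrite !dotlin.
rewrite (le_trans (dot_abs hH _ _))// (le_trans (ler_wpM2r _ h))//.
by rewrite mulrAC -mulrA ler_piMr ?ltW// ltr_pdivrMr//; lra.
Qed.

(** Continuity in operator norm follows from closeness: both forms are at most [M] on the unit ball,
    so that generators differ by at most [C * M * |r - s|^eta]. *)
Lemma dissipative_bound (B : R -> H -> H) M C eta : 0 < M -> 0 < C -> 0 < eta ->
  (forall r (a : R) u v, B r (a *: u + v) = a *: B r u + B r v) ->
  (forall r u, `|B r u| <= M * `|u|) ->
  (forall r x y, dot (B r x) y = dot x (B r y)) ->
  (forall r x, dot (B r x) x <= 0) ->
  (forall r s x y, `|dot (B r x) y - dot (B s x) y| <=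
    C * `|r - s| `^ eta / 2 * (form B r x + form B s y)) ->
  dissipative B M C eta.
Proof.
move=> M0 C0 eta0 lin bd sym neg cl; split=> //; split=> // r e e0.
have [del d0 hd] := powR_small eta0 (e := e / (C * M)) ltac:(by rewrite divr_gt0 ?mulr_gt0).
exists del => // s sr; apply: norm_lin_le => [a u|u u1].
  have z0 t : B t 0 = 0.
    by have := lin t (-1) 0 0; rewrite scaler0 addr0 scaleN1r addNr.
  by have := lin s a u 0; have := lin r a u 0; rewrite !z0 !addr0 => -> ->; rewrite scalerBr.
apply: (norm_le_dot hH) => v v1.
have := cl s r u v; have := hd _ (normr_ge0 _) sr.
set P := `|s - r| `^ eta; have P0 : 0 <= P by exact: powR_ge0.
rewrite ler_pdivlMr ?mulr_gt0// => hP.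
have fM t w : `|w| <= 1 -> form B t w <= M.
  move=> w1; rewrite /form; have := dot_abs hH (B t w) w.
  have : `|B t w| * `|w| <= M * `|w| * 1 by rewrite ler_pM.
  have : M * `|w| <= M by rewrite ler_piMr// ltW.
  by rewrite ler_norml => ? ? /andP[]; lra.
have := ler_wpM2l (mulr_ge0 (ltW C0) P0) (lerD (fM s u u1) (fM r v v1)).
by rewrite !dotlin ler_norml => h /andP[]; lra.
Qed.

Variables (A : R -> unbounded_operator H) (C eta T : R).
Hypotheses (sA : forall t, selfadjoint dot (A t)).
Hypotheses (nA : forall t, nonpositive dot (A t)).
Hypotheses (C0 : 0 < C) (T0 : 0 < T) (eta2 : 2^-1 < eta).
Hypothesis Aclose : forall t s u v, op_dom (A t) u -> op_dom (A s) v ->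
  `|dot (A t u) v - dot u (A s v)| <=
    C * `|t - s| `^ eta / 2 * (- dot (A t u) u - dot (A s v) v).

(* The distance of the solutions for [lam n] and [lam n.+1] is of order
   [Num.sqrt (lam n)], hence geometric. *)
Let lam n : R := 4^-1 ^+ n.
Let B n (r : R) : H -> H := yosida (A r) (lam n).

Let lam_gt0 n : 0 < lam n. Proof. by rewrite exprn_gt0. Qed.

Let eta_gt0 : 0 < eta. Proof. by have := eta2; lra. Qed.

Let dB n : dissipative (B n) (lam n)^-1 C eta.
Proof.
apply: dissipative_bound => //; first by rewrite invr_gt0.
- by move=> r a u v; exact: (yosidaP hH (sA r) (@nA r) (lam_gt0 n)).
- by move=> r u; exact: (yosida_bounded hH (sA r) (@nA r) (lam_gt0 n)).
- by move=> r x y; exact: (yosida_sym hH (sA r) (@nA r) (lam_gt0 n)).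
- by move=> r x; exact: (yosida_le0 hH (sA r) (@nA r) (lam_gt0 n)).
- move=> r s x y; have -> : dot (B n s x) y = dot x (B n s y).
    exact: (yosida_sym hH (sA s) (@nA s) (lam_gt0 n)).
  apply: (yosida_close hH) => //.
  + by rewrite mulr_ge0 ?powR_ge0// ltW.
  + by move=> u v; exact: Aclose.
Qed.

Definition approx (n : nat) (tau : R) (u : H) : R -> H :=
  xget (fun=> u) [set x : R -> H | x tau = u /\ is_sol (B n) tau x].

Let approxP n tau u : approx n tau u tau = u /\ is_sol (B n) tau (approx n tau u).
Proof.
rewrite /approx; case: xgetP => [x _ //|] h.
by have [x x0 sx] := sol_ex hH (dB n) tau u; case: (h x).
Qed.

Let approx_start n tau u : approx n tau u tau = u := (approxP n tau u).1.
Let approx_sol n tau u : is_sol (B n) tau (approx n tau u) := (approxP n tau u).2.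
Arguments approx_sol : clear implicits.

Let approxD n tau t (a : R) u v : tau <= t ->
  approx n tau (a *: u + v) t = a *: approx n tau u t + approx n tau v t.
Proof.
move=> taut.
have sy : is_sol (B n) tau (fun r => a *: approx n tau u r + approx n tau v r).
  move=> r tr; rewrite /B (yosidaP hH (sA r) (@nA r) (lam_gt0 n)).
  apply: has_derivD; last exact: approx_sol.
  by apply: has_derivZ; exact: approx_sol.
have := sol_uniq hH (dB n) (approx_sol n tau (a *: u + v)) sy taut.
by apply; rewrite !approx_start.
Qed.

Let approx0 n tau t : tau <= t -> approx n tau 0 t = 0.
Proof.
move=> taut; have := approxD n (-1) 0 0 taut.
by rewrite scaler0 addr0 scaleN1r addNr.
Qed.

Let approxZ n tau t (a : R) u : tau <= t ->
  approx n tau (a *: u) t = a *: approx n tau u t.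
Proof.
by move=> taut; have := approxD n a u 0 taut; rewrite approx0// !addr0.
Qed.

Let approxB n tau t u v : tau <= t ->
  approx n tau (u - v) t = approx n tau u t - approx n tau v t.
Proof.
move=> taut; have := approxD n (-1) v u taut.
by rewrite !scaleN1r addrC [- approx _ _ _ _ + _]addrC.
Qed.

Let approx_norm n tau t u : tau <= t -> `|approx n tau u t| <= `|u|.
Proof.
move=> taut; have := sol_le hH (dB n) (approx_sol n tau u) (lexx _) taut.
by rewrite approx_start.
Qed.

Let approx_norm1 n tau t u : tau <= t -> `|u| <= 1 -> `|approx n tau u t| <= 1.
Proof. by move=> taut; apply: le_trans; exact: approx_norm. Qed.

Let start1 n tau u : `|u| <= 1 -> `|approx n tau u tau| <= 1.
Proof. by rewrite approx_start. Qed.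

Let approx_comp n tau r t u : tau <= r -> r <= t ->
  approx n r (approx n tau u r) t = approx n tau u t.
Proof.
move=> taur rt; have sy : is_sol (B n) r (approx n tau u).
  by move=> s rs; apply: approx_sol; exact: le_trans rs.
by apply: (sol_uniq hH (dB n) (approx_sol n r _) sy rt); rewrite approx_start.
Qed.

Let sqrt_lam n : Num.sqrt (lam n) = 2^-1 ^+ n.
Proof.
have -> : lam n = (2^-1 ^+ n) ^+ 2.
  rewrite /lam exprAC; congr (_ ^+ n); by field.
by rewrite sqrtr_sqr ger0_norm// exprn_ge0.
Qed.

Let approx_step n tau t u : tau < t -> t - tau <= T ->
  `|approx n.+1 tau u t - approx n tau u t| <=
  6 * (1 / 4 + gen_const C eta T ^+ 2 / (t - tau)) * `|u| * 2^-1 ^+ n.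
Proof.
move=> taut tT; have tt := ltW taut.
rewrite -mulrA [`|u| * _]mulrC mulrA.
apply: (norm_lin_le (f := fun u => approx n.+1 tau u t - approx n tau u t)).
  by move=> a w; rewrite !approxZ// scalerBr.
move=> w w1; apply: (norm_le_dot hH) => v v1.
have lS : lam n.+1 = lam n / 4 by rewrite /lam exprS mulrC.
have lf m r x : lam m * `|B m r x| ^+ 2 <= form (B m) r x.
  by exact: (yosida_norm_le hH (sA r) (@nA r) (lam_gt0 m)).
have := compare_sol hH (dB n) (dB n.+1) T0 eta2 (lam_gt0 n) (lf n) _ _
  (approx_sol n tau w) (approx_sol n.+1 tau w).
rewrite -lS => /(_ _ v (lf n.+1)) h.
have {}h := h t ltac:(by move=> r x y; exact: (yosida_diff hH (sA r) (@nA r))).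
rewrite !approx_start in h; have {}h := h erefl w1 v1 taut tT.
rewrite -opprB (dotNl hH) sqrt_lam in h *.
move: h; rewrite ler_norml => /andP[h _]; lra.
Qed.

Definition evolution (t tau : R) (u : H) : H :=
  xget 0 [set l | seq_lim (fun n => approx n tau u t) l].

Local Notation U := evolution.

Let U_lim t tau u : tau <= t -> t - tau <= T ->
  seq_lim (fun n => approx n tau u t) (U t tau u).
Proof.
move=> taut tT; rewrite /evolution; case: xgetP => [l _ //|] h.
move: taut; rewrite le_eqVlt => /predU1P[taut|taut].
  (* At [t = tau], where [approx_step] says nothing, all approximations equal [u]. *)
  exfalso; apply: (h u) => e e0; exists 0%N => i _.
  by rewrite -taut approx_start subrr normr0 ltW.
have K0 : 0 <= 6 * (1 / 4 + gen_const C eta T ^+ 2 / (t - tau)) * `|u|.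
  have : 0 <= gen_const C eta T ^+ 2 / (t - tau).
    by rewrite divr_ge0 ?sqr_ge0// subr_ge0 ltW.
  by move=> ?; rewrite mulr_ge0//; lra.
have [l ul _] := geometric_lim hH K0 (fun n => approx_step n u taut tT).
by case: (h l).
Qed.

Lemma evolution_linear t tau (a : R) u v : tau <= t -> t - tau <= T ->
  U t tau (a *: u + v) = a *: U t tau u + U t tau v.
Proof.
move=> taut tT; apply: seq_lim_uniq (U_lim _ taut tT) _.
move=> e e0; have := seq_limD (seq_limZ a (U_lim u taut tT)) (U_lim v taut tT).
by move=> /(_ e e0)[n h]; exists n => i /h; rewrite approxD.
Qed.

Lemma evolution_contraction t tau u : tau <= t -> t - tau <= T ->
  `|U t tau u| <= `|u|.
Proof.
move=> taut tT; apply: (seq_lim_norm_le hH _ (U_lim u taut tT)) => n.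
exact: approx_norm.
Qed.

Let U_norm1 t tau u : tau <= t -> t - tau <= T -> `|u| <= 1 -> `|U t tau u| <= 1.
Proof. by move=> taut tT; apply: le_trans; exact: evolution_contraction. Qed.

Let U0 t tau : tau <= t -> t - tau <= T -> U t tau 0 = 0.
Proof.
move=> taut tT; have := evolution_linear (-1) 0 0 taut tT.
by rewrite scaler0 addr0 scaleN1r addNr.
Qed.

Let UZ t tau (a : R) u : tau <= t -> t - tau <= T ->
  U t tau (a *: u) = a *: U t tau u.
Proof.
by move=> taut tT; have := evolution_linear a u 0 taut tT; rewrite U0// !addr0.
Qed.

Let UB t tau u v : tau <= t -> t - tau <= T ->
  U t tau (u - v) = U t tau u - U t tau v.
Proof.
move=> taut tT; have := evolution_linear (-1) v u taut tT.
by rewrite !scaleN1r addrC [- U _ _ _ + _]addrC.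
Qed.

Lemma evolution_id tau u : U tau tau u = u.
Proof.
have tT : tau - tau <= T by rewrite subrr ltW.
apply: seq_lim_uniq (U_lim u (lexx _) tT) _ => e e0; exists 0%N => i _.
by rewrite approx_start subrr normr0 ltW.
Qed.

Lemma evolution_comp t r tau u : tau <= r -> r <= t -> t - tau <= T ->
  U t r (U r tau u) = U t tau u.
Proof.
move=> taur rt tT; have tr : t - r <= T by lra.
have rT : r - tau <= T by lra.
apply/esym/(seq_lim_uniq (U_lim u (le_trans taur rt) tT)) => e e0.
have e2 : 0 < e / 2 by lra.
have /(_ _ e2)[n1 h1] := U_lim u taur rT.
have /(_ _ e2)[n2 h2] := U_lim (U r tau u) rt tr.
exists (maxn n1 n2) => i; rewrite geq_max => /andP[/h1 a /h2 b].
rewrite -(subrKA (approx i r (U r tau u) t)) (le_trans (ler_normD _ _))//.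
rewrite -(approx_comp i u taur rt) -approxB//.
have := @approx_norm i r t (approx i tau u r - U r tau u) rt; lra.
Qed.

Local Notation gc := (gen_const C eta T).

Let gc0 : 0 < gc := gen_const_gt0 (dB 0) T eta2.

Let gen_le n t tau u : `|u| <= 1 -> tau < t -> t - tau <= T ->
  `|B n t (approx n tau u t)| <= gc / (t - tau).
Proof.
move=> u1; apply: (gen_sol_le hH (dB n) T0 eta2 (approx_sol n tau u)).
exact: start1.
Qed.

(** The resolvent moves a vector by [lam n] times the norm of its generator, here at most
    [lam n * gc / (t - tau)]. It brings the approximations into the domain of [A t], where symmetry
    of [A t] can be used. *)
Let resolvent_lim t tau u : `|u| <= 1 -> tau < t -> t - tau <= T ->
  seq_lim (fun n => resolvent (A t) (lam n) (approx n tau u t)) (U t tau u).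
Proof.
move=> u1 taut tT e e0; have p0 : 0 < t - tau by rewrite subr_gt0.
have K1 : 0 < gc / (t - tau) by rewrite divr_gt0.
have e2 : 0 < e / 2 by lra.
have /(_ _ e2)[n1 h1] := U_lim u (ltW taut) tT.
have [n2 h2] := expr2V_small (e := e / 2 / (gc / (t - tau))) ltac:(by rewrite !divr_gt0).
exists (maxn n1 n2) => i; rewrite geq_max => /andP[/h1 a /h2 b].
rewrite -(subrKA (approx i tau u t)) (le_trans (ler_normD _ _))//.
rewrite (resolvent_dist hH (sA t) (@nA t) (lam_gt0 i)).
have l1 : lam i <= 2^-1 ^+ i.
  by rewrite /lam lerXn2r ?nnegrE ?invr_ge0// lef_pV2 ?posrE//; lra.
have := ler_pM (ltW (lam_gt0 i)) (normr_ge0 _) l1 (gen_le i u1 taut tT).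
move: b; rewrite ler_pdivlMr//; rewrite -/(B i t _); lra.
Qed.

(** For [w] in the domain, [dot (U t tau u) (A t w)] is the limit of the pairings of the approximate
    generators with [w], hence at most [gc / (t - tau) * |w|]; [selfadjoint_bounded_dom]
    concludes. *)
Let evolution_dom1 t tau u : `|u| <= 1 -> tau < t -> t - tau <= T ->
  op_dom (A t) (U t tau u) /\ `|A t (U t tau u)| <= gc / (t - tau).
Proof.
move=> u1 taut tT; have p0 : 0 < t - tau by rewrite subr_gt0.
apply: (selfadjoint_bounded_dom hH (sA t) (@nA t)) => [|w Dw].
  by rewrite divr_ge0 ?ltW.
apply: (seq_lim_dot_le hH _ (resolvent_lim u1 taut tT)) => n.
rewrite -(selfadjoint_sym (sA t)) //; last exact: (resolvent_dom hH (sA _) (@nA _)).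
rewrite (le_trans (dot_le hH _ _))// ler_wpM2r//; exact: gen_le.
Qed.

Lemma evolution_dom t tau u : tau < t -> t - tau <= T ->
  op_dom (A t) (U t tau u).
Proof.
move=> taut tT; have [w w1 ->] := unit_scale u; rewrite UZ// ?ltW//.
by apply: op_domZ; exact: (evolution_dom1 w1 taut tT).1.
Qed.

Lemma evolution_gen_le t tau u : `|u| <= 1 -> tau < t -> t - tau <= T ->
  `|A t (U t tau u)| <= gc / (t - tau).
Proof. by move=> u1 taut tT; exact: (evolution_dom1 u1 taut tT).2. Qed.

Lemma evolution_gen_linear t tau (a : R) u v : tau < t -> t - tau <= T ->
  A t (U t tau (a *: u + v)) = a *: A t (U t tau u) + A t (U t tau v).
Proof.
move=> taut tT; rewrite evolution_linear// ?ltW// op_fun_linear//;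
exact: evolution_dom.
Qed.

(** Against [w] in the domain, [A t] is moved onto [w] and [resolvent_lim] applies; the uniform
    bound on the generators extends this to all [v] by density. *)
Let gen_weak t tau u v : `|u| <= 1 -> tau < t -> t - tau <= T ->
  seq_lim (fun n => dot (B n t (approx n tau u t)) v : R^o)
    (dot (A t (U t tau u)) v).
Proof.
move=> u1 taut tT e e0; have p0 : 0 < t - tau by rewrite subr_gt0.
have [Dy yK] := evolution_dom1 u1 taut tT.
set K := gc / (t - tau) in yK; have K1 : 0 < K by rewrite divr_gt0.
have [w Dw vw] := selfadjoint_dense (sA t) v (e := e / 4 / K) ltac:(by rewrite !divr_gt0).
have [n h] := seq_lim_dot (A t w) (resolvent_lim u1 taut tT) (e := e / 2) ltac:(lra).
exists n => i /h; rewrite -!(selfadjoint_sym (sA t))//; last exact: (resolvent_dom hH (sA _) (@nA _)).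
rewrite -/(yosida (A t) (lam i) _) -/(B i t _) => {}h.
have small y : `|y| <= K -> `|dot y (v - w)| <= e / 4.
  move=> yK'; rewrite (le_trans (dot_abs hH _ _))//.
  rewrite (le_trans (ler_pM _ _ yK' (ltW vw)))//.
  by rewrite mulrCA mulfV ?mulr1// gt_eqF.
have h1 := small _ yK; have h2 := small _ (gen_le i u1 taut tT).
move: h h1 h2; rewrite !dotlin !ler_norml.
by move=> /andP[? ?] /andP[? ?] /andP[? ?]; apply/andP; split; lra.
Qed.

Lemma evolution_gen_cont t t' tau m s u : `|u| <= 1 -> 0 < m -> m <= t - tau ->
  m <= t' - tau -> t - tau <= T -> t' - tau <= T -> 0 < s -> 2 * s <= m ->
  `|A t (U t tau u) - A t' (U t' tau u)| <= gen_modulus C eta T m s `|t' - t|.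
Proof.
move=> u1 m0 mt mt' tT t'T s0 sm; apply: (norm_le_dot hH) => v v1.
have l1 := gen_weak v u1 (ltac:(lra) : tau < t) tT.
have l2 := gen_weak v u1 (ltac:(lra) : tau < t') t'T.
have := seq_limD l1 (seq_limZ (-1 : R) l2).
have -> : dot (A t (U t tau u)) v + (-1 : R) *: (dot (A t' (U t' tau u)) v : R^o) =
  dot (A t (U t tau u) - A t' (U t' tau u)) v.
  by rewrite !dotlin scaleN1r.
apply: seq_lim_real_le => n; rewrite scaleN1r.
have := gen_sol_cont hH (dB n) T0 eta2 (approx_sol n tau u) (start1 n tau u1) v1 m0
  mt mt' tT t'T s0 sm.
by rewrite ler_norml => /andP[].
Qed.

Lemma evolution_lip t t' tau m u : `|u| <= 1 -> 0 < m -> m <= t - tau ->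
  t <= t' -> t' - tau <= T ->
  `|U t' tau u - U t tau u| <= gc / m * (t' - t).
Proof.
move=> u1 m0 mt tt' t'T.
have l1 := U_lim u (ltac:(lra) : tau <= t) ltac:(lra).
have l2 := U_lim u (ltac:(lra) : tau <= t') t'T.
have := seq_limD l2 (seq_limZ (-1 : R) l1); rewrite scaleN1r.
apply: (seq_lim_norm_le hH) => n; rewrite scaleN1r.
exact: (sol_lip hH (dB n) T0 eta2 (approx_sol n tau u) (start1 n tau u1) m0 mt tt' t'T).
Qed.

(** Duality turns the initial time into the final time of a backward solution, to which [sol_lip]
    applies. *)
Lemma evolution_lip_start t tau tau' m u : `|u| <= 1 -> 0 < m -> m <= t - tau' ->
  tau <= tau' -> t - tau <= T ->
  `|U t tau' u - U t tau u| <= gc / m * (tau' - tau).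
Proof.
move=> u1 m0 mt tt' t'T.
have l1 := U_lim u (ltac:(lra) : tau <= t) t'T.
have l2 := U_lim u (ltac:(lra) : tau' <= t) ltac:(lra).
have := seq_limD l2 (seq_limZ (-1 : R) l1); rewrite scaleN1r.
apply: (seq_lim_norm_le hH) => n; rewrite scaleN1r.
apply: (norm_le_dot hH) => v v1.
have [y y0 sy] := back_ex hH t v (dB n).
have du := duality hH (ds_sym (dB n)) (approx_sol n tau u) sy ltac:(lra).
have du' := duality hH (ds_sym (dB n)) (approx_sol n tau' u) sy ltac:(lra).
rewrite !approx_start y0 in du du'; rewrite !dotlin du du'.
have y1 : `|y 0| <= 1 by rewrite y0.
have := sol_lip hH (back_shift t (dB n)) T0 eta2 sy y1 m0 (r := t - tau') (r' := t - tau).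
rewrite !subr0 => /(_ mt ltac:(lra) t'T).
have -> : t - tau - (t - tau') = tau' - tau by lra.
have := dot_abs hH u (y (t - tau) - y (t - tau')).
have : `|u| * `|y (t - tau) - y (t - tau')| <= `|y (t - tau) - y (t - tau')|.
  by rewrite ler_piMl.
rewrite !dotlin ler_norml => ? /andP[? ?] ?; lra.
Qed.

(** For each [n] the pairing with [v] is compared with linear functions of slope [D + E] or [D - E];
    then [n] tends to infinity, the slope [D] converging by [gen_weak]. The bound is uniform in [u]
    and [v], as differentiability in operator norm requires. *)
Lemma evolution_taylor t t' tau E u : `|u| <= 1 -> tau < t -> tau < t' ->
  t - tau <= T -> t' - tau <= T ->
  (forall r, Num.min t t' <= r <= Num.max t t' -> forall n v, `|v| <= 1 ->
    `|dot (B n r (approx n tau u r)) v - dot (B n t (approx n tau u t)) v| <= E) ->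
  `|U t' tau u - U t tau u - (t' - t) *: A t (U t tau u)| <= E * `|t' - t|.
Proof.
move=> u1 taut taut' tT t'T h; apply: (norm_le_dot hH) => v v1.
have l1 := seq_lim_dot v (U_lim u (ltW taut) tT).
have l2 := seq_lim_dot v (U_lim u (ltW taut') t'T).
have l3 := gen_weak v u1 taut tT.
have := seq_limD (seq_limD l2 (seq_limZ (-1 : R) l1)) (seq_limZ (- (t' - t)) l3).
have -> : dot (U t' tau u) v + (-1 : R) *: (dot (U t tau u) v : R^o) +
    - (t' - t) *: (dot (A t (U t tau u)) v : R^o) =
    dot (U t' tau u - U t tau u - (t' - t) *: A t (U t tau u)) v.
  by rewrite !dotlin /GRing.scale/=; ring.
apply: seq_lim_real_le => n; rewrite scaleN1r /GRing.scale/=.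
pose phi r := dot (approx n tau u r) v; pose D := dot (B n t (approx n tau u t)) v.
have dphi r : tau <= r -> has_deriv (phi : R -> R^o) r (dot (B n r (approx n tau u r)) v).
  by move=> tr; apply: (has_deriv_dotr hH); exact: approx_sol.
rewrite -/(phi t) -/(phi t') -/D.
have [tt'|t't] := leP t t'.
  have hb r : t < r < t' -> dot (B n r (approx n tau u r)) v <= D + E.
    move=> /andP[tr rt]; have := h r; rewrite min_l// max_r// (ltW tr) (ltW rt).
    move=> /(_ isT n v v1).
    by rewrite ler_norml => /andP[]; rewrite /D; lra.
  have := mean_le tt' (fun r hr => dphi r ltac:(lra)) (fun r _ => has_derivZl (D + E) r) hb.
  by rewrite ger0_norm ?subr_ge0//; lra.
have hb r : t' < r < t -> D - E <= dot (B n r (approx n tau u r)) v.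
  move=> /andP[tr rt]; have := h r; rewrite min_r ?max_l ?(ltW t't)//.
  rewrite (ltW tr) (ltW rt) => /(_ isT n v v1).
  by rewrite ler_norml => /andP[]; rewrite /D; lra.
have := mean_le (ltW t't) (fun r _ => has_derivZl (D - E) r) (fun r hr => dphi r ltac:(lra)) hb.
by rewrite ltr0_norm ?subr_lt0//; lra.
Qed.

Lemma evolution_deriv t t' tau m s u : `|u| <= 1 -> 0 < m -> m <= t - tau ->
  m <= t' - tau -> t - tau <= T -> t' - tau <= T -> 0 < s -> 2 * s <= m ->
  `|U t' tau u - U t tau u - (t' - t) *: A t (U t tau u)| <=
    gen_modulus C eta T m s `|t' - t| * `|t' - t|.
Proof.
move=> u1 m0 mt mt' tT t'T s0 sm; apply: evolution_taylor => //; try lra.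
move=> r /andP[r1 r2] n v v1.
have rb : m <= r - tau /\ r - tau <= T /\ `|r - t| <= `|t' - t|.
  have [tt'|t't] := leP t t'.
    by move: r1 r2; rewrite min_l// max_r// => ? ?; rewrite !ger0_norm; lra.
  move: r1 r2; rewrite min_r ?max_l ?(ltW t't)// => ? ?.
  by rewrite !ler0_norm; lra.
have [rb1 [rb2 rb3]] := rb; rewrite distrC.
have := gen_sol_cont hH (dB n) T0 eta2 (approx_sol n tau u) (start1 n tau u1) v1 m0
  mt rb1 tT rb2 s0 sm.
move/le_trans; apply; rewrite /gen_modulus.
have i1 : 0 <= (m * s)^-1 by rewrite invr_ge0 mulr_ge0 ?(ltW m0) ?(ltW s0).
have i2 : 0 <= 2 * gc by rewrite mulr_ge0 ?(ltW gc0).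
have i3 : 0 <= s^-1 by rewrite invr_ge0 ltW.
have i4 : `|r - t| `^ eta <= `|t' - t| `^ eta.
  by rewrite ge0_ler_powR ?nnegrE// ltW.
have := ler_wpM2r i3 (ler_wpM2l (ltW C0) i4).
have := ler_wpM2r i1 (ler_wpM2l i2 rb3); lra.
Qed.

(** The vector [w] may lie outside the domain of [A r] for [r > 0], but its form at [r] is
    controlled through [form_compare] by the one at 0, where [|B n 0 w| <= |A 0 w|]. This gives
    [sol_start] a bound [Mw] independent of [n] and [r]. *)
Lemma evolution_start_dom w : op_dom (A 0) w ->
  exists2 K : R, 0 <= K & forall t tau, 0 <= tau -> tau <= t -> t <= T ->
    `|U t tau w - w| ^+ 2 <= K * Num.sqrt (t - tau).
Proof.
move=> Dw; pose rho := C * T `^ eta; have rho0 : 0 <= rho.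
  by rewrite mulr_ge0 ?powR_ge0// ltW.
pose Mw := (2 + rho * (1 + rho)) * (`|A 0 w| * `|w|).
have Aw0 : 0 <= `|A 0 w| * `|w| by rewrite mulr_ge0.
have Mw0 : 0 <= Mw by rewrite mulr_ge0// addr_ge0// mulr_ge0// addr_ge0.
exists (`|w| ^+ 2 / 2 + Mw); first by rewrite addr_ge0// divr_ge0 ?sqr_ge0.
move=> t tau tau0 taut tT; have tT' : t - tau <= T by lra.
have bnd n r : 0 <= r <= T -> form (B n) r w <= Mw.
  move=> /andP[r0 rT]; rewrite (le_trans (form_compare hH r 0 w (dB n)))//.
  have f0 : form (B n) 0 w <= `|A 0 w| * `|w|.
    have := dot_abs hH (B n 0 w) w; rewrite ler_norml => /andP[h _].
    rewrite /form (le_trans (y := `|B n 0 w| * `|w|))//; first lra.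
    by rewrite ler_wpM2r//; exact: (yosida_norm_dom hH (sA 0) (@nA 0) (lam_gt0 n)).
  have fg := form_ge0 (dB n) 0 w.
  rewrite subr0 ger0_norm//.
  have rr : C * r `^ eta <= rho by rewrite ler_wpM2l ?(ltW C0)// ge0_ler_powR ?nnegrE// ltW.
  have r1 : 0 <= C * r `^ eta by rewrite mulr_ge0 ?powR_ge0// ltW.
  rewrite ler_pM//; first by rewrite addr_ge0// mulr_ge0// addr_ge0.
  rewrite lerD2l ler_pM//; [by rewrite addr_ge0|by rewrite lerD2l].
suff h : `|U t tau w - w| <= Num.sqrt (Num.sqrt (t - tau) * (`|w| ^+ 2 / 2 + Mw)).
  rewrite mulrC -[leRHS]sqr_sqrtr; last first.
    by rewrite mulr_ge0 ?sqrtr_ge0// addr_ge0// divr_ge0 ?sqr_ge0.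
  by rewrite ler_sqr ?nnegrE ?sqrtr_ge0.
have l1 := U_lim w taut tT'.
apply: (seq_lim_norm_le hH (u := fun n => approx n tau w t - w)) => [n|e /l1[n h]].
  apply: le_of_sqr; first exact: sqrtr_ge0.
  rewrite sqr_sqrtr; last first.
    by rewrite mulr_ge0 ?sqrtr_ge0// addr_ge0// divr_ge0 ?sqr_ge0.
  have := sol_start hH (dB n) (approx_sol n tau w) taut.
  by rewrite approx_start; apply=> r rt; apply: bnd; lra.
by exists n => i /h; rewrite opprB addrA subrK.
Qed.

End limit.

(** * Operator norm limits as uniform estimates on the unit ball *)

Section operator_norm.
Context {R : realType} {H : normedModType R}.
Implicit Types S : H -> H.

Lemma opnorm_leP S K : (opnorm S <= K%:E)%E <->
  forall u, `|u| <= 1 -> `|S u| <= K.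
Proof.
split=> [h u u1|h]; last first.
  by apply: ge_ereal_sup => _ [u u1 <-]; rewrite [leLHS]/=; apply: (h u u1).
rewrite -lee_fin; apply: le_trans h; apply: ereal_sup_ubound.
by exists u.
Qed.

Lemma opnorm_ge0 S : (0 <= opnorm S)%E.
Proof.
apply: (@le_trans _ _ `|S 0|%:E); first by rewrite lee_fin.
by apply: ereal_sup_ubound; exists 0 => //=; rewrite normr0.
Qed.

Lemma opnorm_cvg0P (I : Type) (F : set_system I) (S : I -> H -> H) : Filter F ->
  opnorm (S z) @[z --> F] --> 0%E <->
  forall e, 0 < e -> \forall z \near F, forall u, `|u| <= 1 -> `|S z u| <= e.
Proof.
move=> FF; split=> [h e e0|h P].
  have n0 : nbhs (0%:E : \bar R) [set x | (x <= e%:E)%E].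
    rewrite /nbhs/=; apply/nbhs_ballP; exists e => // r.
    by rewrite /ball/= sub0r normrN lee_fin => /ltW; apply: le_trans; exact: ler_norm.
  have := h _ n0; rewrite /= /nbhs /=; apply: filterS => z.
  by move/opnorm_leP.
rewrite {1}/nbhs/= => /nbhs_ballP[e /= e0 eP].
have e2 : 0 < e / 2 by rewrite divr_gt0.
have := h _ e2; apply: filterS => z /opnorm_leP hz; have := opnorm_ge0 (S z).
rewrite /=; case: (opnorm (S z)) hz => [r| |]//; rewrite !lee_fin => r1 r0.
apply: eP; rewrite /ball/= sub0r normrN ger0_norm//; lra.
Qed.

Lemma near_within_pair (D P : set (R * R)) (z0 : R * R) :
  (\forall z \near within D (nbhs z0), P z) <->
  exists2 del, 0 < del & forall z, D z -> `|z.1 - z0.1| < del ->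
    `|z.2 - z0.2| < del -> P z.
Proof.
rewrite near_withinE; split=> [/nbhs_ballP[del /= d0 h]|[del d0 h]].
  by exists del => // z Dz z1 z2; apply: h => //; split; rewrite /ball/= distrC.
apply/nbhs_ballP; exists del => //= z [z1 z2] Dz.
by apply: h => //; rewrite distrC.
Qed.

Lemma near_within_dnbhs (D P : set R) :
  (\forall h \near within D 0^', P h) <->
  exists2 del, 0 < del & forall h, D h -> h != 0 -> `|h| < del -> P h.
Proof.
rewrite near_withinE /dnbhs near_withinE.
split=> [/nbhs_ballP[del /= d0 h]|[del d0 h]].
  by exists del => // r Dr r0 rd; apply: h => //; rewrite /ball/= sub0r normrN.
apply/nbhs_ballP; exists del => //= r; rewrite /ball/= sub0r normrN => rd r0 Dr.
exact: h.
Qed.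

End operator_norm.

(** The lag [s] is fixed first, by the term that does not contain [h]; the two others are singular
    in [s] and are then made small through [h]. *)
Lemma gen_modulus_small (R : realType) (C eta T m e : R) : 0 < C -> 2^-1 < eta ->
  0 < gen_const C eta T -> 0 < m -> 0 < e ->
  exists s, [/\ 0 < s, 2 * s <= m & exists2 del, 0 < del &
    forall h, 0 <= h -> h <= del -> gen_modulus C eta T m s h <= e].
Proof.
move=> C0 eta2 gc0 m0 e0; have g0 : 0 < eta - 2^-1 by lra.
have [K KE] : exists K, K = C / (eta - 2^-1) * Num.sqrt (2 * form_const C eta T / m).
  by eexists.
have K0 : 0 <= K by rewrite KE mulr_ge0 ?sqrtr_ge0// divr_ge0// ltW.
have [d1 d10 h1] := powR_small g0 (e := e / 4 / (K + 1)) ltac:(by rewrite !divr_gt0//; lra).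
have [s [s0 sd sm]] : exists s, [/\ 0 < s, s <= d1 & 2 * s <= m].
  have mh : Num.min d1 (m / 2) <= m / 2 by rewrite ge_min lexx orbT.
  exists (Num.min d1 (m / 2)); split; last lra.
    by rewrite lt_min d10 divr_gt0.
  by rewrite ge_min lexx.
exists s; split => //.
have [d2 d20 h2] := powR_small (ltac:(lra) : 0 < eta) (e := e * s / (18 * C))
  ltac:(by rewrite divr_gt0// mulr_gt0).
exists (Num.min d2 (e * (m * s) / (8 * gen_const C eta T))).
  by rewrite lt_min d20 divr_gt0// !mulr_gt0.
move=> h hh0; rewrite le_min => /andP[hd2 hd3].
have t1 : K * s `^ (eta - 2^-1) <= e / 4.
  have := h1 s (ltW s0) sd; rewrite ler_pdivlMr; last lra.
  have := powR_ge0 s (eta - 2^-1); lra.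
have t2 : 9 / 2 * (C * h `^ eta) / s <= e / 4.
  rewrite ler_pdivrMr//; have := h2 h hh0 hd2; rewrite ler_pdivlMr ?mulr_gt0//; lra.
have t3 : 2 * gen_const C eta T * h / (m * s) <= e / 4.
  rewrite ler_pdivrMr ?mulr_gt0//; move: hd3; rewrite ler_pdivlMr ?mulr_gt0//; lra.
rewrite /gen_modulus -KE; lra.
Qed.

(** * Existence of the evolution family on the given time interval *)

Section wellposed.
Context {R : realType} {H : normedModType R} {dot : H -> H -> R}.
Hypothesis hH : hilbert_dot dot.

Local Notation dotC := (dotC hH).
Local Notation dotE := (dotE hH).
Local Notation dotlin := (dotlin hH).

Section existence.
Variables (A : R -> unbounded_operator H) (C eta T : R).
Hypotheses (sA : forall t, 0 <= t <= T -> selfadjoint dot (A t)).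
Hypotheses (nA : forall t, 0 <= t <= T -> nonpositive dot (A t)).
Hypotheses (C0 : 0 < C) (T0 : 0 < T) (eta2 : 2^-1 < eta).
Hypothesis Aclose : forall t s u v, 0 <= t <= T -> 0 <= s <= T ->
  op_dom (A t) u -> op_dom (A s) v ->
  `|dot (A t u) v - dot u (A s v)| <=
    C * `|t - s| `^ eta / 2 * (- dot (A t u) u - dot (A s v) v).

(* Freezing the operators outside of [0, T] reduces to families indexed by all
   real times. *)
Let clamp (t : R) := if t <= 0 then 0 else if t <= T then t else T.

Let clampP t : 0 <= clamp t <= T.
Proof.
have := T0; rewrite /clamp.
by have [t0|t0] := leP t 0; have [tT|tT] := leP t T; move=> ?; apply/andP; split; lra.
Qed.

Let clamp_id t : 0 <= t <= T -> clamp t = t.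
Proof.
by rewrite /clamp => /andP[? ?]; have [t0|t0] := leP t 0; have [tT|tT] := leP t T; lra.
Qed.

Let clamp_dist t s : `|clamp t - clamp s| <= `|t - s|.
Proof.
have ts := ler_norm (t - s); rewrite ler_norml /clamp.
have st := ler_norm (s - t); rewrite distrC in st; have T00 := T0.
have [t0|t0] := leP t 0; have [s0|s0] := leP s 0;
  have [tT|tT] := leP t T; have [sT|sT] := leP s T; apply/andP; split; lra.
Qed.

Let Ac t := A (clamp t).

Let AcE t : 0 <= t <= T -> Ac t = A t. Proof. by move=> h; rewrite /Ac clamp_id. Qed.

Let sAc t : selfadjoint dot (Ac t). Proof. exact/sA/clampP. Qed.
Let nAc t : nonpositive dot (Ac t). Proof. exact: nA (clampP t). Qed.

Let Acclose t s u v : op_dom (Ac t) u -> op_dom (Ac s) v ->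
  `|dot (Ac t u) v - dot u (Ac s v)| <=
    C * `|t - s| `^ eta / 2 * (- dot (Ac t u) u - dot (Ac s v) v).
Proof.
move=> Du Dv; rewrite (le_trans (Aclose (clampP t) (clampP s) Du Dv))//.
have n1 := nAc Du; have n2 := nAc Dv; have e2 := eta2.
rewrite ler_wpM2r//; first by rewrite /Ac in n1 n2 *; lra.
by rewrite ler_wpM2r// ler_wpM2l ?(ltW C0)// ge0_ler_powR ?nnegrE//; lra.
Qed.

Local Notation U := (evolution Ac).

Let Ulin := evolution_linear hH sAc nAc C0 T0 eta2 Acclose.
Let Ucontr := evolution_contraction hH sAc nAc C0 T0 eta2 Acclose.
Let Uid := evolution_id hH sAc nAc C0 T0 eta2 Acclose.
Let Ucomp := evolution_comp hH sAc nAc C0 T0 eta2 Acclose.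
Let Udom := evolution_dom hH sAc nAc C0 T0 eta2 Acclose.
Let Ugen_le := evolution_gen_le hH sAc nAc C0 T0 eta2 Acclose.
Let Ugen_lin := evolution_gen_linear hH sAc nAc C0 T0 eta2 Acclose.
Let Ugen_cont := evolution_gen_cont hH sAc nAc C0 T0 eta2 Acclose.
Let Ulip := evolution_lip hH sAc nAc C0 T0 eta2 Acclose.
Let Ulip_start := evolution_lip_start hH sAc nAc C0 T0 eta2 Acclose.
Let Uderiv := evolution_deriv hH sAc nAc C0 T0 eta2 Acclose.
Let Ustart := evolution_start_dom hH sAc nAc C0 T0 eta2 Acclose.

Let gc := gen_const C eta T.
Let gc0 : 0 < gc.
Proof.
have e2 := eta2; have g0 : 0 <= C / (eta - 2^-1) by rewrite divr_ge0 ?(ltW C0)//; lra.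
have : 0 <= C / (eta - 2^-1) * Num.sqrt (2 * form_const C eta T * T) * T `^ (eta - 2^-1).
  by rewrite mulr_ge0 ?powR_ge0// mulr_ge0 ?sqrtr_ge0.
by rewrite /gc /gen_const; lra.
Qed.

Let U_norm1 t tau u : tau <= t -> t - tau <= T -> `|u| <= 1 -> `|U t tau u| <= 1.
Proof. by move=> h1 h2; apply: le_trans; exact: Ucontr. Qed.

Let UB t tau u v : tau <= t -> t - tau <= T ->
  U t tau (u - v) = U t tau u - U t tau v.
Proof.
move=> taut tT; have := Ulin (-1) v u taut tT.
by rewrite !scaleN1r addrC [- U _ _ _ + _]addrC.
Qed.

Let UZ t tau (a : R) v : tau <= t -> t - tau <= T ->
  U t tau (a *: v) = a *: U t tau v.
Proof.
move=> taut tT; have := Ulin a v 0 taut tT; have := Ulin (-1) 0 0 taut tT.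
by rewrite scaler0 !addr0 scaleN1r addNr => ->; rewrite addr0.
Qed.

(** By contractivity [u] may be replaced by a nearby [w] in the domain of [A 0], for which
    [evolution_start_dom] is uniform in [tau]. *)
Lemma evolution_near_diagonal u e : 0 < e -> exists2 del, 0 < del &
  forall t tau, 0 <= tau -> tau <= t -> t <= T -> t - tau <= del ->
  `|U t tau u - u| <= e.
Proof.
move=> e0; have [w Dw uw] := selfadjoint_dense (sAc 0) u (e := e / 4) ltac:(lra).
have [K K0 hK] := Ustart Dw; have K1 : 0 < K + 1 by lra.
exists (((e / 2) ^+ 2 / (K + 1)) ^+ 2).
  by rewrite exprn_gt0// divr_gt0// exprn_gt0//; lra.
move=> t tau tau0 taut tT td.
have tT' : t - tau <= T by lra.
have Uw : `|U t tau w - w| <= e / 2.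
  apply: le_of_sqr; first lra.
  rewrite (le_trans (hK t tau tau0 taut tT))//.
  have : Num.sqrt (t - tau) <= (e / 2) ^+ 2 / (K + 1).
    rewrite -[leRHS]ger0_norm ?divr_ge0 ?sqr_ge0 ?(ltW K1)// -sqrtr_sqr.
    exact: ler_wsqrtr.
  by rewrite ler_pdivlMr//; have := sqrtr_ge0 (t - tau); lra.
have Uuw := Ucontr (u - w) taut tT'; rewrite UB// in Uuw.
rewrite -(subrKA (U t tau w)) (le_trans (ler_normD _ _))//.
rewrite -(subrKA w (U t tau w)); have := ler_normD (U t tau w - w) (w - u).
by rewrite [`|w - u|]distrC; lra.
Qed.

(** Off the diagonal the evolution factors through a fixed midpoint [sg]: [tau] enters only in
    [U sg tau] and [t] only in [U t sg], both Lipschitz with constants governed by the gap [m].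
    These blow up at the diagonal, which is treated apart. *)
Lemma evolution_strong_cont u e t0 tau0 : 0 <= tau0 -> tau0 <= t0 -> t0 <= T ->
  0 < e -> exists2 del, 0 < del & forall t tau, 0 <= tau -> tau <= t -> t <= T ->
    `|t - t0| < del -> `|tau - tau0| < del -> `|U t0 tau0 u - U t tau u| <= e.
Proof.
move=> tau00 + t0T e0; rewrite le_eqVlt => /predU1P[<-|tt].
  have [del d0 h] := evolution_near_diagonal u e0.
  exists (del / 2) => [|t tau ? ? ?]; first lra.
  rewrite !ltr_norml => /andP[? ?] /andP[? ?]; rewrite Uid distrC; apply: h => //; lra.
have [w w1 uw] := unit_scale u.
pose sg := (t0 + tau0) / 2; pose m := (t0 - tau0) / 4.
have m0 : 0 < m by rewrite /m; lra.
pose L := (gc / m * 2 * `|u|) + 1.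
have L0 : 0 < L.
  by have : 0 <= gc / m * 2 * `|u|; [rewrite !mulr_ge0// ?invr_ge0 ltW|rewrite /L; lra].
exists (Num.min m (e / L)); first by rewrite lt_min m0 divr_gt0.
move=> t tau tau_0 taut tT; rewrite !lt_min => /andP[a1 a2] /andP[b1 b2].
move: a1 b1; rewrite !ltr_norml => /andP[a1 a1'] /andP[b1 b1'].
have sg1 : tau0 <= sg by rewrite /sg; lra.
have sg2 : sg <= t0 by rewrite /sg; lra.
have sg3 : tau <= sg by rewrite /sg /m in b1' *; lra.
have sg4 : sg <= t by rewrite /sg /m in a1 *; lra.
have T1 : t0 - tau0 <= T by lra.
have T2 : t - tau <= T by lra.
rewrite uw !UZ//; last exact: ltW.
rewrite -scalerBr normrZ normr_id.
rewrite -(Ucomp w sg1 sg2 T1) -(Ucomp w sg3 sg4 T2).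
have w2 : `|U sg tau w| <= 1 by apply: U_norm1 => //; lra.
have S1 : `|U t0 sg (U sg tau0 w) - U t0 sg (U sg tau w)| <= gc / m * `|tau - tau0|.
  rewrite -UB//; last lra.
  rewrite (le_trans (Ucontr _ sg2 _))//; first lra.
  have [tt0|tt0] := leP tau tau0.
    rewrite [`|tau - _|]distrC [`|tau0 - tau|]ger0_norm ?subr_ge0//.
    by apply: Ulip_start => //; rewrite /sg /m in m0 b1 *; lra.
  rewrite distrC ger0_norm ?subr_ge0 ?(ltW tt0)//.
  by apply: Ulip_start => //; rewrite /sg /m in m0 b1' *; lra.
have S2 : `|U t0 sg (U sg tau w) - U t sg (U sg tau w)| <= gc / m * `|t - t0|.
  have [tt0|tt0] := leP t t0.
    rewrite [`|t - _|]distrC [`|t0 - t|]ger0_norm ?subr_ge0//.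
    by apply: Ulip => //; rewrite /sg /m in m0 a1 *; lra.
  rewrite distrC ger0_norm ?subr_ge0 ?(ltW tt0)//.
  by apply: Ulip => //; rewrite /sg /m in m0 a1' *; lra.
have S : `|U t0 sg (U sg tau0 w) - U t sg (U sg tau w)| <= gc / m * 2 * (e / L).
  rewrite -(subrKA (U t0 sg (U sg tau w))) (le_trans (ler_normD _ _))//.
  have gm : 0 <= gc / m by rewrite divr_ge0 ?ltW.
  by have := ler_wpM2l gm (ltW a2); have := ler_wpM2l gm (ltW b2); lra.
rewrite (le_trans (ler_wpM2l (normr_ge0 u) S))//.
have -> : `|u| * (gc / m * 2 * (e / L)) = e * (gc / m * 2 * `|u|) / L by ring.
by rewrite ler_pdivrMr// ler_pM2l// /L lerDl.
Qed.

Lemma evolution_family_ex : evolution_family T A U.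
Proof.
have bnd t tau : 0 <= tau <= t -> t <= T -> (opnorm (U t tau) <= 1%:E)%E.
  move=> /andP[tau0 taut] tT; apply/opnorm_leP => u u1.
  by apply: U_norm1 => //; lra.
have gbnd t tau : 0 <= tau < t -> t <= T ->
    (opnorm (A t \o U t tau) <= (gc / (t - tau))%:E)%E.
  move=> /andP[tau0 taut] tT; apply/opnorm_leP => u u1 /=.
  by rewrite -AcE; [apply: Ugen_le => //; lra|lra].
split=> //.
- move=> t tau h tT; split; last by rewrite (le_lt_trans (bnd t tau h tT))// ltry.
  by move: h => /andP[? ?] a u v; apply: Ulin => //; lra.
- move=> t tau sigma /andP[? ?] /andP[? ?] u; apply: Ucomp => //; lra.
- move=> u; apply/subspace_continuousP => -[t0 tau0] /= [/andP[? ?] ?].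
  apply/cvgrPdist_le => e e0; apply/near_within_pair.
  have [del d0 h] := evolution_strong_cont u (t0 := t0) (tau0 := tau0) ltac:(by [])
    ltac:(by []) ltac:(lra) e0.
  by exists del => // -[t tau] /= [/andP[? ?] /ltW ?] ? ?; exact: h.
- move=> t tau /andP[tau0 taut] tT u; rewrite -AcE; last lra.
  by apply: Udom => //; lra.
- move=> t tau /andP[tau0 taut] tT; apply/opnorm_cvg0P => e e0.
  have m0 : 0 < (t - tau) / 2 by lra.
  have [s [s0 sm [del d0 hd]]] := gen_modulus_small (T := T) C0 eta2 gc0 m0 e0.
  apply/near_within_dnbhs; exists (Num.min del ((t - tau) / 2)).
    by rewrite lt_min d0.
  move=> h /andP[h1 h2] h0; rewrite lt_min => /andP[hdel hm] u u1.
  move: hm; rewrite ltr_norml => /andP[hm1 hm2].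
  have := Uderiv (t := t) (t' := t + h) (tau := tau) (m := (t - tau) / 2) (s := s) (u := u).
  have -> : t + h - t = h by lra.
  move=> /(_ u1 m0 ltac:(lra) ltac:(lra) ltac:(lra) ltac:(lra) s0 sm).
  rewrite AcE; last lra.
  move=> k; have hh : 0 < `|h| by rewrite normr_gt0.
  rewrite -(ler_pM2l hh) -normrZ scalerBr scalerA mulfV// scale1r.
  rewrite (le_trans k)// mulrC ler_wpM2l//; apply: hd => //; exact: ltW.
- move=> t tau h tT; split; last first.
    by rewrite (le_lt_trans (gbnd t tau h tT))// ltry.
  by move: h => /andP[? ?] a u v /=; rewrite -AcE; [apply: Ugen_lin => //; lra|lra].
(* The same factorisation at a midpoint: [gen_modulus] controls the change of [t], and the bound on
   [A t (U t sg)] times the Lipschitz dependence of [U sg tau] controls that of [tau]. *)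
- move=> t tau /andP[tau0 taut] tT; apply/opnorm_cvg0P => e e0.
  apply/near_within_pair => /=.
  pose sg := (t + tau) / 2; pose m := (t - tau) / 4.
  have m0 : 0 < m by rewrite /m; lra.
  have e2 : 0 < e / 2 by lra.
  have [s [s0 sm [del d0 hd]]] := gen_modulus_small (T := T) C0 eta2 gc0 m0 e2.
  pose L := gc / m * (gc / m).
  have L0 : 0 < L by rewrite mulr_gt0// divr_gt0.
  exists (Num.min (Num.min del m) (e / 2 / L)).
    by rewrite !lt_min d0 m0 !divr_gt0.
  move=> [t' tau'] /= [/andP[tau'0 taut'] t'T].
  rewrite !lt_min => /andP[/andP[a1 a2] a3] /andP[/andP[b1 b2] b3] u u1.
  move: a2 b2; rewrite !ltr_norml => /andP[a2 a2'] /andP[b2 b2'].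
  have sg1 : tau <= sg by rewrite /sg; lra.
  have sg2 : sg < t by rewrite /sg; lra.
  have sg3 : tau' <= sg by rewrite /sg /m in b2' *; lra.
  have sg4 : sg < t' by rewrite /sg /m in a2 *; lra.
  have mm1 : m <= t - sg by rewrite /m /sg; lra.
  have mm2 : m <= t' - sg by rewrite /m /sg in a2 *; lra.
  have T1 : t - tau <= T by lra.
  have T2 : t' - tau' <= T by lra.
  have T3 : t - sg <= T by lra.
  have T4 : t' - sg <= T by lra.
  rewrite -!AcE; [|lra|lra].
  rewrite -(Ucomp u sg1 (ltW sg2) T1) -(Ucomp u sg3 (ltW sg4) T2).
  have w1 : `|U sg tau' u| <= 1 by apply: U_norm1 => //; lra.
  rewrite distrC.
  have S1 : `|Ac t (U t sg (U sg tau' u)) - Ac t' (U t' sg (U sg tau' u))| <= e / 2.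
    rewrite (le_trans (Ugen_cont w1 m0 mm1 mm2 T3 T4 s0 sm))//.
    by apply: hd => //; exact: ltW.
  have S2 : `|Ac t (U t sg (U sg tau u)) - Ac t (U t sg (U sg tau' u))| <= e / 2.
    have -> : Ac t (U t sg (U sg tau u)) - Ac t (U t sg (U sg tau' u)) =
        Ac t (U t sg (U sg tau u - U sg tau' u)).
      have := Ugen_lin (-1) (U sg tau' u) (U sg tau u) sg2 T3.
      by rewrite !scaleN1r [- U _ _ _ + _]addrC => ->; rewrite addrC.
    have glin : forall v, `|Ac t (U t sg v)| <= gc / (t - sg) * `|v|.
      apply: norm_lin_le => [a v|v v1]; last exact: Ugen_le.
      rewrite (UZ a v (ltW sg2) T3); apply: op_funZ; exact: Udom.
    have du : `|U sg tau u - U sg tau' u| <= gc / m * `|tau' - tau|.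
      have [tt0|tt0] := leP tau' tau.
        rewrite [`|tau' - _|]distrC [`|tau - tau'|]ger0_norm ?subr_ge0//.
        by apply: Ulip_start => //; rewrite /sg /m in m0 *; lra.
      rewrite distrC ger0_norm ?subr_ge0 ?(ltW tt0)//.
      by apply: Ulip_start => //; rewrite /sg /m in m0 b2' *; lra.
    rewrite (le_trans (glin _))//.
    have g1 : gc / (t - sg) <= gc / m by rewrite ler_pM2l// lef_pV2 ?posrE//; lra.
    have g2 : 0 <= gc / (t - sg) by rewrite divr_ge0 ?(ltW gc0)//; lra.
    rewrite (le_trans (ler_pM g2 (normr_ge0 _) g1 du))// mulrA -/L.
    by rewrite mulrC -ler_pdivlMr// ltW.
  rewrite -(subrKA (Ac t (U t sg (U sg tau' u)))) (le_trans (ler_normD _ _))//; lra.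
- by exists gc => // t tau h tT; apply: gbnd => //; exact: ltW.
Qed.

End existence.

End wellposed.

(** * Uniqueness of the evolution family *)

Section uniqueness.
Context {R : realType} {H : normedModType R} {dot : H -> H -> R}.
Hypothesis hH : hilbert_dot dot.
Variables (A : R -> unbounded_operator H) (T : R).
Hypotheses (nA : forall t, 0 <= t <= T -> nonpositive dot (A t)).

Lemma evolution_family_deriv (W : R -> R -> H -> H) t tau u :
  evolution_family T A W -> 0 <= tau < t -> t <= T -> `|u| <= 1 ->
  forall e, 0 < e -> exists2 del, 0 < del & forall h, `|h| <= del ->
    tau < t + h <= T -> `|W (t + h) tau u - W t tau u - h *: A t (W t tau u)| <=
    e * `|h|.
Proof.
move=> hW taut tT u1 e e0.
have /opnorm_cvg0P/(_ e e0)/near_within_dnbhs[del d0 hd] :=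
  evol_derivable hW taut tT.
exists (del / 2) => [|h hdel hT]; first lra.
have [->|h0] := eqVneq h 0.
  by rewrite addr0 scale0r subrr subr0 !normr0 mulr0.
have hh : 0 < `|h| by rewrite normr_gt0.
have := hd h hT h0 ltac:(lra) u u1.
by rewrite -(ler_pM2l hh) -normrZ scalerBr scalerA mulfV// scale1r mulrC.
Qed.

Lemma evolution_family_uniq (V W : R -> R -> H -> H) t tau :
  evolution_family T A V -> evolution_family T A W ->
  0 <= tau <= t -> t <= T -> W t tau = V t tau.
Proof.
move=> hV hW /andP[tau0 +] tT; rewrite le_eqVlt => /predU1P[tt0|taut].
  rewrite -tt0 in tT *; apply/funext => u.
  have tt : 0 <= tau <= T by rewrite tau0 tT.
  by rewrite (evol_id hV tt) (evol_id hW tt).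
have unit_eq u : `|u| <= 1 -> W t tau u = V t tau u.
  move=> u1; pose x r := W r tau u - V r tau u.
  have dx r : tau < r < T -> has_deriv x r (A r (W r tau u) - A r (V r tau u)).
    move=> /andP[tr rT]; apply: has_derivB => e e0.
      have [del d0 hd] := evolution_family_deriv hW (t := r) (tau := tau)
        ltac:(by rewrite tau0) (ltW rT) u1 e0.
      exists (Num.min del (Num.min ((r - tau) / 2) (T - r))).
        by rewrite !lt_min d0; apply/andP; split; lra.
      move=> h; rewrite !le_min => /andP[h1 /andP[+ +]].
      by rewrite !ler_norml => /andP[? ?] /andP[? ?]; apply: hd => //; lra.
    have [del d0 hd] := evolution_family_deriv hV (t := r) (tau := tau)
      ltac:(by rewrite tau0) (ltW rT) u1 e0.
    exists (Num.min del (Num.min ((r - tau) / 2) (T - r))).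
      by rewrite !lt_min d0; apply/andP; split; lra.
    move=> h; rewrite !le_min => /andP[h1 /andP[+ +]].
    by rewrite !ler_norml => /andP[? ?] /andP[? ?]; apply: hd => //; lra.
  have decr a b : tau < a -> a <= b -> b < T -> `|x b| <= `|x a|.
    move=> ta ab bT; apply: le_of_sqr => //.
    have d1 r : a <= r <= b -> has_deriv (fun r => `|x r| ^+ 2 : R^o) r
        (2 * dot (A r (W r tau u) - A r (V r tau u)) (x r)).
      by move=> h; apply: (has_deriv_sqr_norm hH); apply: dx; lra.
    have := mean_le ab d1 (fun r _ => has_deriv_cst (0 : R^o) r).
    rewrite subrr subr_le0; apply => r h.
    have tr : 0 <= tau < r by rewrite tau0 /=; lra.
    have rT : r <= T by lra.
    have rr : 0 <= r <= T by lra.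
    have DW := evol_dom hW tr rT u; have DV := evol_dom hV tr rT u.
    rewrite -op_funB// pmulr_rle0//; apply: nA => //; exact: op_domB.
  (* Differentiability holds after [tau] only, so that the initial value is reached through strong
     continuity at [(tau, tau)]. *)
  have start e : 0 < e -> tau < T -> exists2 del, 0 < del & forall r,
      tau < r -> r < T -> r - tau < del -> `|x r| <= e.
    move=> e0 tauT.
    have near_tau Z : evolution_family T A Z -> exists2 del, 0 < del & forall r,
        tau < r -> r < T -> r - tau < del -> `|Z r tau u - u| <= e / 2.
      move=> hZ; have := @evol_strongly_continuous _ _ _ _ _ hZ u.
      move/subspace_continuousP => /(_ (tau, tau)) /= h.
      have {}h := h ltac:(by split => //; apply/andP; split; lra).
      move/cvgrPdist_le : h => /(_ (e / 2) ltac:(lra)) /near_within_pair[del d0 hd].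
      exists del => // r tr rT rd.
      have tt : 0 <= tau <= T by rewrite tau0 /=; lra.
      have := hd (r, tau) ltac:(by split => //=; apply/andP; split; lra) => /=.
      rewrite /from_subspace/= subrr normr0 (gtr0_norm (_ : 0 < r - tau)) ?subr_gt0//.
      by rewrite (evol_id hZ tt) distrC; apply.
    have [d1 d10 h1] := near_tau _ hW; have [d2 d20 h2] := near_tau _ hV.
    exists (Num.min d1 d2) => [|r tr rT]; first by rewrite lt_min d10.
    rewrite lt_min => /andP[/(h1 r tr rT) a /(h2 r tr rT) b].
    rewrite /x -(subrKA u) (le_trans (ler_normD _ _))// [`|u - _|]distrC; lra.
  have x0 b : tau < b -> b < T -> x b = 0.
    move=> tb bT; apply/eqP; rewrite -normr_le0; apply/ler_addgt0Pr => e e0.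
    rewrite add0r; have [del d0 hd] := start e e0 (lt_trans tb bT).
    pose a := Num.min b (tau + del / 2).
    have ta : tau < a by rewrite lt_min tb; lra.
    have ab : a <= b by rewrite ge_min lexx.
    have ad : a - tau < del.
      by have : a <= tau + del / 2; [rewrite ge_min lexx orbT|lra].
    by rewrite (le_trans (decr _ _ ta ab bT))// hd//; exact: le_lt_trans bT.
  apply/eqP; rewrite -subr_eq0 -/(x t).
  (* Strong continuity is given for times below [T] only; at [t = T] the one-sided derivative
     provides the continuity from the left. *)
  move: tT; rewrite le_eqVlt => /predU1P[tT|tT]; last by rewrite x0.
  rewrite -normr_le0; apply/ler_addgt0Pr => e e0; rewrite add0r.
  have near_T Z : evolution_family T A Z -> exists2 del, 0 < del & forall r,
      tau < r -> r < t -> t - r < del -> `|Z t tau u - Z r tau u| <= e / 2.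
    move=> hZ; have tT' : t <= T by rewrite tT.
    have [del d0 hd] := evolution_family_deriv hZ (t := t) (tau := tau)
      ltac:(by rewrite tau0) tT' u1 ltr01.
    set y := A t _ in hd; have y1 : 0 < 1 + `|y| by have := normr_ge0 y; lra.
    exists (Num.min del (e / 2 / (1 + `|y|))) => [|r tr rt].
      by rewrite lt_min d0 !divr_gt0.
    rewrite lt_min ltr_pdivlMr// => /andP[k1 k2].
    have rh : `|r - t| = t - r by rewrite distrC gtr0_norm ?subr_gt0.
    have := hd (r - t); rewrite rh [t + (r - t)]addrC subrK.
    move=> /(_ ltac:(lra) ltac:(lra)) hk.
    rewrite distrC -(subrK ((r - t) *: y) (Z r tau u - _)).
    rewrite (le_trans (ler_normD _ _))// normrZ rh; lra.
  have [d1 d10 h1] := near_T _ hW; have [d2 d20 h2] := near_T _ hV.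
  pose r := Num.max ((tau + t) / 2) (t - Num.min d1 d2 / 2).
  have mn : 0 < Num.min d1 d2 by rewrite lt_min d10.
  have r1 : tau < r by rewrite lt_max; apply/orP; left; lra.
  have r2 : r < t by rewrite gt_max; apply/andP; split; lra.
  have r3 : t - r < Num.min d1 d2.
    by have : t - Num.min d1 d2 / 2 <= r; [rewrite le_max lexx orbT|lra].
  move: r3; rewrite lt_min => /andP[/(h1 r r1 r2) a /(h2 r r1 r2) b].
  have := x0 r r1 ltac:(by rewrite -tT) => /eqP; rewrite subr_eq0 => /eqP e1.
  rewrite e1 in a; rewrite /x -(subrKA (V r tau u)) (le_trans (ler_normD _ _))//.
  by rewrite [`|V r tau u - _|]distrC; lra.
apply/funext => u; have [w w1 ->] := unit_scale u.
have tt : 0 <= tau <= t by rewrite tau0 ltW.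
have linZ Z : evolution_family T A Z ->
    Z t tau (`|u| *: w) = `|u| *: Z t tau w.
  move=> hZ; have [Zlin _] := evol_bounded hZ tt tT.
  have z0 : Z t tau 0 = 0.
    by have := Zlin (-1) 0 0; rewrite scaler0 addr0 scaleN1r addNr.
  by have := Zlin `|u| w 0; rewrite z0 !addr0.
by rewrite (linZ _ hV) (linZ _ hW) unit_eq.
Qed.

End uniqueness.


(** * Square-integrable classes form a Hilbert space *)

Lemma seq_lim_cvg (R : realType) (u : nat -> R) (l : R) :
  seq_lim (u : nat -> R^o) l -> u @ \oo --> l.
Proof.
move=> ul; apply/cvgrPdist_le => e e0; have [n hn] := ul e e0.
by exists n => // i /= /hn; rewrite distrC.
Qed.

(** Makes [geometric_lim] applicable to the pointwise values of a sequence of functions. *)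
Lemma real_hilbert (R : realType) :
  @hilbert_dot R R^o (fun u v : R^o => (u : R) * v).
Proof.
split => [u v|a u v w|u|u uC]; first exact: mulrC.
- by rewrite mulrDl mulrA.
- by rewrite -expr2 -real_normK// num_real.
have /cauchy_cvg/cvg_ex[/= l ul] : cauchy (u @ \oo).
  apply: cauchy_exP => e e0; have [n hn] := uC (e / 2) ltac:(lra).
  exists (u n), n => // i /= ni.
  rewrite -ball_normE/= (le_lt_trans (hn n i (leqnn _) ni))//; lra.
exists l => e e0; have /cvgrPdist_le/(_ e e0)[n _ hn] := ul.
by exists n => i ni; rewrite distrC; exact: (hn i ni).
Qed.

Section L2.
Context d (T : measurableType d) (R : realType).
Variable m : {measure set T -> \bar R}.
Local Notation L := (LspaceType2 m).
Local Notation cls := (@Lspace_of_Lfun _ T R m 2%:R%:E (lee1n 2)).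

Lemma L2_measurable (u : L) : measurable_fun setT (u : T -> R).
Proof. by have := LspaceP u; rewrite inE => /andP[/[!inE]]. Qed.

Lemma L2_integrable (u v : L) : m.-integrable setT (fun x => (u x * v x)%:E).
Proof.
have /Lfun1_integrable := Lfun2_mul_Lfun1 (LspaceP u) (LspaceP v).
exact.
Qed.

Lemma L2_lin (a : R) (u v : L) :
  {ae m, forall x, (a *: u + v : L) x = a * u x + v x}.
Proof.
have -> : a *: u + v = cls (a *: (Lfun_of_Lspace u) + Lfun_of_Lspace v).
  by rewrite -[v in LHS]Lfun_of_LspaceK -[u in LHS]Lfun_of_LspaceK
     [_ *: _]Lspace_scaleE [LHS]Lspace_addE.
have := Lspace_of_LfunK (a *: (Lfun_of_Lspace u) + Lfun_of_Lspace v).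
by apply: filterS => x /(_ I).
Qed.

Lemma L2_normE (u : L) : (\int[m]_x ((u x) ^+ 2)%:E)%E = (`|u| ^+ 2)%:E.
Proof.
have fu : 'N[m]_2[EFin \o u]%E \is a fin_num.
  rewrite ge0_fin_numE ?Lnorm_ge0//.
  by have := LspaceP u; rewrite inE => /andP[_ /[!inE]].
rewrite [`|u|](_ : _ = fine 'N[m]_2[EFin \o u]%E)//.
have := @poweR_Lnorm _ _ _ m (EFin \o u) 2 ltac:(by []).
rewrite -[in LHS](fineK fu) poweR_EFin powR_mulrn ?fine_ge0 ?Lnorm_ge0// => ->.
by apply: eq_integral => x _ /=; rewrite powR_mulrn// real_normK// num_real.
Qed.

Lemma L2_normB (u v : L) :
  (\int[m]_x ((u x - v x) ^+ 2)%:E)%E = (`|u - v| ^+ 2)%:E.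
Proof.
rewrite -L2_normE; apply: ae_eq_integral => //.
- apply/measurable_EFinP/measurable_funX/measurable_funB; exact: L2_measurable.
- apply/measurable_EFinP/measurable_funX; exact: L2_measurable.
- have := L2_lin (-1) v u; rewrite scaleN1r addrC; apply: filterS => x -> _.
  by rewrite mulN1r addrC.
Qed.

Lemma L2_of_fun (f : T -> R) (u : L) (K : R) : measurable_fun setT f ->
  (\int[m]_x ((f x - u x) ^+ 2)%:E <= K%:E)%E ->
  exists v : L, {ae m, forall x, v x = f x}.
Proof.
move=> mf fK; have mu := L2_measurable u.
have fuL : (f \- u) \in Lfun m 2%:E.
  apply/andP; split; rewrite inE/=; first exact: measurable_funB.
  rewrite /finite_norm unlock /Lnorm poweR_lty//.
  rewrite (le_lt_trans _ (ltry K))// (le_trans _ fK)//.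
  apply: ge0_le_integral => //=.
  - apply/measurable_EFinP; apply: (measurableT_comp (measurable_powR _)) => //.
    apply: measurableT_comp => //; exact: measurable_funB.
  - by apply/measurable_EFinP; apply: measurable_funX; exact: measurable_funB.
  - by move=> x _; rewrite powR_mulrn// real_normK// num_real.
have : f \in Lfun m 2%:E.
  have -> : f = (f \- u) \+ u by apply/funext => x /=; rewrite subrK.
  have [_] := Lfun_addr_closed m (lee1n 2 : (1 <= 2%:R%:E :> \bar R)%E).
  by apply; [exact: fuL|exact: LspaceP].
move=> fL; exists (cls (Lfun_Sub (lee1n 2) fL)).
have := Lspace_of_LfunK (Lfun_Sub (lee1n 2) fL).
by apply: filterS => x /(_ I).
Qed.


Lemma fatou_lim (h : nat -> T -> R) (f : T -> R) (K : \bar R) (n : nat) :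
  (forall i, measurable_fun setT (h i)) -> (forall i x, 0 <= h i x) ->
  (forall x, h ^~ x @ \oo --> f x) ->
  (forall i, (n <= i)%N -> (\int[m]_x (h i x)%:E <= K)%E) ->
  (\int[m]_x (f x)%:E <= K)%E.
Proof.
move=> mh h0 hf hK.
have -> : (\int[m]_x (f x)%:E = \int[m]_x limn_einf (fun i => (h i x)%:E))%E.
  apply: eq_integral => x _.
  suff /cvg_limn_einf_sup[-> _] : (fun i => (h i x)%:E) @ \oo --> (f x)%:E by [].
  by apply: cvg_EFin; [exact: nearW|exact: hf].
rewrite (le_trans (fatou m measurableT _ _))//.
- by move=> i; apply/measurable_EFinP.
- by move=> i x _; rewrite lee_fin.
rewrite limn_einf_lim; apply: lime_le; first exact: is_cvg_einfs.
exists n => // i /= ni; apply: le_trans (hK i ni).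
by apply: ereal_inf_lbound; exists i => /=.
Qed.

(** The terms of the weighted series [g] have integrals at most [4^-k], so that [g] is integrable.
    Where it is finite, [|D k| <= (g + 1) * 2^-k] and the values converge geometrically; Fatou's
    lemma turns this into convergence in norm. *)
Lemma L2_complete_fast (v : nat -> L) :
  (forall k j, (k <= j)%N -> `|v j - v k| <= 4^-1 ^+ k) ->
  exists l, forall k, `|l - v k| <= 4^-1 ^+ k.
Proof.
move=> vC; pose D k x := v k.+1 x - v k x.
have mD k : measurable_fun setT (D k) by apply: measurable_funB; exact: L2_measurable.
pose g x : \bar R := (\sum_(k <oo) (4 ^+ k * D k x ^+ 2)%:E)%E.
have mt k : measurable_fun setT (fun x => (4 ^+ k * D k x ^+ 2)%:E).
  by apply/measurable_EFinP; apply: measurable_funM => //; exact: measurable_funX.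
have t0 k x : (0 <= (4 ^+ k * D k x ^+ 2)%:E)%E.
  by rewrite lee_fin; apply: mulr_ge0; rewrite ?sqr_ge0// exprn_ge0.
have mg : measurable_fun setT g.
  apply: (@ge0_emeasurable_sum _ _ _ _ (fun k x => (4 ^+ k * D k x ^+ 2)%:E) xpredT).
    by move=> *; exact: t0.
  by [].
have gI : m.-integrable setT g.
  apply/integrableP; split => //.
  under eq_integral do rewrite gee0_abs ?nneseries_ge0//.
  rewrite integral_nneseries// (@le_lt_trans _ _ 2%:E)// ?ltry//.
  apply: lime_le; first by apply: is_cvg_nneseries => *; exact: integral_ge0.
  apply: nearW => n; rewrite (@le_trans _ _ (\sum_(0 <= k < n) (4^-1 ^+ k)%:E)%E)//.
    apply: lee_sum => k _.
    under eq_integral do rewrite EFinM.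
    have k0 : 0 <= 4 ^+ k :> R by rewrite exprn_ge0.
    rewrite ge0_integralZl_EFin//; last first.
    - by apply/measurable_EFinP; exact: measurable_funX.
    - by move=> x _; rewrite lee_fin sqr_ge0.
    rewrite L2_normB -EFinM lee_fin.
    have := vC k k.+1 (leqnSn k) => h.
    rewrite (@le_trans _ _ (4 ^+ k * (4^-1 ^+ k) ^+ 2))//.
      by rewrite ler_pM2l ?exprn_gt0// lerXn2r// ?nnegrE ?normr_ge0 ?exprn_ge0.
    by rewrite expr2 mulrA -exprMn mulfV// expr1n mul1r.
  rewrite sumEFin lee_fin.
  have : \sum_(0 <= k < n) 4^-1 ^+ k <= 2 - 2 * 2^-1 ^+ n :> R.
    elim: n => [|n IH]; first by rewrite big_nil; lra.
    rewrite big_nat_recr//= exprS.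
    have : 4^-1 ^+ n <= 2^-1 ^+ n :> R by rewrite lerXn2r// ?nnegrE; lra.
    lra.
  have : 0 <= 2^-1 ^+ n :> R by rewrite exprn_ge0.
  lra.
have [N [mN N0 gN]] := integrable_ae measurableT gI.
(* Set to 0 on the exceptional set, the functions converge everywhere, which makes the limit
   measurable. *)
pose f_ k := (v k : T -> R) \_ (~` N).
have mf_ k : measurable_fun setT (f_ k).
  apply/(measurable_restrictT _ (measurableC mN)).
  by apply: (measurable_funS measurableT) => //; exact: L2_measurable.
have f_E k x : ~ N x -> f_ k x = v k x.
  by move=> Nx; rewrite /f_ patchE mem_set.
have /choice[f hf] x : exists l : R, f_ ^~ x @ \oo --> l.
  have [Nx|Nx] := pselect (N x).
    exists 0; rewrite (_ : f_ ^~ x = cst 0); first exact: cvg_cst.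
    by apply/funext => k; rewrite /f_ patchE memNset// => /(_ Nx).
  have gx : g x \is a fin_num by apply: contrapT => gx; apply: Nx; apply: gN => /(_ I).
  have [|k|l ul _] := @geometric_lim _ _ _ (real_hilbert R) (f_ ^~ x) (fine (g x) + 1).
  - by rewrite addr_ge0 ?fine_ge0// nneseries_ge0.
  - rewrite !f_E//; apply: le_of_sqr.
      by rewrite mulr_ge0 ?exprn_ge0// addr_ge0 ?fine_ge0// nneseries_ge0.
    rewrite real_normK ?num_real//.
    have : ((4 ^+ k * D k x ^+ 2)%:E <= g x)%E.
      have := @nneseries_lim_ge R (fun k => (4 ^+ k * D k x ^+ 2)%:E) xpredT 0 k.+1 (fun k _ _ => t0 k x).
      by apply: le_trans; rewrite big_nat_recr//= leeDr// sume_ge0.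
    rewrite -(fineK gx) lee_fin -/(D k x).
    have : 0 <= fine (g x) by rewrite fine_ge0// nneseries_ge0.
    move: (fine (g x)) => r r0 h.
    rewrite exprMn -exprM mulnC exprM (_ : 2^-1 ^+ 2 = 4^-1); last by field.
    rewrite exprVn ler_pdivlMr ?exprn_gt0// mulrC (le_trans h)//; rewrite /=; nra.
  by exists l; exact: seq_lim_cvg.
have mf : measurable_fun setT f by apply: (@measurable_fun_cvg _ _ _ _ f_) => // x _; exact: hf.
have ffk k : (\int[m]_x ((f x - v k x) ^+ 2)%:E <= ((4^-1 ^+ k) ^+ 2)%:E)%E.
  have aeN : {ae m, forall x, ~ N x} by exists N; split => // x /= /contrapT.
  have -> : (\int[m]_x ((f x - v k x) ^+ 2)%:E = \int[m]_x ((f x - f_ k x) ^+ 2)%:E)%E.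
    apply: ae_eq_integral => //.
    - by apply/measurable_EFinP/measurable_funX/measurable_funB => //; exact: L2_measurable.
    - by apply/measurable_EFinP/measurable_funX/measurable_funB.
    - by apply: filterS aeN => x Nx _; rewrite f_E.
  apply: (@fatou_lim (fun j x => (f_ j x - f_ k x) ^+ 2) _ _ k).
  - by move=> i; apply/measurable_funX/measurable_funB.
  - by move=> i x; rewrite sqr_ge0.
  - by move=> x; under eq_fun do rewrite expr2; rewrite expr2; apply: cvgM;
      apply: cvgB => //; exact: cvg_cst.
  move=> j kj; have <- : (\int[m]_x ((v j x - v k x) ^+ 2)%:E =
      \int[m]_x ((f_ j x - f_ k x) ^+ 2)%:E)%E.
    apply: ae_eq_integral => //.
    - by apply/measurable_EFinP/measurable_funX/measurable_funB; exact: L2_measurable.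
    - by apply/measurable_EFinP/measurable_funX/measurable_funB.
    - by apply: filterS aeN => x Nx _; rewrite !f_E.
  by rewrite L2_normB lee_fin lerXn2r ?nnegrE ?exprn_ge0// vC.
have [l lf] := L2_of_fun mf (ffk 0%N); exists l => k.
apply: le_of_sqr; first by rewrite exprn_ge0.
rewrite -lee_fin -L2_normB; apply: le_trans (ffk k).
rewrite le_eqVlt; apply/orP; left; apply/eqP; apply: ae_eq_integral => //.
- by apply/measurable_EFinP/measurable_funX/measurable_funB; exact: L2_measurable.
- by apply/measurable_EFinP/measurable_funX/measurable_funB => //; exact: L2_measurable.
- by apply: filterS lf => x -> _.
Qed.

Lemma L2_complete (u : nat -> L) : seq_cauchy u -> exists l, seq_lim u l.
Proof.
move=> uC.
have /choice[n hn] k : exists n, forall i j, (n <= i)%N -> (n <= j)%N ->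
    `|u i - u j| <= 4^-1 ^+ k by apply: uC; rewrite exprn_gt0.
pose M k := (\max_(i < k.+1) n i)%N.
have nM k j : (k <= j)%N -> (n k <= M j)%N.
  by move=> kj; apply: (@leq_bigmax _ (fun i : 'I_j.+1 => n i) (Ordinal (kj : (k < j.+1)%N))).
have [|l hl] := @L2_complete_fast (fun k => u (M k)).
  by move=> k j kj; apply: hn; exact: nM.
exists l => e e0; have [k hk] := expr2V_small (e := e / 2) ltac:(lra).
exists (n k) => i ni; rewrite -(subrKA (u (M k))) (le_trans (ler_normD _ _))//.
have := hn k i (M k) ni (nM _ _ (leqnn k)); have := hl k; rewrite distrC.
have := hk k (leqnn k).
have : 4^-1 ^+ k <= 2^-1 ^+ k :> R by rewrite lerXn2r// ?nnegrE; lra.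
lra.
Qed.

Lemma L2_hilbert : hilbert_dot (@L2dot _ T R m).
Proof.
split => [u v|a u v w|u|]; last exact: L2_complete.
- by apply: eq_Rintegral => x _; rewrite mulrC.
- rewrite /L2dot -RintegralZl//; last exact: L2_integrable.
  rewrite -RintegralD//; last first.
  + exact: L2_integrable.
  + have := integrableZl measurableT a (L2_integrable u w).
    by apply: eq_integrable => // x _.
  rewrite /Rintegral; congr fine; apply: ae_eq_integral => //.
  + by apply/measurable_EFinP/measurable_funM; exact: L2_measurable.
  + apply/measurable_EFinP/measurable_funD.
      apply: measurable_funM => //; apply: measurable_funM; exact: L2_measurable.
    by apply: measurable_funM; exact: L2_measurable.
  + by have := L2_lin a u v; apply: filterS => x -> _; congr EFin; ring.
- have := L2_normE u; rewrite /L2dot /Rintegral.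
  by under eq_integral do rewrite expr2; move=> ->.
Qed.
End L2.

(* [p], [q], [a], [b] stand for [E(t,u,u)], [E(s,v,v)], [E(t,u,v)], [E(s,v,u)]. *)
Definition form_close (R : realType) (C : R) (p q a b : \bar R) : Prop :=
  [/\ (0 <= p)%E, (0 <= q)%E & ((p < +oo)%E -> (q < +oo)%E ->
    [/\ a \is a fin_num, b \is a fin_num &
        `|fine a - fine b| <= C * (fine p + fine q)])].

(** * Weighted quadratic integrals with nearby weights *)

Section form_close.
Context {R : realType}.
Implicit Types (C : R) (p q a b : \bar R).

Lemma form_closeD C p q a b p' q' a' b' :
  form_close C p q a b -> form_close C p' q' a' b' ->
  form_close C (p + p')%E (q + q')%E (a + a')%E (b + b')%E.
Proof.
move=> [p0 q0 h] [p0' q0' h']; split; rewrite ?adde_ge0// => poo qoo.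
have p1 : (p < +oo)%E by apply: le_lt_trans poo; rewrite leeDl.
have p1' : (p' < +oo)%E by apply: le_lt_trans poo; rewrite leeDr.
have q1 : (q < +oo)%E by apply: le_lt_trans qoo; rewrite leeDl.
have q1' : (q' < +oo)%E by apply: le_lt_trans qoo; rewrite leeDr.
have [fa fb A] := h p1 q1; have [fa' fb' B] := h' p1' q1'.
rewrite !fin_numD fa fb fa' fb'; split => //.
rewrite (fineD fa fa') (fineD fb fb') (fineD (x := p)) ?(fineD (x := q)) ?ge0_fin_numE//.
by rewrite opprD addrACA (le_trans (ler_normD _ _))//; lra.
Qed.

Lemma form_closeZ C c p q a b : 0 <= c -> form_close C p q a b ->
  form_close C (c%:E * p)%E (c%:E * q)%E (c%:E * a)%E (c%:E * b)%E.
Proof.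
rewrite le_eqVlt => /orP[/eqP <- _|c0 [p0 q0 h]].
  by rewrite !mul0e; split => // _ _; split => //=; rewrite subrr normr0 addr0 mulr0.
have c0' : (0 <= c%:E)%E by rewrite lee_fin ltW.
split=> [||poo qoo]; rewrite ?mule_ge0//.
have fin x : (0 <= x)%E -> (c%:E * x < +oo)%E -> (x < +oo)%E.
  by case: x => [x||]//; rewrite ?ltry// gt0_muley ?lte_fin.
have [fa fb A] := h (fin _ p0 poo) (fin _ q0 qoo).
have fp : p \is a fin_num by rewrite ge0_fin_numE// fin.
have fq : q \is a fin_num by rewrite ge0_fin_numE// fin.
rewrite !fin_numM// !fineM//=; split => //.
rewrite -mulrBr normrM gtr0_norm// -mulrDr mulrCA.
by rewrite ler_pM2l.
Qed.

Lemma form_close_le C C' p q a b : C <= C' ->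
  form_close C p q a b -> form_close C' p q a b.
Proof.
move=> CC [p0 q0 h]; split => // poo qoo; have [fa fb A] := h poo qoo.
split=> //; rewrite (le_trans A)// ler_wpM2r// addr_ge0// fine_ge0//.
Qed.

(** The lower bound [kap] turns the absolute error [del] into a relative one, after which
    [2 |f g| <= f^2 + g^2] suffices. The last two bounds are there to make the mixed terms
    integrable. *)
Lemma weighted_amgm (k1 k2 f g i kap del : R) : 0 < kap -> 0 <= del ->
  kap <= k1 -> kap <= k2 -> `|k1 - k2| <= del -> 0 <= i ->
  let S := k1 * (f * f) * i + k2 * (g * g) * i in
  [/\ `|k1 * (f * g) * i - k2 * (g * f) * i| <= del / kap / 2 * S,
      `|k1 * (f * g) * i| <= (2 + del / kap) * S &
      `|k2 * (g * f) * i| <= (2 + del / kap) * S].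
Proof.
move=> kap0 del0 h1 h2 h3 i0 S.
have [e e0 de] : exists2 e, 0 <= e & del = e * kap.
  by exists (del / kap); rewrite ?divr_ge0 ?(ltW kap0)// divfK// gt_eqF.
rewrite /S de mulfK ?gt_eqF// {S}; rewrite de in h3.
set P := f * f * i; set Q := g * g * i; set W := `|f * g * i|.
have P0 : 0 <= P by rewrite mulr_ge0// -expr2 sqr_ge0.
have Q0 : 0 <= Q by rewrite mulr_ge0// -expr2 sqr_ge0.
have W0 : 0 <= W by exact: normr_ge0.
have WPQ : 2 * W <= P + Q.
  rewrite /W normrM (ger0_norm i0) /P /Q -mulrDl mulrA ler_wpM2r// normrM.
  rewrite -[f * f]expr2 -[g * g]expr2 -[f ^+ 2]real_normK ?num_real//.
  rewrite -[g ^+ 2]real_normK ?num_real//.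
  by have := sqr_ge0 (`|f| - `|g|); lra.
have -> : k1 * (f * g) * i - k2 * (g * f) * i = (k1 - k2) * (f * g * i) by ring.
have -> : k1 * (f * g) * i = k1 * (f * g * i) by ring.
have -> : k2 * (g * f) * i = k2 * (f * g * i) by ring.
have -> : k1 * (f * f) * i = k1 * P by rewrite /P; ring.
have -> : k2 * (g * g) * i = k2 * Q by rewrite /Q; ring.
have k10 : 0 <= k1 by lra.
have k20 : 0 <= k2 by lra.
rewrite !(normrM _ (f * g * i)) -/W (ger0_norm k10) (ger0_norm k20).
move: h3; rewrite ler_distl => /andP[h4 h5].
have c1 := ler_wpM2r P0 h1; have c2 := ler_wpM2r Q0 h2.
have c3 := ler_wpM2l e0 c1; have c4 := ler_wpM2l e0 c2.
have c5 : k1 * Q <= (k2 + e * kap) * Q by rewrite ler_wpM2r.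
have c6 : k2 * P <= (k1 + e * kap) * P by rewrite ler_wpM2r//; lra.
have c7 : 0 <= kap * P by rewrite mulr_ge0// ltW.
have c8 : 0 <= kap * Q by rewrite mulr_ge0// ltW.
have c9 := mulr_ge0 e0 c7; have c10 := mulr_ge0 e0 c8.
split.
- have A : `|k1 - k2| * W <= e * kap * W by rewrite ler_wpM2r// ler_distl h4 h5.
  have := ler_wpM2l (mulr_ge0 e0 (ltW kap0)) WPQ; lra.
- have := ler_wpM2l k10 WPQ; lra.
- have := ler_wpM2l k20 WPQ; lra.
Qed.

End form_close.

Section weighted.
Import HBNNSimple.
Context d (X : measurableType d) (R : realType) (nu : {measure set X -> \bar R}).

(** Valid without measurability, because the integral is a supremum over simple functions below [f]:
    cutting one of them off on [N] keeps its integral and puts it below [g]. *)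
Lemma ge0_le_integral_null (f g : X -> \bar R) (N : set X) :
  measurable N -> nu N = 0%E ->
  (forall x, 0 <= f x)%E -> (forall x, 0 <= g x)%E ->
  (forall x, ~ N x -> f x = g x) -> (\int[nu]_x f x <= \int[nu]_x g x)%E.
Proof.
move=> mN N0 f0 g0 fg; rewrite ge0_integralTE//.
apply: ge_ereal_sup => _ [h hf <-].
pose h' := mul_nnsfun h (indic_nnsfun R (measurableC mN)).
have -> : sintegral nu h = sintegral nu h'.
  rewrite -!integralT_nnsfun; apply: ae_eq_integral => //.
  - by apply/measurable_EFinP; exact: measurable_funPT.
  - by apply/measurable_EFinP; exact: measurable_funPT.
  exists N; split => // x /= /not_implyP[_]; apply: contra_notP => Nx.
  by rewrite mindicE mem_set// mulr1.
rewrite ge0_integralTE//; apply: ereal_sup_ubound; exists h' => //= x.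
rewrite /h' /= mindicE; case: (boolP (x \in ~` N)) => [/set_mem Nx|_].
  by rewrite mulr1 -fg.
by rewrite mulr0.
Qed.

(* Used to replace the trace of [u], whose measurability is unclear, by [u]. *)
Lemma integral_null (f g : X -> \bar R) (N D : set X) :
  measurable N -> nu N = 0%E -> (forall x, D x -> ~ N x -> f x = g x) ->
  (\int[nu]_(x in D) f x = \int[nu]_(x in D `\` N) g x)%E.
Proof.
move=> mN N0 fg; rewrite integral_mkcond [RHS]integral_mkcond.
set u := f \_ D; set w := g \_ _.
have {}fg x : ~ N x -> u x = w x.
  move=> Nx; rewrite /u /w !patchE; case: ifPn => [/set_mem Dx|Dx].
    by rewrite mem_set// fg.
  by rewrite memNset// => -[Dx' _]; move: Dx; rewrite mem_set.
rewrite integralE [RHS]integralE; congr (_ - _)%E; apply/eqP; rewrite eq_le;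
  apply/andP; split; apply: (ge0_le_integral_null mN N0) => // x Nx;
  by rewrite unlock fg.
Qed.

Lemma weighted_form_close (D : set X) (k1 k2 F G r : X -> R) (kap del : R) :
  measurable D -> measurable_fun D k1 -> measurable_fun D k2 ->
  measurable_fun D F -> measurable_fun D G -> measurable_fun D r ->
  0 < kap -> 0 <= del ->
  (forall x, D x -> [/\ kap <= k1 x, kap <= k2 x, `|k1 x - k2 x| <= del & 0 <= r x]) ->
  form_close (del / kap / 2)
    (\int[nu]_(x in D) (k1 x * (F x * F x) / r x)%:E)
    (\int[nu]_(x in D) (k2 x * (G x * G x) / r x)%:E)
    (\int[nu]_(x in D) (k1 x * (F x * G x) / r x)%:E)
    (\int[nu]_(x in D) (k2 x * (G x * F x) / r x)%:E).
Proof.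
move=> mD mk1 mk2 mF mG mr kap0 del0 h.
have mI (k A B : X -> R) : measurable_fun D k -> measurable_fun D A -> measurable_fun D B ->
    measurable_fun D (fun x => k x * (A x * B x) / r x).
  move=> mk mA mB; apply: measurable_funM.
    by apply: measurable_funM => //; exact: measurable_funM.
  (* Where [r] is nonnegative its inverse is a real power, and real powers are measurable. *)
  apply: (@eq_measurable_fun _ _ _ _ D (fun x => r x `^ (-1))).
    by move=> x /set_mem/h[_ _ _ rx]; rewrite powR_inv1.
  exact: (measurableT_comp (measurable_powR _)).
have p0 x : D x -> 0 <= k1 x * (F x * F x) / r x.
  move=> /h[a _ _ b]; rewrite divr_ge0// mulr_ge0 -?expr2 ?sqr_ge0//; lra.
have q0 x : D x -> 0 <= k2 x * (G x * G x) / r x.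
  move=> /h[_ a _ b]; rewrite divr_ge0// mulr_ge0 -?expr2 ?sqr_ge0//; lra.
split; try by apply: integral_ge0 => x Dx; rewrite lee_fin ?p0 ?q0.
move=> poo qoo.
pose p x := k1 x * (F x * F x) / r x; pose q x := k2 x * (G x * G x) / r x.
pose a x := k1 x * (F x * G x) / r x; pose b x := k2 x * (G x * F x) / r x.
have nnI (f : X -> R) : measurable_fun D f -> (forall x, D x -> 0 <= f x) ->
    (\int[nu]_(x in D) (f x)%:E < +oo)%E -> nu.-integrable D (fun x => (f x)%:E).
  move=> mf f0 foo; apply/integrableP; split; first exact/measurable_EFinP.
  rewrite (_ : (\int[nu]_(x in D) `|(f x)%:E| = \int[nu]_(x in D) (f x)%:E)%E)//.
  by apply: eq_integral => x /set_mem/f0 fx; rewrite /= ger0_norm.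
have ip : nu.-integrable D (EFin \o p) by apply: nnI => //; exact: mI.
have iq : nu.-integrable D (EFin \o q) by apply: nnI => //; exact: mI.
have ipq : nu.-integrable D (EFin \o (fun x => p x + q x)).
  by have := integrableD mD ip iq; apply: eq_integrable => // x _.
have iS c : nu.-integrable D (EFin \o (fun x => c * (p x + q x))).
  by have := integrableZl mD c ipq; apply: eq_integrable => // x _.
have dom x : D x -> [/\ `|a x - b x| <= del / kap / 2 * (p x + q x),
    `|a x| <= (2 + del / kap) * (p x + q x) &
    `|b x| <= (2 + del / kap) * (p x + q x)].
  by move=> /h[h1 h2 h3 r0]; apply: weighted_amgm; rewrite // invr_ge0.
have S0 x : D x -> 0 <= (2 + del / kap) * (p x + q x).
  move=> Dx; apply: mulr_ge0; last by rewrite addr_ge0// ?p0 ?q0.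
  by rewrite addr_ge0// divr_ge0// ltW.
have ia : nu.-integrable D (EFin \o a).
  apply: (le_integrable mD _ _ (iS (2 + del / kap))).
    by apply/measurable_EFinP; exact: mI.
  by move=> x Dx /=; rewrite lee_fin [leRHS]ger0_norm ?S0//; have [] := dom x Dx.
have ib : nu.-integrable D (EFin \o b).
  apply: (le_integrable mD _ _ (iS (2 + del / kap))).
    by apply/measurable_EFinP; exact: mI.
  by move=> x Dx /=; rewrite lee_fin [leRHS]ger0_norm ?S0//; have [] := dom x Dx.
split; [exact: integrable_fin_num ia|exact: integrable_fin_num ib|].
rewrite -!/(Rintegral _ _ _) -RintegralB// -RintegralD// -RintegralZl//.
rewrite (le_trans (le_normr_Rintegral _ _))//.
  by have := integrableB mD ia ib; apply: eq_integrable => // x _.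
apply: le_Rintegral => //.
have := integrable_abse (integrableB mD ia ib).
by apply: eq_integrable => // x _.
by move=> x /dom[].
Qed.

(** [F] and [G] will come from traces, and [F0], [G0] are measurable functions equal to them almost
    everywhere. All exceptional sets are collected in one null set, which is removed from [D]. *)
Lemma ae_weighted_form_close (D : set X) (k1 k2 F F0 G G0 r : X -> R)
    (kap del : R) :
  measurable D -> measurable_fun D k1 -> measurable_fun D k2 ->
  measurable_fun D F0 -> measurable_fun D G0 -> measurable_fun D r ->
  0 < kap -> 0 <= del ->
  {ae nu, forall x, D x -> kap <= k1 x} -> {ae nu, forall x, D x -> kap <= k2 x} ->
  {ae nu, forall x, D x -> `|k1 x - k2 x| <= del} -> (forall x, D x -> 0 <= r x) ->
  {ae nu, forall x, D x -> F x = F0 x} -> {ae nu, forall x, D x -> G x = G0 x} ->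
  form_close (del / kap / 2)
    (\int[nu]_(x in D) (k1 x * (F x * F x) / r x)%:E)
    (\int[nu]_(x in D) (k2 x * (G x * G x) / r x)%:E)
    (\int[nu]_(x in D) (k1 x * (F x * G x) / r x)%:E)
    (\int[nu]_(x in D) (k2 x * (G x * F x) / r x)%:E).
Proof.
move=> mD mk1 mk2 mF mG mr kap0 del0 h1 h2 h12 r0 FF GG.
have : {ae nu, forall x, D x -> [/\ kap <= k1 x, kap <= k2 x,
    `|k1 x - k2 x| <= del, F x = F0 x & G x = G0 x]}.
  near=> x => Dx; split; move: Dx; near: x => //.
move=> [N [mN N0 hN]].
have {}hN x : D x -> ~ N x -> [/\ kap <= k1 x, kap <= k2 x,
    `|k1 x - k2 x| <= del, F x = F0 x & G x = G0 x].
  by move=> Dx Nx; apply: contrapT => h; apply/Nx/hN => /(_ Dx).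
have E k (A B A0 B0 : X -> R) :
    (forall x, D x -> ~ N x -> A x = A0 x /\ B x = B0 x) ->
    (\int[nu]_(x in D) (k x * (A x * B x) / r x)%:E =
     \int[nu]_(x in D `\` N) (k x * (A0 x * B0 x) / r x)%:E)%E.
  by move=> AB; apply: integral_null => // x Dx Nx; have [-> ->] := AB x Dx Nx.
rewrite (E k1 F F F0 F0) ?(E k2 G G G0 G0) ?(E k1 F G F0 G0) ?(E k2 G F G0 F0);
  try by move=> x Dx Nx; have [] := hN x Dx Nx.
have mDN : measurable (D `\` N) by exact: measurableD.
have sDN f : measurable_fun D f -> measurable_fun (D `\` N) f.
  by apply: measurable_funS.
apply: weighted_form_close; try exact: sDN; rewrite // => x [Dx Nx].
by have [] := hN x Dx Nx; split => //; exact: r0.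
Unshelve. all: by end_near. Qed.

End weighted.

(** * Null sets of product measures and their slices *)

Section slices.
Context d1 d2 (X : measurableType d1) (Y : measurableType d2) (R : realType).
Variable m1 : {measure set X -> \bar R}.
Variable m2 : {sigma_finite_measure set Y -> \bar R}.

Lemma product_null (A : set (X * Y)) : measurable A ->
  (m1 \x m2)%E A = 0%E <-> {ae m1, forall x, m2 (xsection A x) = 0%E}.
Proof.
move=> mA; have mf := measurable_fun_xsection m2 mA.
have E : (m1 \x m2)%E A = (\int[m1]_x `|m2 (xsection A x)|)%E.
  by apply: eq_integral => x _; rewrite gee0_abs.
rewrite E (ae_eq_integral_abs m1 measurableT mf).
by split; apply: filterS => x; [move=> /(_ I)|move=> ? _].
Qed.

Lemma ae_fst (P : X -> Prop) :
  {ae m1, forall x, P x} -> {ae (m1 \x m2)%E, forall z, P z.1}.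
Proof.
move=> [N [mN N0 hN]]; exists (N `*` setT); split; first exact: measurableX.
  apply/product_null; first exact: measurableX.
  exists N; split => // x /=; apply: contra_notP => Nx.
  by rewrite (_ : xsection _ _ = set0) ?measure0// -subset0 /xsection => y /=; rewrite inE => -[].
by move=> z /hN.
Qed.

Lemma ae_snd (P : Y -> Prop) :
  {ae m2, forall y, P y} -> {ae (m1 \x m2)%E, forall z, P z.2}.
Proof.
move=> [N [mN N0 hN]]; exists (setT `*` N); split; first exact: measurableX.
  apply/product_null; first exact: measurableX.
  apply: filterE => x; rewrite (_ : xsection _ _ = N)//.
  by apply/seteqP; split => y; rewrite /xsection /= inE//= => -[].
by move=> z /hN.
Qed.

Lemma ae_xsection (P : X * Y -> Prop) : {ae (m1 \x m2)%E, forall z, P z} ->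
  {ae m1, forall x, {ae m2, forall y, P (x, y)}}.
Proof.
move=> [N [mN N0 hN]]; have /product_null := N0 => /(_ mN).
apply: filterS => x Nx; exists (xsection N x); split => //.
  exact: measurable_xsection.
by move=> y Py; rewrite /xsection/= inE; exact: hN.
Qed.

End slices.

(** The product is nested to the left, while at a fixed time the forms integrate over pairs of
    points; repeated use of [product_null] regroups the last two factors. *)
Lemma ae_slice d1 d2 (X : measurableType d1) (Y : measurableType d2)
    (R : realType) (m1 : {measure set X -> \bar R})
    (m2 : {sigma_finite_measure set Y -> \bar R}) (P : X * Y * Y -> Prop) :
  {ae ((m1 \x m2) \x m2)%E, forall z, P z} ->
  {ae m1, forall x, {ae (m2 \x m2)%E, forall z, P (x, z.1, z.2)}}.
Proof.
move=> [N [mN N0 hN]]; have /product_null := N0 => /(_ mN)/ae_xsection.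
pose g x (z : Y * Y) : X * Y * Y := (x, z.1, z.2).
have mg x : measurable_fun setT (g x).
  apply: measurable_fun_pair => //; apply: measurable_fun_pair => //.
apply: filterS => x Nx; exists (g x @^-1` N); split => [||z Pz]; last exact: hN.
  by rewrite -[X in measurable X]setTI; exact: mg.
apply/product_null; first by rewrite -[X in measurable X]setTI; exact: mg.
by apply: filterS Nx => y; rewrite /xsection/=.
Qed.

Section time_slices.
Context {R : realType}.
Local Notation leb := (@lebesgue_measure R).

Lemma ae_itv_witness (P : R -> Prop) (a b : R) : {ae leb, forall t, P t} ->
  a < b -> exists2 t, a <= t <= b & P t.
Proof.
move=> [N [mN N0 hN]] ab; apply: contrapT => h.
have : (leb `[a, b]%classic <= leb N)%E.
  apply: le_measure; rewrite ?inE// => t; rewrite /= in_itv/= => tab.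
  by apply: hN => Pt; apply: h; exists t.
rewrite [leb N]N0 lebesgue_measure_itv/= lte_fin ab -EFinD lee_fin; lra.
Qed.

(* Bounds holding at almost all times hold, up to a factor, at all times by
   the Hoelder continuity. *)
Lemma ae_lower_bound d (Z : measurableType d) (nu : {measure set Z -> \bar R})
    (k : R -> Z -> R) (D : set Z) (T eta kap c : R) :
  0 < T -> 0 < eta -> 0 < kap ->
  {ae leb, forall tau, {ae nu, forall z, 0 <= tau <= T -> D z -> kap <= k tau z}} ->
  (forall t tau, 0 <= t <= T -> 0 <= tau <= T ->
    {ae nu, forall z, D z -> `|k t z - k tau z| <= c * `|t - tau| `^ eta}) ->
  forall t, 0 <= t <= T -> {ae nu, forall z, D z -> kap / 2 <= k t z}.
Proof.
move=> T0 eta0 kap0 hk hol t /andP[t0 tT].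
have c1 : 0 < `|c| + 1 by have := normr_ge0 c; lra.
have [del del0 hdel] := powR_small eta0 (e := kap / 2 / (`|c| + 1))
  ltac:(by rewrite !divr_gt0).
(* A time [tau] at which the bound holds is taken in [[0, T]] within [del] of [t]; moving from it to
   [t] costs at most [kap / 2]. *)
have [] := ae_itv_witness (a := Num.max 0 (t - del)) (b := Num.min T (t + del)) hk.
  by rewrite lt_min !gt_max; apply/andP; split; apply/andP; split; lra.
move=> tau; rewrite ge_max le_min => /andP[/andP[a1 a2] /andP[b1 b2]] ktau.
have tau0T : 0 <= tau <= T by rewrite a1.
have := hol t tau; rewrite t0 tT => /(_ isT tau0T) ht.
apply: filterS2 ktau ht => z /(_ tau0T) h1 h2 Dz; move: (h1 Dz) (h2 Dz).
have := hdel `|t - tau| (normr_ge0 _) _.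
rewrite ler_norml ler_pdivlMr// => /(_ _)/wrap[]; first lra.
have : c * `|t - tau| `^ eta <= `|t - tau| `^ eta * (`|c| + 1).
  rewrite mulrC ler_wpM2l ?powR_ge0//; have := ler_norm c; lra.
rewrite ler_norml => A B C /andP[E _]; lra.
Qed.

End time_slices.

(** * Comparison of the energies at two times *)

Section energy_close.
Context {R : realType} {N : nat}.
Local Notation E := 'rV[R]_N.

Lemma measurable_rV_coord (i : 'I_N) : measurable_fun setT (fun v : E => v ord0 i).
Proof.
rewrite (_ : (fun v : E => _) = (@tnth N R ^~ i) \o @tuple_of_row R N).
  apply: measurableT_comp; first exact: measurable_tnth.
  exact: measurable_tuple_of_row.
by apply/funext => v /=; rewrite tnth_mktuple.
Qed.

Lemma measurable_eucl_dist (e : R) :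
  measurable_fun setT (fun z : E * E => eucl_dist z.1 z.2 `^ e).
Proof.
apply: (measurableT_comp (measurable_powR _)).
rewrite (_ : (fun z : E * E => _) = fun z =>
    (\sum_i (z.1 ord0 i - z.2 ord0 i) ^+ 2) `^ 2^-1).
  apply: (measurableT_comp (measurable_powR _)); apply: measurable_sum => i.
  apply: measurable_funX; apply: measurable_funB.
    by apply: measurableT_comp (measurable_rV_coord i) _.
  by apply: measurableT_comp (measurable_rV_coord i) _.
apply/funext => z; rewrite powR12_sqrt; last by apply: sumr_ge0 => i _; exact: sqr_ge0.
by congr Num.sqrt; apply: eq_bigr => i _; rewrite !mxE expr2.
Qed.

Variables (D : set E) (nu : {sigma_finite_measure set E -> \bar R}).
Variables (T eta : R).
Hypotheses (mD : measurable D) (T0 : 0 < T) (eta0 : 0 < eta).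

Lemma measurable_slice d2 (Y : measurableType d2) (B : set Y)
    (f : R * Y -> R) t : measurable B -> 0 <= t <= T ->
  measurable_fun (`[0, T] `*` B) f -> measurable_fun B (fun y => f (t, y)).
Proof.
move=> mB tT mf; apply: (measurable_comp _ _ mf) => //.
- by apply: measurableX.
- by move=> _ [y By <-]; split => //=; rewrite in_itv.
- by apply: measurable_funTS; exact: measurable_fun_pair.
Qed.

(** The lower bound [k1] is known at almost every time only; [ae_lower_bound] replaces it by
    [k1 / 2] at every time, and the constant is [|c| / (k1 / 2) / 2]. *)
Lemma kernel_form_close (k : R -> E -> E -> R) (k1 k2 c e : R)
    (F F0 G G0 : E * E -> R) t s :
  admissible_kernel T eta k1 k2 c D nu k -> 0 < k1 ->
  0 <= t <= T -> 0 <= s <= T ->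
  measurable_fun (D `*` D) F0 -> measurable_fun (D `*` D) G0 ->
  {ae (nu \x nu)%E, forall z, (D `*` D) z -> F z = F0 z} ->
  {ae (nu \x nu)%E, forall z, (D `*` D) z -> G z = G0 z} ->
  form_close (`|c| / k1 * `|t - s| `^ eta)
    (\int[nu \x nu]_(z in D `*` D)
      (k t z.1 z.2 * (F z * F z) / eucl_dist z.1 z.2 `^ e)%:E)%E
    (\int[nu \x nu]_(z in D `*` D)
      (k s z.1 z.2 * (G z * G z) / eucl_dist z.1 z.2 `^ e)%:E)%E
    (\int[nu \x nu]_(z in D `*` D)
      (k t z.1 z.2 * (F z * G z) / eucl_dist z.1 z.2 `^ e)%:E)%E
    (\int[nu \x nu]_(z in D `*` D)
      (k s z.1 z.2 * (G z * F z) / eucl_dist z.1 z.2 `^ e)%:E)%E.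
Proof.
move=> [mk _ hk hol] k10 tT sT mF mG FF GG.
have mDD : measurable (D `*` D) by exact: measurableX.
have hol' r tau : 0 <= r <= T -> 0 <= tau <= T -> {ae (nu \x nu)%E, forall z,
    (D `*` D) z -> `|k r z.1 z.2 - k tau z.1 z.2| <= c * `|r - tau| `^ eta}.
  by move=> rT tauT; apply: hol; rewrite in_itv.
have lb : forall r, 0 <= r <= T ->
    {ae (nu \x nu)%E, forall z, (D `*` D) z -> k1 / 2 <= k r z.1 z.2}.
  apply: (ae_lower_bound (k := fun r z => k r z.1 z.2) T0 eta0 k10 _ hol').
  have := ae_slice hk; apply: filterS => tau; apply: filterS => z h tauT [D1 D2].
  have tauI : `[0, T]%classic tau by rewrite /= in_itv.
  by have /andP[] := h (conj (conj tauI D1) D2).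
have mks r : 0 <= r <= T -> measurable_fun (D `*` D) (fun z => k r z.1 z.2).
  move=> rT; apply: (measurable_comp _ _ mk (g := fun z : E * E => (r, z.1, z.2))).
  - by apply: measurableX => //; apply: measurableX.
  - by move=> _ [z [D1 D2] <-]; split => //; split => //=; rewrite in_itv.
  - apply: measurable_funTS; apply: measurable_fun_pair => //.
    by apply: measurable_fun_pair.
have -> : `|c| / k1 * `|t - s| `^ eta = `|c| * `|t - s| `^ eta / (k1 / 2) / 2.
  by field; rewrite gt_eqF.
apply: (ae_weighted_form_close (F0 := F0) (G0 := G0)
  (k1 := fun z => k t z.1 z.2) (k2 := fun z => k s z.1 z.2)) => //.
- exact: mks.
- exact: mks.
- by apply: measurable_funTS; exact: measurable_eucl_dist.
- by rewrite divr_gt0.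
- exact: lb.
- exact: lb.
- apply: filterS (hol' t s tT sT) => z h /h{}h; rewrite (le_trans h)//.
  by rewrite ler_wpM2r ?powR_ge0// ler_norm.
- by move=> z _; exact: powR_ge0.
Qed.

Lemma coeff_form_close (b : R -> E -> R) (b0 c : R) (F F0 G G0 : E -> R) t s :
  admissible_coeff T eta b0 c D nu b -> 0 < b0 ->
  0 <= t <= T -> 0 <= s <= T ->
  measurable_fun D F0 -> measurable_fun D G0 ->
  {ae nu, forall z, D z -> F z = F0 z} ->
  {ae nu, forall z, D z -> G z = G0 z} ->
  form_close (`|c| / b0 * `|t - s| `^ eta)
    (\int[nu]_(z in D) (b t z * F z * F z)%:E)
    (\int[nu]_(z in D) (b s z * G z * G z)%:E)
    (\int[nu]_(z in D) (b t z * F z * G z)%:E)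
    (\int[nu]_(z in D) (b s z * G z * F z)%:E).
Proof.
move=> [mb _ [b1 b01 hb] hol] b00 tT sT mF mG FF GG.
have hol' r tau : 0 <= r <= T -> 0 <= tau <= T -> {ae nu, forall z,
    D z -> `|b r z - b tau z| <= c * `|r - tau| `^ eta}.
  by move=> rT tauT; apply: hol; rewrite in_itv.
have lb : forall r, 0 <= r <= T -> {ae nu, forall z, D z -> b0 / 2 <= b r z}.
  apply: (ae_lower_bound (k := b) T0 eta0 b00 _ hol').
  have := ae_xsection hb; apply: filterS => tau; apply: filterS => z h tauT Dz.
  have tauI : `[0, T]%classic tau by rewrite /= in_itv.
  by rewrite (le_trans (ltW b01))//; exact: (h (conj tauI Dz)).
(* The boundary term takes the shape of a kernel term with denominator 1. *)
have I k (A B : E -> R) : (\int[nu]_(z in D) (k z * A z * B z)%:E =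
    \int[nu]_(z in D) (k z * (A z * B z) / 1)%:E)%E.
  by apply: eq_integral => z _; rewrite divr1 mulrA.
have -> : `|c| / b0 * `|t - s| `^ eta = `|c| * `|t - s| `^ eta / (b0 / 2) / 2.
  by field; rewrite gt_eqF.
rewrite (I (b t) F F) (I (b s) G G) (I (b t) F G) (I (b s) G F).
apply: (ae_weighted_form_close (F0 := F0) (G0 := G0)
  (k1 := b t) (k2 := b s) (r := fun=> 1)) => //.
- exact: (measurable_slice mD tT mb).
- exact: (measurable_slice mD sT mb).
- by rewrite divr_gt0.
- exact: lb.
- exact: lb.
- apply: filterS (hol' t s tT sT) => z h /h{}h; rewrite (le_trans h)//.
  by rewrite ler_wpM2r ?powR_ge0// ler_norm.
Qed.

End energy_close.

(** Membership in [Hs_L2] makes the averages converge to [u x]. In the integrals the trace can then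
    be exchanged for the measurable function [u]. *)
Lemma trace_Hs (R : realType) (N : nat) (s : R) (A : set 'rV[R]_N) (oA : open A)
    (mu : {measure set 'rV[R]_N -> \bar R}) (u : L2_domain_boundary oA mu) :
  Hs_L2 s oA mu u ->
  {ae mu, forall x, boundary A x ->
    trace A (u : LspaceType2 (domain_boundary_measure oA mu)) x =
    (u : LspaceType2 (domain_boundary_measure oA mu)) x}.
Proof.
move=> [_]; apply: filterS => x h /h; rewrite /trace => /cvg_lim; apply.
exact: norm_hausdorff.
Qed.

Lemma frac_const_ge0 (R : realType) (N : nat) (s : R) : 0 <= s ->
  0 <= frac_const N s.
Proof.
move=> s0; have G0 (z : R) : 0 <= Gamma z.
  by apply: Rintegral_ge0 => x _; rewrite mulr_ge0 ?powR_ge0 ?expR_ge0.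
by rewrite /frac_const divr_ge0// ?mulr_ge0// powR_ge0.
Qed.

(** Each of the three terms comes with its own constant; all are enlarged to their sum, as
    [form_closeD] asks for a common one. *)
Lemma energy_form_close (R : realType) (N : nat) (Omega : set 'rV[R]_N)
    (oO : open Omega) (mu : {sigma_finite_measure set 'rV[R]_N -> \bar R})
    (d sg T eta : R) (K zeta : R -> 'rV[R]_N -> 'rV[R]_N -> R)
    (b : R -> 'rV[R]_N -> R) (k1 k2 zeta1 zeta2 b0 c C1 C2 : R) :
  0 <= sg -> 0 < T -> 0 < eta -> 0 < k1 -> 0 < zeta1 -> 0 < b0 ->
  admissible_kernel T eta k1 k2 C1 Omega (lebesgue_rV N) K ->
  admissible_kernel T eta zeta1 zeta2 C2 (boundary Omega) mu zeta ->
  admissible_coeff T eta b0 c (boundary Omega) mu b ->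
  forall (t s : R) (u v : LspaceType2 (domain_boundary_measure oO mu)),
  0 <= t <= T -> 0 <= s <= T -> Hs_L2 sg oO mu u -> Hs_L2 sg oO mu v ->
  form_close ((`|C1| / k1 + `|C2| / zeta1 + `|c| / b0) * `|t - s| `^ eta)
    (energy d sg Omega mu K zeta b t u u) (energy d sg Omega mu K zeta b s v v)
    (energy d sg Omega mu K zeta b t u v) (energy d sg Omega mu K zeta b s v u).
Proof.
move=> sg0 T0 eta0 k10 z10 b00 KP zetaP bP t s u v tT sT uH vH.
have mu_ := L2_measurable u; have mv := L2_measurable v.
have mO := open_measurable_rV oO.
have mB := closed_measurable_rV (closed_boundary (A := Omega)).
have mdiff (w : 'rV[R]_N -> R) B : measurable_fun setT w ->
    measurable_fun (B `*` B) (fun z : 'rV[R]_N * 'rV[R]_N => w z.1 - w z.2).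
  move=> mw; apply: measurable_funTS; apply: measurable_funB.
    exact: (measurableT_comp mw measurable_fst).
  exact: (measurableT_comp mw measurable_snd).
have trd (w : LspaceType2 (domain_boundary_measure oO mu)) : Hs_L2 sg oO mu w ->
    {ae (mu \x mu)%E, forall z, (boundary Omega `*` boundary Omega) z ->
      trace Omega w z.1 - trace Omega w z.2 = w z.1 - w z.2}.
  move=> /trace_Hs h; apply: filterS2 (ae_fst mu h) (ae_snd mu h).
  by move=> z h1 h2 [/h1 -> /h2 ->].
have CE x y : x <= y -> x * `|t - s| `^ eta <= y * `|t - s| `^ eta.
  by move=> xy; rewrite ler_wpM2r// powR_ge0.
have c1 : 0 <= `|C1| / k1 by rewrite divr_ge0// ltW.
have c2 : 0 <= `|C2| / zeta1 by rewrite divr_ge0// ltW.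
have c3 : 0 <= `|c| / b0 by rewrite divr_ge0// ltW.
rewrite /energy; apply: form_closeD; first apply: form_closeD.
- apply: form_closeZ; first by rewrite divr_ge0// frac_const_ge0.
  apply: (form_close_le (C := `|C1| / k1 * `|t - s| `^ eta)).
    by apply: CE; lra.
  apply: (kernel_form_close mO T0 eta0 _ KP k10 tT sT (F0 := fun z => u z.1 - u z.2)
    (G0 := fun z => v z.1 - v z.2)) => //; [exact: mdiff|exact: mdiff| |];
    exact: filterE.
- apply: (form_close_le (C := `|c| / b0 * `|t - s| `^ eta)).
    by apply: CE; lra.
  apply: (coeff_form_close mB T0 eta0 bP b00 tT sT (F0 := u) (G0 := v)).
  + exact: measurable_funTS.
  + exact: measurable_funTS.
  + exact: trace_Hs uH.
  + exact: trace_Hs vH.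
- apply: (form_close_le (C := `|C2| / zeta1 * `|t - s| `^ eta)).
    by apply: CE; lra.
  apply: (kernel_form_close mB T0 eta0 _ zetaP z10 tT sT (F0 := fun z => u z.1 - u z.2)
    (G0 := fun z => v z.1 - v z.2)) => //; [exact: mdiff|exact: mdiff| |].
  + exact: trd uH.
  + exact: trd vH.
Qed.

Unset Implicit Arguments.

Theorem theorem3p8 (R : realType) (N : nat) (Omega : set 'rV[R]_N)
    (eps delta : R) (Omega_ : nat -> set 'rV[R]_N) (d : R)
    (mu : {sigma_finite_measure set 'rV[R]_N -> \bar R}) (s T eta : R)
    (K zeta : R -> 'rV[R]_N -> 'rV[R]_N -> R) (b : R -> 'rV[R]_N -> R)
    (k1 k2 zeta1 zeta2 b0 c C1 C2 : R)
    (eps0 : 0 < eps) (delta0 : 0 < delta)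
    (OmegaP : eps_delta_domain eps delta Omega)
    (Omega_bounded : bounded_set Omega)
    (Omega_lipschitz : forall n,
      lipschitz_domain (Omega_ n) /\ bounded_set (Omega_ n))
    (Omega_nondecr : forall n, Omega_ n `<=` Omega_ n.+1)
    (Omega_bigcup : Omega = \bigcup_n Omega_ n)
    (dP : 0 < d <= N%:R) (muP : d_set_measure d (boundary Omega) mu)
    (s01 : 0 < s < 1) (sP : N%:R - d < 2 * s < N%:R)
    (T0 : 0 < T) (etaP : 2^-1 < eta < 1)
    (k1_gt0 : 0 < k1) (k12 : k1 < k2)
    (zeta1_gt0 : 0 < zeta1) (zeta12 : zeta1 < zeta2) (b0_gt0 : 0 < b0)
    (KP : admissible_kernel T eta k1 k2 C1 Omega (lebesgue_rV N) K)
    (zetaP : admissible_kernel T eta zeta1 zeta2 C2 (boundary Omega) mu zeta)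
    (bP : admissible_coeff T eta b0 c (boundary Omega) mu b) :
  let H := L2_domain_boundary (eps_delta_domain_open OmegaP) mu in
  forall A : R -> unbounded_operator H,
    (forall t, 0 <= t <= T ->
      form_operator (@L2dot _ _ _ _)
        (Hs_L2 s (eps_delta_domain_open OmegaP) mu)
        (fun u v => energy d s Omega mu K zeta b t u v) (A t)) ->
  exists2 U : R -> R -> H -> H, evolution_family T A U &
    forall W : R -> R -> H -> H, evolution_family T A W ->
      forall t tau, 0 <= tau <= t -> t <= T -> W t tau = U t tau.
Proof.
move=> H A HA.
have T00 := T0; have /andP[s0 _] := s01; have /andP[eta2 _] := etaP.
have eta0 : 0 < eta by lra.
have hH := L2_hilbert (domain_boundary_measure (eps_delta_domain_open OmegaP) mu).
have sA t : 0 <= t <= T -> selfadjoint (@L2dot _ _ _ _) (A t) by case/HA.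
have nA t : 0 <= t <= T -> nonpositive (@L2dot _ _ _ _) (A t) by case/HA.
set B := `|C1| / k1 + `|C2| / zeta1 + `|c| / b0.
have B0 : 0 <= B by rewrite !addr_ge0// divr_ge0// ltW.
(* The factor 2 makes up for the division by 2 in the abstract estimate, and the 1 keeps the
   constant positive even if [C1], [C2] and [c] vanish. *)
have Aclose t s' (u v : H) : 0 <= t <= T -> 0 <= s' <= T ->
    op_dom (A t) u -> op_dom (A s') v ->
    `|L2dot (A t u) v - L2dot u (A s' v)| <=
    (2 * B + 1) * `|t - s'| `^ eta / 2 * (- L2dot (A t u) u - L2dot (A s' v) v).
  move=> tT sT ut vs.
  have [_ nt ht Et] := HA t tT; have [_ ns hs Es] := HA s' sT.
  have uH := ht _ ut; have vH := hs _ vs.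
  (* On the domains the form identity gives real values to both energies, so that the finiteness
     conditions in [form_close] are met, and it turns the mixed energies into pairings with [A t u]
     and [A s' v]. *)
  have [_ _] := energy_form_close d (ltW s0) T00 eta0 k1_gt0 zeta1_gt0
    b0_gt0 KP zetaP bP tT sT uH vH.
  rewrite (Et u u)// (Es v v)// (Et u v)// (Es v u)// !ltry => /(_ isT isT)[_ _] /=.
  rewrite !(dotNl hH) (dotC hH (A s' v) u) -/B => h.
  have -> : L2dot (A t u) v - L2dot u (A s' v) =
    - (- L2dot (A t u) v - - L2dot u (A s' v)) by ring.
  rewrite normrN (le_trans h)//.
  have := nt _ ut; have := ns _ vs; have := powR_ge0 `|t - s'| eta.
  move=> p0 h1 h2; have : 0 <= `|t - s'| `^ eta * (- L2dot (A t u) u - L2dot (A s' v) v).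
    by rewrite mulr_ge0//; lra.
  lra.
have BB : 0 < 2 * B + 1 by lra.
eexists.
  exact: (evolution_family_ex hH sA nA BB T00 eta2 Aclose).
move=> W hW t tau; apply: (evolution_family_uniq hH nA) => //.
exact: (evolution_family_ex hH sA nA BB T00 eta2 Aclose).
Qed.
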